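(* There exists a constant $0<\varepsilon_0<1$, depending only on $\Delta$ and $\Delta_{\mathcal K}$, such that the following holds. Suppose there exist $\varepsilon_0<\varepsilon<1$ and $0<\kappa<1$ such that $$\varepsilon\le p^v(x,z^v)\le\varepsilon^{-1},\qquad \kappa\le g^v(x^v,y^v)\le\kappa^{-1}\qquad\text{for all } v\in V,\ x,z\in\mathbb X,\ y\in\mathbb Y.$$ Then for every $n\ge 0$, $x\in\mathbb X$, $K\in\mathcal K$ and $J\subseteq K$ (and every number of particles $N\ge1$), $$|\!|\!|\pi_n^x-\hat\pi_n^x|\!|\!|_J\le \alpha\,\operatorname{card}J\left[e^{-\beta_1 d(J,\partial K)}+\frac{e^{\beta_2|\mathcal K|_\infty}}{\sqrt N}\right],$$ where the constants $0<\alpha,\beta_1,\beta_2<\infty$ depend only on $\varepsilon,\kappa,r,\Delta$ and $\Delta_{\mathcal K}$ (in particular not on $n$, on $N$, on $\operatorname{card}V$, or on the observation sequence).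
   Context: Model. $G=(V,E)$ is a finite undirected graph with graph distance $d$ (with $d=+\infty$ if there is no path); $d(J,J')=\min_{v\in J}\min_{v'\in J'}d(v,v')$, with $\min\varnothing=+\infty$ and $e^{-\infty}=0$. Fix an integer $r\ge1$ and let $N(v)=\{v'\in V: d(v,v')\le r\}$. For each $v\in V$, $\mathbb X^v,\mathbb Y^v$ are Polish spaces with reference measures $\psi^v,\varphi^v$; $\mathbb X=\prod_v\mathbb X^v$, $\mathbb Y=\prod_v\mathbb Y^v$, $\psi=\bigotimes_v\psi^v$, $\varphi=\bigotimes_v\varphi^v$; $x^J=(x^j)_{j\in J}$ for $J\subseteq V$. The functions $p^v:\mathbb X\times\mathbb X^v\to\mathbb R_+$ and $g^v:\mathbb X^v\times\mathbb Y^v\to\mathbb R_+$ are measurable transition densities with respect to $\psi^v$ and $\varphi^v$ (i.e. $\int p^v(x,z^v)\psi^v(dz^v)=1$, $\int g^v(x^v,y^v)\varphi^v(dy^v)=1$), and $p^v(x,z^v)$ depends on $x$ only through $x^{N(v)}$. Put $p(x,z)=\prod_v p^v(x,z^v)$, $g(x,y)=\prod_v g^v(x^v,y^v)$. The hidden Markov model has hidden chain $(X_n)$ with transition density $p$ w.r.t. $\psi$ and observations $Y_n$, conditionally independent given $(X_n)$, with density $g(X_n,\cdot)$ w.r.t. $\varphi$. Partition. $\mathcal K$ is a partition of $V$ into nonoverlapping blocks. For $K\in\mathcal{K}$, $\partial K=\{v\in K: N(v)\not\subseteq K\}$. Set $|\mathcal K|_\infty=\max_{K\in\mathcal K}\operatorname{card}K$,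 $\Delta=\max_{v\in V}\operatorname{card}N(v)$, $\Delta_{\mathcal K}=\max_{K\in\mathcal K}\operatorname{card}\{K'\in\mathcal K: d(K,K')\le r\}$. Filters. The observations $Y_1,Y_2,\ldots\in\mathbb Y$ are a fixed sequence. For a probability $\rho$ on $\mathbb X$: $(\mathsf P\rho)(f)=\int f(x')p(x,x')\psi(dx')\rho(dx)$; $(\mathsf C_n\rho)(f)=\int f(x)g(x,Y_n)\rho(dx)/\int g(x,Y_n)\rho(dx)$; $\mathsf B\rho=\bigotimes_{K\in\mathcal K}\mathsf B^K\rho$, where $\mathsf B^K\rho$ is the marginal of $\rho$ on $\mathbb X^K=\prod_{v\in K}\mathbb X^v$; $\mathsf S^N\rho=\frac1N\sum_{i=1}^N\delta_{x(i)}$ with $x(1),\dots,x(N)$ i.i.d. $\sim\rho$ (if $\rho$ is random, sampled conditionally on $\rho$). The nonlinear filter is $\pi_n^x=\mathsf F_n\cdots\mathsf F_1\delta_x$ with $\mathsf F_k=\mathsf C_k\mathsf P$ (so that $\pi^x_n$ is the conditional law of $X_n$ given $Y_1,\ldots,Y_n$ when $X_0=x$), and the block particle filter is the random measure $\hat\pi_n^x=\hat{\mathsf F}_n\cdots\hat{\mathsf F}_1\delta_x$ with $\hat{\mathsf F}_k=\mathsf C_k\mathsf B\mathsf S^N\mathsf P$, with fresh independent samples at each step. Norm. For random probability measures $\rho,\rho'$ on $\mathbb X$, $|\!|\!|\rho-\rho'|\!|\!|_J=\sup_f\mathbf E[|\rho(f)-\rho'(f)|^2]^{1/2}$, the supremum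 being over measurable $f:\mathbb X\to\mathbb R$ with $|f|\le1$ and $f(x)=f(\tilde x)$ whenever $x^J=\tilde x^J$. The expectation is over the random sampling. *)

(* Defs.v *)
From HB Require Import structures.
From mathcomp Require Import all_boot all_order all_algebra.
From mathcomp Require Import all_classical all_reals all_analysis.

Set Implicit Arguments.
Unset Strict Implicit.
Unset Printing Implicit Defensive.

Import Order.TTheory GRing.Theory Num.Theory.
Import numFieldNormedType.Exports.

Local Open Scope classical_set_scope.
Local Open Scope ring_scope.
Local Open Scope ereal_scope.

Section graph.
Context (R : realType) (V : finType) (adj : rel V).

(* [ereal_inf set0 = +oo], so that unreachable vertices are at distance +oo
   and the distance to an empty set is +oo. *)
Definition gdist (v w : V) : \bar R :=
  ereal_inf [set l | exists s : seq V,
    [/\ path adj v s, last v s = w & l = (size s)%:R%:E]].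

Definition set_gdist (J J' : {set V}) : \bar R :=
  ereal_inf [set l | exists v w, [/\ v \in J, w \in J' & l = gdist v w]].

Variable r : nat.

Definition nbhd (v : V) : {set V} :=
  [set w | `[< gdist v w <= r%:R%:E >]]%SET.

Definition boundary (K : {set V}) : {set V} :=
  [set v in K | ~~ (nbhd v \subset K)]%SET.

Definition max_nbhd : nat := (\max_(v : V) #|nbhd v|)%N.

Definition max_block (P : {set {set V}}) : nat := (\max_(K in P) #|K|)%N.

Definition max_block_nbhd (P : {set {set V}}) : nat :=
  (\max_(K in P)
    #|[set K' in P | `[< (set_gdist K K' <= r%:R%:E)%E >]]%SET|)%N.

End graph.

(* Completeness is part of the type; a Hausdorff pseudometric is a metric. *)
Definition polish (R : realType) (T : completePseudoMetricType R) : Prop :=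
  hausdorff_space T /\ exists2 D : set T, countable D & dense D.

Definition borel (T : ptopologicalType) : measurableType (@open T).-sigma :=
  g_sigma_algebraType (@open T).

Section product_space.
Context (I : Type) (d : I -> measure_display)
  (T : forall i, measurableType (d i)).

Definition cylinder : set (set (forall i, T i)) :=
  [set A | exists (i : I) (B : set (T i)),
    measurable B /\ A = (fun x => x i) @^-1` B].

Definition product_space : measurableType cylinder.-sigma :=
  g_sigma_algebraType cylinder.

End product_space.

Section product_measure.
Context (R : realType) (I : finType) (d : I -> measure_display)
  (T : forall i, measurableType (d i)).
Variable m : forall i, set (T i) -> \bar R.

(* Integrates [f] with respect to [m i], successively for the coordinates [i]
   listed in [s]; the other coordinates are frozen to those of [x]. *)
Fixpoint iterated_integral (s : seq I) (f : product_space T -> \bar R)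
    (x : product_space T) : \bar R :=
  if s is i :: s' then
    \int[@m i]_z iterated_integral s' f (dfwith x i z)
  else f x.

(* All coordinates are integrated out, so the base point [point] is irrelevant;
   by Tonelli's theorem so is the order of integration for the measures below,
   which are all finite. *)
Definition product_measure (A : set (product_space T)) : \bar R :=
  iterated_integral (enum I) (fun x => (\1_A x)%:E) point.

End product_measure.

(* The filtering operators act on set functions and not on bundled measures, so
   that they are defined whatever the hypotheses on [p] and [g]. *)

Section operators.
Context (R : realType) (V : finType) (d : V -> measure_display)
  (X : forall v, measurableType (d v)).
Local Notation XX := (product_space X).
Implicit Types (rho : set XX -> \bar R) (A : set XX).

Definition joint_kernel (p : forall v, XX -> X v -> R) (x z : XX) : R :=
  (\prod_(v : V) p v x (z v))%R.

Definition predict (psi : set XX -> \bar R) (p : XX -> XX -> R) rho A : \bar R :=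
  \int[rho]_x \int[psi]_(z in A) (p x z)%:E.

(* [l] is the likelihood function [x |-> g x y] of the observation [y]. *)
Definition correct (l : XX -> R) rho A : \bar R :=
  (\int[rho]_(x in A) (l x)%:E) / (\int[rho]_x (l x)%:E).

Definition block_space (K : {set V}) :=
  product_space (fun v : {v : V | v \in K} => X (val v)).

Definition block_restrict (K : {set V}) (x : XX) : block_space K :=
  fun v => x (val v).

Definition marginal (K : {set V}) rho : set (block_space K) -> \bar R :=
  pushforward rho (@block_restrict K).

Variable P : {set {set V}}.

(* When [P] is a partition of [V], this is the identification of the product of
   all [X v] with the product over the blocks [K] of [P] of [block_space K]. *)
Definition split_blocks (x : XX) :
    product_space (fun K : {K : {set V} | K \in P} => block_space (val K)) :=
  fun K => @block_restrict (val K) x.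

Definition blocking rho A : \bar R :=
  product_measure (fun K : {K : {set V} | K \in P} => @marginal (val K) rho)
    (split_blocks @` A).

Definition empirical (N : nat) (xs : 'I_N -> XX) A : \bar R :=
  (N%:R^-1)%:E * \sum_(i < N) \d_(xs i) A.

End operators.

Definition joint_density (R : realType) (V : finType)
    (dX dY : V -> measure_display) (X : forall v, measurableType (dX v))
    (Y : forall v, measurableType (dY v)) (g : forall v, X v -> Y v -> R)
    (x : product_space X) (y : product_space Y) : R :=
  (\prod_(v : V) g v (x v) (y v))%R.

Section filters.
Context (R : realType) (V : finType) (d : V -> measure_display)
  (X : forall v, measurableType (d v)).
Local Notation XX := (product_space X).
Variables (psi : set XX -> \bar R) (p : XX -> XX -> R).
(* [l n] is the likelihood function of the [n]-th observation; the observations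
   are numbered from 1 and [l 0] is not used. *)
Variable l : nat -> XX -> R.
Variable x0 : XX.

Fixpoint nonlinear_filter (n : nat) : set XX -> \bar R :=
  if n is k.+1 then correct (l k.+1) (predict psi p (nonlinear_filter k))
  else \d_x0.

Context (dO : measure_display) (Omega : measurableType dO)
  (Pr : probability Omega R) (N : nat).

(* Conditionally on the sub-sigma-algebra [G], the variables [xs i] are
   independent and have law [rho]. *)
Definition cond_iid (G : set (set Omega)) (rho : Omega -> set XX -> \bar R)
    (xs : 'I_N -> Omega -> XX) : Prop :=
  (forall i, measurable_fun setT (xs i)) /\
  forall (H : set Omega) (A : 'I_N -> set XX), G H ->
    (forall i, measurable (A i)) ->
    Pr (H `&` [set w | forall i, A i (xs i w)]) =
      \int[Pr]_(w in H) \prod_(i < N) rho w (A i).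

Definition history (xi : nat -> 'I_N -> Omega -> XX) (k : nat) :
    set (set Omega) :=
  <<s [set H | exists (j : nat) (i : 'I_N) (B : set XX),
        [/\ (j < k)%N, measurable B & H = xi j i @^-1` B]] >>.

(* [xi k] is the sample drawn by the sampling operator at time [k.+1], and
   [hpi] the resulting sequence of random measures. *)
Definition block_particle_filter (P : {set {set V}})
    (xi : nat -> 'I_N -> Omega -> XX) (hpi : nat -> Omega -> set XX -> \bar R) :
    Prop :=
  [/\ forall w, hpi 0%N w = \d_x0,
      forall k, cond_iid (history xi k)
        (fun w => predict psi p (hpi k w)) (xi k)
    & forall k w, hpi k.+1 w =
        correct (l k.+1) (blocking P (empirical R (fun i => xi k i w)))].

Definition local_test (J : {set V}) (f : XX -> R) : Prop :=
  [/\ measurable_fun setT f, forall x, (`|f x| <= 1)%R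
    & forall x x' : XX, (forall v, v \in J -> x v = x' v) -> f x = f x'].

Definition local_norm (J : {set V}) (rho rho' : Omega -> set XX -> \bar R) :
    \bar R :=
  ereal_sup [set Lnorm Pr 2%:E (fun w =>
      \int[rho w]_x (f x)%:E - \int[rho' w]_x (f x)%:E) | f in local_test J].

End filters.

(* Main.v *)
(* All laws that occur are densities with respect to a product of probability
   measures, namely the normalised reference measures, whose masses lie between
   [eps] and [eps^-1].  Call such a density good if the mixed differences of its
   logarithm are small, uniformly in the number of sites.  Good densities are
   preserved by the full and by the block filter, and on them the Dobrushin
   comparison theorem turns a bound on the oscillation of [ln h' - ln h] at each
   site into a bound on the averages of local functions.

   Bias: blocking only affects the transitions of the sites that interact with
   another block, so that the oscillation of the logarithmic ratio of the two
   filters at a site [v] of [K] remains of order exp(- beta1 d(v, boundary K)).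

   Variance: the laws produced by replacing the first [k] steps of the block
   filter by the block particle filter are compared for successive [k].  The
   sampling error made at time [k] reaches block [K] at time [k + m] through a tree
   of at most DeltaK ^ m blocks, while the dependence of the root of the tree on
   its leaves contracts by a factor rho ^ m with rho * DeltaK <= 1/2.  At each leaf
   the error is that of a product of empirical block marginals, a V-statistic in
   the particles: two choices of the indices without collisions yield independent
   terms, and the other ones form a fraction O(1/N). *)

From HB Require Import structures.
Require Import Defs.
From mathcomp Require Import all_boot all_order all_algebra.
From mathcomp Require Import all_classical all_reals all_analysis.
From mathcomp Require Import perm measurable_realfun ring lra.

Set Implicit Arguments.
Unset Strict Implicit.
Unset Printing Implicit Defensive.

Import Order.TTheory GRing.Theory Num.Theory.
Import numFieldNormedType.Exports.

Local Open Scope classical_set_scope.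
Local Open Scope ring_scope.

(** * Bounded measurable functions and their means *)

(** A sampling error is small only in mean square and for one test function at a time: the empirical
    law has no density to which the logarithmic comparison used for the bias could be applied. It
    has to enter linearly, through a numerator and a denominator, while the decay in time must come
    from a bound that does not see the starting law. Pinned laws provide this: their logarithmic
    ratios contract uniformly over all starting states, every law propagated from an arbitrary start
    is a mixture of them, and a bound of a numerator by a denominator extends from pinned laws to
    mixtures by positivity. The tree keeps the exponents local: blocks that do not influence [K]
    cancel from every quotient, so that only the size of a block and the number of its neighbours
    are paid for, and not [#|V|]. The threshold must therefore beat the branching of the tree as
    well as the interaction of the sites. Likelihoods are products of one-site functions and leave
    mixed differences unchanged. *)

Section bounded_measurable.
Context (R : realType) d (T : measurableType d).
Implicit Types (f g : T -> R).

(** Boundedness makes a function integrable for every probability at once, so that [mean] is linear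
    without integrability conditions to be carried along. *)
Definition bm f := measurable_fun setT f /\ exists C, forall x, `|f x| <= C.

Lemma bm_meas f : bm f -> measurable_fun setT f. Proof. by case. Qed.

Lemma bm_bound f : bm f -> exists2 C, 0 <= C & forall x, `|f x| <= C.
Proof.
case=> _ [C fC]; exists C => //; exact: le_trans (fC point).
Qed.

Lemma eq_bm f g : f =1 g -> bm f -> bm g.
Proof. by move=> /funext ->. Qed.

Lemma bm_cst c : bm (fun=> c).
Proof. by split; [exact: measurable_cst|exists `|c|]. Qed.

Lemma bmD f g : bm f -> bm g -> bm (fun x => f x + g x).
Proof.
move=> [mf [C fC]] [mg [D gD]]; split; first exact: measurable_funD.
by exists (C + D) => x; rewrite (le_trans (ler_normD _ _))// lerD.
Qed.

Lemma bmN f : bm f -> bm (fun x => - f x).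
Proof.
move=> [mf [C fC]]; split; first exact: measurableT_comp.
by exists C => x; rewrite normrN.
Qed.

Lemma bmB f g : bm f -> bm g -> bm (fun x => f x - g x).
Proof. by move=> bf bg; apply: bmD => //; exact: bmN. Qed.

Lemma bmM f g : bm f -> bm g -> bm (fun x => f x * g x).
Proof.
move=> [mf [C fC]] [mg [D gD]]; split; first exact: measurable_funM.
by exists (C * D) => x; rewrite normrM ler_pM.
Qed.

Lemma bm_abs f : bm f -> bm (fun x => `|f x|).
Proof.
move=> [mf [C fC]]; split; first exact: measurableT_comp.
by exists C => x; rewrite normr_id.
Qed.

Lemma bm_sum (I : Type) (s : seq I) (P : pred I) (F : I -> T -> R) :
  (forall i, P i -> bm (F i)) -> bm (fun x => \sum_(i <- s | P i) F i x).
Proof.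
move=> bF; elim: s => [|i s IH].
  by apply: (@eq_bm (fun=> 0)) => [x|]; [rewrite big_nil|exact: bm_cst].
have [Pi|nPi] := boolP (P i).
  apply: (@eq_bm (fun x => F i x + \sum_(j <- s | P j) F j x)) => [x|].
    by rewrite big_cons Pi.
  by apply: bmD => //; exact: bF.
by apply: eq_bm IH => x; rewrite big_cons (negbTE nPi).
Qed.

Lemma bm_prod (I : Type) (s : seq I) (P : pred I) (F : I -> T -> R) :
  (forall i, P i -> bm (F i)) -> bm (fun x => \prod_(i <- s | P i) F i x).
Proof.
move=> bF; elim: s => [|i s IH].
  by apply: (@eq_bm (fun=> 1)) => [x|]; [rewrite big_nil|exact: bm_cst].
have [Pi|nPi] := boolP (P i).
  apply: (@eq_bm (fun x => F i x * \prod_(j <- s | P j) F j x)) => [x|].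
    by rewrite big_cons Pi.
  by apply: bmM => //; exact: bF.
by apply: eq_bm IH => x; rewrite big_cons (negbTE nPi).
Qed.

Lemma bm_indic (A : set T) : measurable A -> bm (\1_A : T -> R).
Proof.
move=> mA; split; first exact: measurable_indic.
exists 1 => x; rewrite indicE; case: (_ \in _); rewrite ?normr1 ?normr0//.
Qed.

(** Functions that may stand in a denominator: the uniform lower bound survives partial integration
    and keeps the inverse bounded. *)
Definition bpos f := bm f /\ exists2 c, 0 < c & forall x, c <= f x.

Lemma bpos_bm f : bpos f -> bm f. Proof. by case. Qed.

Lemma bpos_gt0 f x : bpos f -> 0 < f x.
Proof. by case=> _ [c c0 cf]; exact: lt_le_trans (cf x). Qed.

Lemma bpos_ge0 f x : bpos f -> 0 <= f x.
Proof. by move=> /(bpos_gt0 x)/ltW. Qed.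

Lemma eq_bpos f g : f =1 g -> bpos f -> bpos g.
Proof. by move=> /funext ->. Qed.

Lemma bpos_cst c : 0 < c -> bpos (fun=> c).
Proof. by move=> c0; split; [exact: bm_cst|exists c]. Qed.

Lemma bposM f g : bpos f -> bpos g -> bpos (fun x => f x * g x).
Proof.
move=> [bf [c c0 cf]] [bg [e e0 eg]]; split; first exact: bmM.
by exists (c * e) => [|x]; rewrite ?mulr_gt0// ler_pM// ltW.
Qed.

Lemma bpos_prod (I : Type) (s : seq I) (P : pred I) (F : I -> T -> R) :
  (forall i, P i -> bpos (F i)) -> bpos (fun x => \prod_(i <- s | P i) F i x).
Proof.
move=> bF; elim: s => [|i s IH].
  by apply: (@eq_bpos (fun=> 1)) => [x|]; [rewrite big_nil|exact: bpos_cst].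
have [Pi|nPi] := boolP (P i).
  apply: (@eq_bpos (fun x => F i x * \prod_(j <- s | P j) F j x)) => [x|].
    by rewrite big_cons Pi.
  by apply: bposM => //; exact: bF.
by apply: eq_bpos IH => x; rewrite big_cons (negbTE nPi).
Qed.

Lemma bposV f : bpos f -> bpos (fun x => (f x)^-1).
Proof.
move=> bf; have [[mf [C fC]] [c c0 cf]] := bf.
have fx0 x : 0 < f x by exact: bpos_gt0.
have C0 : 0 < C by rewrite (lt_le_trans (fx0 point))// (le_trans (ler_norm _)).
split; last first.
  exists C^-1; first by rewrite invr_gt0.
  by move=> x; rewrite lef_pV2 ?posrE// (le_trans (ler_norm _)).
split; last first.
  by exists c^-1 => x; rewrite ger0_norm ?invr_ge0 ?(ltW (fx0 x))// lef_pV2 ?posrE.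
have o0 : open [set y : R | y != 0] by exact: open_neq.
apply: (@measurable_comp _ _ _ _ _ _ [set y : R | y != 0] (@GRing.inv R)) => //.
- exact: open_measurable.
- by move=> _ [x _ <-] /=; rewrite gt_eqF.
- apply: open_continuous_measurable_fun => //.
  by move=> y /set_mem/= y0; exact: inv_continuous.
Qed.

Lemma bm_div f g : bm f -> bpos g -> bm (fun x => f x / g x).
Proof. by move=> bf /bposV/bpos_bm; exact: bmM. Qed.

End bounded_measurable.

Lemma bm_comp (R : realType) d d' (T : measurableType d) (T' : measurableType d')
  (f : T' -> R) (g : T -> T') :
  bm f -> measurable_fun setT g -> bm (fun x => f (g x)).
Proof.
move=> [mf [C fC]] mg; split; first exact: measurableT_comp mf mg.
by exists C.
Qed.

Lemma bpos_comp (R : realType) d d' (T : measurableType d) (T' : measurableType d')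
  (f : T' -> R) (g : T -> T') :
  bpos f -> measurable_fun setT g -> bpos (fun x => f (g x)).
Proof.
by move=> [bf [c c0 cf]] mg; split; [exact: bm_comp bf mg|exists c].
Qed.

Ltac bm_tac := solve [repeat first
  [ done | exact: bm_cst | apply: bmM | apply: bmB | apply: bmD | apply: bm_abs
  | apply: bmN | apply: bpos_bm ] ].

Definition mean (R : realType) d (T : measurableType d) (P : probability T R)
  (f : T -> R) : R := \int[P]_x f x.

Section mean_theory.
Context (R : realType) d (T : measurableType d) (P : probability T R).
Implicit Types (f g : T -> R).

Lemma bm_integrable f : bm f -> P.-integrable setT (EFin \o f).
Proof.
move=> [mf [C fC]]; apply: (@le_integrable _ _ _ _ _ _ _ (EFin \o cst C)) => //.
- exact/measurable_EFinP.
- move=> x _ /=; rewrite lee_fin (le_trans (fC x))//.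
  by rewrite ger0_norm// (le_trans _ (fC x)).
- exact: finite_measure_integrable_cst.
Qed.

Lemma EFin_mean f : bm f -> (mean P f)%:E = (\int[P]_x (f x)%:E)%E.
Proof.
move=> bf; rewrite /mean /Rintegral fineK//.
exact: integrable_fin_num (bm_integrable bf).
Qed.

Lemma eq_mean f g : f =1 g -> mean P f = mean P g.
Proof. by move=> /funext ->. Qed.

Lemma mean_cst c : mean P (fun=> c) = c.
Proof.
rewrite /mean Rintegral_cst//; have /= -> := probability_setT P.
by rewrite mulr1.
Qed.

Lemma meanD f g : bm f -> bm g ->
  mean P (fun x => f x + g x) = mean P f + mean P g.
Proof. by move=> bf bg; rewrite /mean RintegralD//; exact: bm_integrable. Qed.

Lemma meanB f g : bm f -> bm g ->
  mean P (fun x => f x - g x) = mean P f - mean P g.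
Proof. by move=> bf bg; rewrite /mean RintegralB//; exact: bm_integrable. Qed.

Lemma meanZl c f : bm f -> mean P (fun x => c * f x) = c * mean P f.
Proof. by move=> bf; rewrite /mean RintegralZl//; exact: bm_integrable. Qed.

Lemma meanZr c f : bm f -> mean P (fun x => f x * c) = mean P f * c.
Proof. by move=> bf; rewrite /mean RintegralZr//; exact: bm_integrable. Qed.

Lemma mean_sum (I : Type) (s : seq I) (F : I -> T -> R) :
  (forall i, bm (F i)) ->
  mean P (fun x => \sum_(i <- s) F i x) = \sum_(i <- s) mean P (F i).
Proof.
move=> bF; elim: s => [|i s IH].
  by rewrite big_nil -[RHS]mean_cst; apply: eq_mean => x; rewrite big_nil.
rewrite big_cons -IH -meanD//; last by apply: bm_sum => j _; exact: bF.
by apply: eq_mean => x; rewrite big_cons.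
Qed.

Lemma le_mean f g : bm f -> bm g -> (forall x, f x <= g x) ->
  mean P f <= mean P g.
Proof.
by move=> bf bg fg; apply: le_Rintegral => //; exact: bm_integrable.
Qed.

Lemma mean_ge0 f : (forall x, 0 <= f x) -> 0 <= mean P f.
Proof. by move=> f0; apply: Rintegral_ge0. Qed.

Lemma mean_le f c : bm f -> (forall x, f x <= c) -> mean P f <= c.
Proof.
by move=> bf fc; rewrite -(mean_cst c) le_mean//; exact: bm_cst.
Qed.

Lemma mean_ge f c : bm f -> (forall x, c <= f x) -> c <= mean P f.
Proof.
by move=> bf fc; rewrite -(mean_cst c) le_mean//; exact: bm_cst.
Qed.

Lemma mean_norm f : bm f -> `|mean P f| <= mean P (fun x => `|f x|).
Proof. by move=> bf; apply: le_normr_Rintegral => //; exact: bm_integrable. Qed.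

Lemma mean_norm_le f c : bm f -> (forall x, `|f x| <= c) -> `|mean P f| <= c.
Proof.
move=> bf fc; rewrite (le_trans (mean_norm bf))// mean_le//; exact: bm_abs.
Qed.

Lemma mean_gt0 f : bpos f -> 0 < mean P f.
Proof. by move=> [bf [c c0 cf]]; rewrite (lt_le_trans c0)// mean_ge. Qed.

Lemma mean_indic A : measurable A -> (mean P \1_A)%:E = P A.
Proof.
move=> mA; rewrite EFin_mean; last exact: bm_indic.
by rewrite integral_indic// setIT.
Qed.

(** Expansion of the variance, which is nonnegative. *)
Lemma mean_sqr_le f : bm f -> (mean P f) ^+ 2 <= mean P (fun x => f x ^+ 2).
Proof.
move=> bf; set m := mean P f.
have bf2 : bm (fun x => f x ^+ 2).
  by apply: (@eq_bm _ _ _ (fun x => f x * f x)) => [x|]; [rewrite expr2|exact: bmM].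
have : 0 <= mean P (fun x => (f x - m) ^+ 2).
  by apply: mean_ge0 => x; exact: sqr_ge0.
rewrite (@eq_mean _ (fun x => f x ^+ 2 - ((m *+ 2) * f x - m ^+ 2))); last first.
  by move=> x; rewrite sqrrB; ring.
have b1 : bm (fun x => (m *+ 2) * f x) by apply: bmM => //; exact: bm_cst.
rewrite meanB//; last by apply: bmB => //; exact: bm_cst.
rewrite meanB//; last exact: bm_cst.
rewrite mean_cst meanZl// -/m => h.
by rewrite -subr_ge0 (le_trans h)// le_eqVlt; apply/orP; left; apply/eqP; ring.
Qed.

End mean_theory.

(** * Partial means and exchange of integrals *)

Section mean_fubini.
Context (R : realType) d1 d2 (T1 : measurableType d1) (T2 : measurableType d2).

Lemma bm_slice1 (F : T1 -> T2 -> R) x : bm (fun u : T1 * T2 => F u.1 u.2) ->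
  bm (F x).
Proof.
move=> bF; apply: (bm_comp bF (g := fun y => (x, y))).
exact: measurable_pair1.
Qed.

Lemma bm_slice2 (F : T1 -> T2 -> R) y : bm (fun u : T1 * T2 => F u.1 u.2) ->
  bm (fun x => F x y).
Proof.
move=> bF; apply: (bm_comp bF (g := fun x => (x, y))).
exact: measurable_pair2.
Qed.

Lemma bm_integrable2 (P1 : probability T1 R) (P2 : probability T2 R)
    (F : T1 -> T2 -> R) : bm (fun u : T1 * T2 => F u.1 u.2) ->
  (P1 \x P2)%E.-integrable setT (fun u => (F u.1 u.2)%:E).
Proof.
move=> bF; have [mF [C FC]] := bF.
apply/integrable12ltyP; first exact/measurable_EFinP.
have C0 : 0 <= C by apply: le_trans (FC (point, point)).
have int_cst d (T : measurableType d) (P : probability T R) :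
    (\int[P]_y C%:E = C%:E)%E.
  by rewrite (integral_cst P measurableT); have /= -> := probability_setT P; rewrite mule1.
apply: (@le_lt_trans _ _ (\int[P1]_x \int[P2]_y C%:E)%E).
  have mA : measurable_fun setT (fun u : T1 * T2 => `|(F u.1 u.2)%:E|%E).
    by apply: measurableT_comp => //; exact/measurable_EFinP.
  apply: ge0_le_integral => //.
  - by move=> x _; exact: integral_ge0.
  - by apply: (measurable_fun_fubini_tonelli_F (m2 := P2) _ mA) => u.
  - move=> x _; apply: ge0_le_integral => //.
    + exact: (measurableT_comp mA (measurable_pair1 x)).
    + by move=> y _; rewrite lee_fin (FC (x, y)).
by rewrite !int_cst ltry.
Qed.

Lemma bm_mean2 (P2 : probability T2 R) (F : T1 -> T2 -> R) : bm (fun u : T1 * T2 => F u.1 u.2) ->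
  bm (fun x => mean P2 (F x)).
Proof.
move=> bF; have [mF [C FC]] := bF; split.
  (* Measurability of the partial mean does not involve the law on the first factor; a Dirac mass
     serves as a dummy. *)
  have mG := measurable_fubini_F (bm_integrable2 \d_point P2 bF).
  exact: measurableT_comp mG.
exists C => x; apply: mean_norm_le; first exact: bm_slice1 bF.
by move=> y; exact: (FC (x, y)).
Qed.

Lemma bm_mean1 (P1 : probability T1 R) (F : T1 -> T2 -> R) : bm (fun u : T1 * T2 => F u.1 u.2) ->
  bm (fun y => mean P1 (fun x => F x y)).
Proof.
move=> bF; have [mF [C FC]] := bF; split.
  have mG := measurable_fubini_G (bm_integrable2 P1 \d_point bF).
  exact: measurableT_comp mG.
exists C => y; apply: mean_norm_le; first exact: bm_slice2 bF.
by move=> x; exact: (FC (x, y)).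
Qed.

Lemma mean_fubini1 (P1 : probability T1 R) (P2 : probability T2 R)
    (F : T1 -> T2 -> R) : bm (fun u : T1 * T2 => F u.1 u.2) ->
  (\int[(P1 \x P2)%E]_u (F u.1 u.2)%:E)%E =
  (mean P1 (fun x => mean P2 (F x)))%:E.
Proof.
move=> bF; rewrite EFin_mean; last exact: bm_mean2.
rewrite -(integral12_prod_meas1 (bm_integrable2 P1 P2 bF)).
by apply: eq_integral => x _; rewrite EFin_mean//; exact: bm_slice1 bF.
Qed.

Lemma mean_fubini2 (P1 : probability T1 R) (P2 : probability T2 R)
    (F : T1 -> T2 -> R) : bm (fun u : T1 * T2 => F u.1 u.2) ->
  (\int[(P1 \x P2)%E]_u (F u.1 u.2)%:E)%E =
  (mean P2 (fun y => mean P1 (fun x => F x y)))%:E.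
Proof.
move=> bF; rewrite EFin_mean; last exact: bm_mean1.
rewrite -(integral21_prod_meas1 (bm_integrable2 P1 P2 bF)).
by apply: eq_integral => y _; rewrite EFin_mean//; exact: bm_slice2 bF.
Qed.

Lemma mean_fubini (P1 : probability T1 R) (P2 : probability T2 R)
    (F : T1 -> T2 -> R) : bm (fun u : T1 * T2 => F u.1 u.2) ->
  mean P1 (fun x => mean P2 (F x)) = mean P2 (fun y => mean P1 (fun x => F x y)).
Proof. by move=> bF; apply: EFin_inj; rewrite -mean_fubini1// mean_fubini2. Qed.

End mean_fubini.

(** * Products of probability measures *)

Section product_space_theory.
Context (I : finType) (d : I -> measure_display)
  (T : forall i, measurableType (d i)).
Local Notation XX := (product_space T).

Lemma measurable_coord i : measurable_fun setT (fun x : XX => x i).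
Proof.
move=> _ B mB; rewrite setTI; apply: sub_sigma_algebra.
by exists i, B.
Qed.

Lemma measurable_to_product d' (S : measurableType d') (f : S -> XX) :
  (forall i, measurable_fun setT (fun s => f s i)) -> measurable_fun setT f.
Proof.
move=> mf; apply: (@measurability _ _ S XX setT f (@cylinder I d T)) => //.
move=> _ [_ [i [B [mB ->]]] <-].
by have := mf i measurableT B mB.
Qed.

Lemma measurable_dfwith i :
  measurable_fun setT (fun u : XX * T i => dfwith u.1 i u.2 : XX).
Proof.
apply: measurable_to_product => j; have [e|ne] := eqVneq i j.
  subst j; apply: eq_measurable_fun measurable_snd => u _.
  by rewrite dfwithin.
apply: (eq_measurable_fun (fun u : XX * T i => u.1 j)) => [u _|].
  by rewrite dfwithout.
exact: (measurableT_comp (measurable_coord (i:=j))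
  (@measurable_fst _ _ XX (T i))).
Qed.

Lemma measurable_dfwith1 i (x : XX) :
  measurable_fun setT (fun z : T i => dfwith x i z : XX).
Proof. by have := measurableT_comp (measurable_dfwith (i:=i)) (measurable_pair1 x). Qed.

Lemma measurable_dfwith2 i (z : T i) :
  measurable_fun setT (fun x : XX => dfwith x i z : XX).
Proof. by have := measurableT_comp (measurable_dfwith (i:=i)) (measurable_pair2 z). Qed.

Lemma dfwith_same i (x : XX) (y z : T i) :
  dfwith (dfwith x i y) i z = dfwith x i z.
Proof.
by apply: functional_extensionality_dep => j; case: dfwithP => [|k ik];
  [rewrite dfwithin|rewrite !dfwithout].
Qed.

Lemma dfwith_id i (x : XX) : dfwith x i (x i) = x.
Proof. by apply: functional_extensionality_dep => j; case: dfwithP. Qed.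

Lemma dfwithC i j (x : XX) (y : T i) (z : T j) : i != j ->
  dfwith (dfwith x i y) j z = dfwith (dfwith x j z) i y.
Proof.
move=> ij; apply: functional_extensionality_dep => k.
have [e|ik] := eqVneq i k.
  by subst k; rewrite dfwithout 1?eq_sym// !dfwithin.
have [e|jk] := eqVneq j k; first by subst k; rewrite dfwithin dfwithout// dfwithin.
by rewrite !dfwithout.
Qed.

Definition box (A : forall i, set (T i)) : set XX :=
  [set x | forall i, A i (x i)].

Definition boxes : set (set XX) :=
  [set B | exists2 A : forall i, set (T i), (forall i, measurable (A i)) & B = box A].

Lemma boxT : box (fun=> setT) = setT.
Proof. by apply/seteqP; split. Qed.

Lemma measurable_box A : (forall i, measurable (A i)) -> measurable (box A).
Proof.
move=> mA; have -> : box A = \bigcap_(i in [set: I]) ((fun x : XX => x i) @^-1` A i).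
  by apply/seteqP; split => [x Ax i _|x Ax i]; [exact: Ax|exact: Ax].
apply: fin_bigcap_measurable; first exact: finite_finset.
move=> i _.
by have := @measurable_coord i measurableT _ (mA i); rewrite setTI.
Qed.

Lemma boxes_setI : setI_closed boxes.
Proof.
move=> _ _ [A mA ->] [B mB ->]; exists (fun i => A i `&` B i).
  by move=> i; exact: measurableI.
by apply/seteqP; split => [x [Ax Bx] i|x ABx]; [split|split=> i; case: (ABx i)].
Qed.

(** Boxes, unlike cylinders, are stable under intersection, which the uniqueness of measures
    requires of a generating class. *)
Lemma measurable_boxes : @measurable _ XX = <<s boxes >>.
Proof.
apply/seteqP; split; last first.
  apply: smallest_sub; first exact: sigma_algebra_measurable.
  by move=> _ [A mA ->]; exact: measurable_box.
apply: smallest_sub; first exact: smallest_sigma_algebra.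
move=> _ [i [B [mB ->]]]; apply: sub_sigma_algebra.
exists (dfwith (fun j => [set: T j]) i B).
  by move=> j; case: dfwithP.
apply/seteqP; split => [x Bx j|x /(_ i)]; first by case: dfwithP.
by rewrite dfwithin.
Qed.

End product_space_theory.

Section product_probability.
Context (R : realType) (I : finType) (d : I -> measure_display)
  (T : forall i, measurableType (d i)) (psi : forall i, probability (T i) R).
Local Notation XX := (product_space T).
Local Open Scope ereal_scope.
Local Notation iter := (iterated_integral (fun i => psi i)).

Lemma iterated_integral_nneg (s : seq I) (f : XX -> \bar R) :
  measurable_fun setT f -> (forall x, 0 <= f x) ->
  measurable_fun setT (iter s f) /\ forall x, 0 <= iter s f x.
Proof.
move=> mf f0; elim: s => [|i s [mh h0]] //=; split.
  apply: (measurable_fun_fubini_tonelli_F (m2 := psi i)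
    (fun u : XX * T i => iter s f (dfwith u.1 i u.2))) => //.
  exact: measurableT_comp mh (@measurable_dfwith _ _ _ i).
by move=> x; exact: integral_ge0.
Qed.

(** Monotone convergence at each of the successive integrations. *)
Let iter_nneseries (s : seq I) (f : nat -> XX -> \bar R) :
  (forall n, measurable_fun setT (f n)) -> (forall n x, 0 <= f n x) ->
  forall x, iter s (fun x => \sum_(0 <= n <oo) f n x) x =
    \sum_(0 <= n <oo) iter s (f n) x.
Proof.
move=> mf f0; elim: s => [//|i s IH] x /=.
under eq_integral do rewrite IH.
rewrite integral_nneseries// => n.
  have [mh _] := iterated_integral_nneg s (mf n) (f0 n).
  exact: measurableT_comp mh (@measurable_dfwith1 _ _ _ i x).
by move=> z _; have [_ ->] := iterated_integral_nneg s (mf n) (f0 n).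
Qed.

Let PPf : set XX -> \bar R := product_measure psi.

Let PP0 : PPf set0 = 0.
Proof.
rewrite /PPf /product_measure; elim: (enum I) point => [|i s IH] x /=.
  by rewrite indic0.
by rewrite integral0_eq.
Qed.

Let PP_ge0 A : 0 <= PPf A.
Proof.
rewrite /PPf /product_measure; elim: (enum I) point => [|i s IH] x /=.
  by rewrite lee_fin.
by rewrite integral_ge0.
Qed.

Let PP_sigma_additive : semi_sigma_additive PPf.
Proof.
move=> F mF tF mUF; rewrite /PPf /product_measure.
have -> : (fun x : XX => (\1_(\bigcup_n F n) x : R)%:E) =
    (fun x : XX => \sum_(0 <= n <oo) (\1_(F n) x : R)%:E).
  by apply/funext => x; rewrite indic_bigcup.
rewrite iter_nneseries//; last first.
  by move=> n; apply/measurable_EFinP/measurable_indic.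
apply: is_cvg_nneseries => n _ _.
have [|x|_ h] := @iterated_integral_nneg (enum I) (fun x => (\1_(F n) x)%:E).
- by apply/measurable_EFinP/measurable_indic.
- by rewrite lee_fin.
- exact: h.
Qed.

Definition prodP : set XX -> \bar R := product_measure psi.

HB.instance Definition _ := isMeasure.Build _ _ _ prodP
  PP0 PP_ge0 PP_sigma_additive.

(** The coordinates in [s] have been integrated and contribute their masses; the others keep an
    indicator, which is trivially 1 once [s] lists all of [I]. *)
Let iter_box (A : forall i, set (T i)) (s : seq I) x :
  (forall i, measurable (A i)) -> uniq s ->
  iter s (fun x => (\1_(box A) x)%:E) x =
    (\prod_(i <- s) psi i (A i)) *
      (\1_[set x : XX | forall j, j \notin s -> A j (x j)] x)%:E.
Proof.
move=> mA; elim: s x => [|i s IH] x /=.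
  rewrite big_nil mul1e => _; congr (\1_ _ x)%:E.
  by apply/seteqP; split => y Ay j => [_|]; exact: Ay.
move=> /andP[nis us]; under eq_integral do rewrite IH//.
set S := [set x : XX | _]; set S' := [set x : XX | _].
have E z : (\1_S (dfwith x i z) : R) = (\1_(A i) z * \1_S' x)%R.
  rewrite -(_ : \1_(A i `*` S') (z, x) = \1_(A i) z * \1_S' x)%R; last first.
    by rewrite !indicE in_setX/=; case: (_ \in A i); case: (_ \in S'); rewrite ?mulr0 ?mul0r ?mulr1.
  rewrite !indicE; congr (nat_of_bool _)%:R; apply/idP/idP; rewrite !inE.
    move=> Sz; split => /=; first by have := Sz i nis; rewrite dfwithin.
    move=> j; rewrite inE negb_or => /andP[ji js].
    by have := Sz j js; rewrite dfwithout// eq_sym.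
  move=> [/= Az S'x] j js; have [e|ne] := eqVneq i j.
    by subst j; rewrite dfwithin.
  by rewrite dfwithout//; apply: S'x; rewrite inE negb_or eq_sym ne.
under eq_integral do rewrite E EFinM.
have p0 : 0 <= \prod_(j <- s) psi j (A j).
  by apply: prode_ge0 => j _.
have pf : \prod_(j <- s) psi j (A j) \is a fin_num.
  elim: (s) => [|j s' IHs]; first by rewrite big_nil.
  by rewrite big_cons fin_numM// fin_num_measure.
rewrite -(fineK pf).
under eq_integral do rewrite -!EFinM mulrCA EFinM.
rewrite ge0_integralZr//=; last 2 first.
- by apply/measurable_EFinP/measurable_indic.
- by rewrite lee_fin mulr_ge0// fine_ge0.
rewrite integral_indic// setIT big_cons EFinM fineK// muleA//.
Qed.

Lemma prodP_box (A : forall i, set (T i)) : (forall i, measurable (A i)) ->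
  prodP (box A) = \prod_i psi i (A i).
Proof.
move=> mA; rewrite /prodP /product_measure [LHS]iter_box ?enum_uniq//.
rewrite big_enum/= indicE mem_set ?mule1//.
by move=> j; rewrite mem_enum.
Qed.

Let PP_setT : prodP setT = 1.
Proof.
rewrite -boxT prodP_box//; rewrite big1// => i _.
exact: probability_setT.
Qed.

HB.instance Definition _ := Measure_isProbability.Build _ _ _ prodP PP_setT.

End product_probability.

Section mean_change.
Context (R : realType).

Lemma eq_mean_measure d (T : measurableType d) (P Q : probability T R) f :
  (forall A, measurable A -> P A = Q A) -> mean P f = mean Q f.
Proof.
move=> PQ; rewrite /mean /Rintegral; congr fine.
by apply: eq_measure_integral => A mA _; exact: PQ.
Qed.

Definition image_prob d d' (T : measurableType d) (T' : measurableType d')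
    (P : probability T R) (X : T -> T') (mX : measurable_fun setT X) :
    probability T' R :=
  distribution P (mfun_Sub (mem_set mX)).

Lemma image_probE d d' (T : measurableType d) (T' : measurableType d')
    (P : probability T R) (X : T -> T') (mX : measurable_fun setT X) A :
  image_prob P mX A = P (X @^-1` A).
Proof. by []. Qed.

Lemma mean_image d d' (T : measurableType d) (T' : measurableType d')
    (P : probability T R) (X : T -> T') (mX : measurable_fun setT X) f :
  bm f -> mean (image_prob P mX) f = mean P (fun x => f (X x)).
Proof.
move=> bf; have bfX := bm_comp bf mX.
apply: EFin_inj; rewrite !EFin_mean//.
rewrite /image_prob integral_distribution//.
- by apply/measurable_EFinP; case: bf.
- exact: bm_integrable bfX.
Qed.

Lemma box_unique (I : finType) (d : I -> measure_display)
    (T : forall i, measurableType (d i)) (P Q : probability (product_space T) R) :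
  (forall A, (forall i, measurable (A i)) -> P (box A) = Q (box A)) ->
  forall B, measurable B -> P B = Q B.
Proof.
move=> PQ B mB.
apply: (g_sigma_algebra_measure_unique (@boxes I d T) _ (fun=> setT)) => //.
- by move=> _ [A mA ->]; exact: measurable_box.
- by move=> _; exists (fun=> setT); rewrite // boxT.
- by rewrite bigcup_const.
- exact: boxes_setI.
- by move=> _ [A mA ->]; exact: PQ.
- by move=> _; rewrite (le_lt_trans (probability_le1 _ _))// ltry.
- by rewrite -measurable_boxes.
Qed.

End mean_change.

(** * Integrating out coordinates of a product law *)

Section product_mean.
Context (R : realType) (V : finType) (d : V -> measure_display)
  (T : forall v, measurableType (d v)) (psi : forall v, probability (T v) R).
Local Notation XX := (product_space T).
Local Notation PP := (prodP psi : probability XX R).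
Implicit Types (f g : XX -> R) (S : {set V}).

Definition Ev v f (x : XX) : R := mean (psi v) (fun z => f (dfwith x v z)).

Lemma bm_dfwith v f : bm f ->
  bm (fun u : XX * T v => f (dfwith u.1 v u.2)).
Proof. by move=> bf; apply: bm_comp bf _; exact: measurable_dfwith. Qed.

Lemma bm_dfwith1 v f (x : XX) : bm f -> bm (fun z : T v => f (dfwith x v z)).
Proof. by move=> bf; apply: bm_comp bf _; exact: measurable_dfwith1. Qed.

Lemma bpos_dfwith1 v f (x : XX) : bpos f -> bpos (fun z : T v => f (dfwith x v z)).
Proof. by move=> bf; apply: bpos_comp bf _; exact: measurable_dfwith1. Qed.

Lemma bm_Ev v f : bm f -> bm (Ev v f).
Proof.
move=> bf; have := bm_mean2 (psi v) (F := fun (x : XX) z => f (dfwith x v z))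
  (bm_dfwith v bf).
by [].
Qed.

(** Resampling one coordinate preserves a product law: on a box the old coordinate is freed and has
    mass 1, and the new one supplies the missing factor. *)
Lemma mean_Ev v f : bm f -> mean PP (Ev v f) = mean PP f.
Proof.
move=> bf; pose Q := image_prob (PP \x psi v)%E (@measurable_dfwith _ _ T v).
have -> : mean PP f = mean Q f.
  apply: eq_mean_measure; apply: box_unique => A mA.
  transitivity (\prod_v psi v (A v))%E; first exact: prodP_box.
  rewrite [RHS]image_probE.
  have -> : (fun u : XX * T v => dfwith u.1 v u.2) @^-1` box A =
      box (dfwith A v setT) `*` A v.
    apply/seteqP; split => [[x z] /= Axz|[x z] /= [Ax Az] j].
      split=> [j|]; last by have := Axz v; rewrite dfwithin.
      by case: dfwithP => // j' vj'; have := Axz j'; rewrite dfwithout.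
    have [e|vj] := eqVneq v j; first by subst j; rewrite dfwithin.
    by have := Ax j; rewrite !dfwithout.
  have mA' j : measurable (dfwith A v setT j) by case: dfwithP.
  have mB : measurable (box (dfwith A v setT)) by exact: measurable_box.
  transitivity (PP (box (dfwith A v setT)) * psi v (A v))%E; last first.
    by apply/esym; exact: product_measure1E.
  transitivity ((\prod_j psi j (dfwith A v setT j)) * psi v (A v))%E; last first.
    by congr (_ * _)%E; apply/esym; exact: prodP_box.
  rewrite (bigD1 v)//= [in RHS](bigD1 v)//= dfwithin.
  have /= -> := probability_setT (psi v).
  rewrite mul1e muleC; congr (_ * _)%E.
  by apply: eq_bigr => j jv; rewrite dfwithout// eq_sym.
rewrite mean_image//; apply: EFin_inj.
rewrite [RHS]EFin_mean; last exact: (bm_dfwith v bf).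
by rewrite (mean_fubini1 PP (psi v) (F := fun (x : XX) z => f (dfwith x v z)))//; exact: (bm_dfwith v bf).
Qed.

Definition loc S f := forall x x' : XX, (forall v, v \in S -> x v = x' v) ->
  f x = f x'.

Lemma loc_cst S c : loc S (fun=> c). Proof. by []. Qed.

Lemma locS S S' f : S \subset S' -> loc S f -> loc S' f.
Proof. by move=> /fintype.subsetP SS' lf x x' xx'; apply: lf => v /SS'; exact: xx'. Qed.

Lemma locM S f g : loc S f -> loc S g -> loc S (fun x => f x * g x).
Proof. by move=> lf lg x x' xx'; rewrite (lf x x')// (lg x x'). Qed.

Lemma loc_prod (I : Type) (s : seq I) (P : pred I) S (F : I -> XX -> R) :
  (forall i, P i -> loc S (F i)) -> loc S (fun x => \prod_(i <- s | P i) F i x).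
Proof. by move=> lF x x' xx'; apply: eq_bigr => i Pi; exact: lF. Qed.

Lemma loc_dfwith S f v (x : XX) z : loc S f -> v \notin S ->
  f (dfwith x v z) = f x.
Proof.
move=> lf vS; apply: lf => w wS; rewrite dfwithout//.
by apply: contraNneq vS => ->.
Qed.

Lemma loc_Ev S f v : loc S f -> loc (S :\ v)%SET (Ev v f).
Proof.
move=> lf x x' xx'; apply: eq_mean => z; apply: lf => w wS.
have [e|vw] := eqVneq v w; first by subst w; rewrite !dfwithin.
by rewrite !dfwithout//; apply: xx'; rewrite in_setD1 eq_sym vw.
Qed.

Lemma EvM S f g v : loc S g -> v \notin S -> bm f ->
  Ev v (fun x => f x * g x) =1 (fun x => Ev v f x * g x).
Proof.
move=> lg vS bf x; rewrite /Ev -meanZr; last exact: bm_dfwith1.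
by apply: eq_mean => z; rewrite (loc_dfwith _ _ lg vS).
Qed.

Definition Evs (s : seq V) f : XX -> R := foldr Ev f s.

Lemma bm_Evs s f : bm f -> bm (Evs s f).
Proof. by move=> bf; elim: s => //= v s IH; exact: bm_Ev. Qed.

Lemma mean_Evs s f : bm f -> mean PP (Evs s f) = mean PP f.
Proof.
by move=> bf; elim: s => //= v s IH; rewrite mean_Ev//; exact: bm_Evs.
Qed.

Lemma loc_Evs S f s : loc S f -> loc (S :\: [set v in s])%SET (Evs s f).
Proof.
move=> lf; elim: s => [|v s IH] /=.
  by apply: locS lf; apply/fintype.subsetP => v; rewrite !inE.
apply: locS (loc_Ev (v := v) IH).
by apply/fintype.subsetP => w; rewrite !inE negb_or => /and3P[-> -> ->].
Qed.

Lemma EvsM S f g s : loc S g -> (forall v, v \in s -> v \notin S) -> bm f ->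
  Evs s (fun x => f x * g x) =1 (fun x => Evs s f x * g x).
Proof.
move=> lg sS bf; elim: s sS => //= v s IH sS x.
rewrite -(EvM lg)//; last 2 first.
- by apply: sS; rewrite inE eqxx.
- exact: bm_Evs.
congr (Ev v _ x); apply/funext => y; apply: IH => w ws.
by apply: sS; rewrite inE ws orbT.
Qed.

Lemma Evs_loc S f x : loc S f -> bm f -> Evs (enum S) f x = mean PP f.
Proof.
move=> lf bf; rewrite -(mean_Evs (enum S) bf) -[LHS](mean_cst PP).
apply: eq_mean => y; apply: (loc_Evs (s := enum S) lf) => v.
by rewrite !inE mem_enum; case: (v \in S).
Qed.

(** Integrating out the coordinates in [S] turns [f] into its mean and leaves [g] untouched. *)
Lemma mean_indep S f g : loc S f -> loc (~: S)%SET g -> bm f -> bm g ->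
  mean PP (fun x => f x * g x) = mean PP f * mean PP g.
Proof.
move=> lf lg bf bg; rewrite -(mean_Evs (enum S)); last exact: bmM.
rewrite -meanZl//; apply: eq_mean => x; rewrite (EvsM lg)//; last first.
  by move=> v; rewrite mem_enum !inE negbK.
by rewrite (Evs_loc _ lf).
Qed.

Definition upd S (x y : XX) : XX := fun v => if v \in S then y v else x v.

Lemma measurable_upd S :
  measurable_fun setT (fun u : XX * XX => upd S u.1 u.2).
Proof.
apply: measurable_to_product => v; rewrite /upd /=; case: (v \in S).
  by have := measurableT_comp (@measurable_coord _ _ T v)
    (@measurable_snd _ _ XX XX).
by have := measurableT_comp (@measurable_coord _ _ T v)
    (@measurable_fst _ _ XX XX).
Qed.

End product_mean.

(** * Averages under an unnormalised density *)

Definition wavg (R : realType) d (T : measurableType d) (P : probability T R)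
  (k f : T -> R) : R := mean P (fun x => f x * k x) / mean P k.

Section weighted_average.
Context (R : realType) d (T : measurableType d) (P : probability T R).
Implicit Types (f g k : T -> R).

Lemma wavgK k f : bpos k -> wavg P k f * mean P k = mean P (fun x => f x * k x).
Proof. by move=> /(mean_gt0 P) k0; rewrite /wavg divfK// gt_eqF. Qed.

Lemma wavg_cst k c : bpos k -> wavg P k (fun=> c) = c.
Proof.
move=> bk; have k0 := mean_gt0 P bk.
by rewrite /wavg meanZl; [rewrite mulfK// gt_eqF|exact: bpos_bm].
Qed.

Lemma wavgB k f g : bpos k -> bm f -> bm g ->
  wavg P k (fun x => f x - g x) = wavg P k f - wavg P k g.
Proof.
move=> /bpos_bm bk bf bg; rewrite /wavg -mulrBl -meanB; [|exact: bmM..].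
by congr (_ / _); apply: eq_mean => x; rewrite mulrBl.
Qed.

Lemma le_wavg k f g : bpos k -> bm f -> bm g -> (forall x, f x <= g x) ->
  wavg P k f <= wavg P k g.
Proof.
move=> bk bf bg fg; have k0 := mean_gt0 P bk.
rewrite /wavg ler_pM2r ?invr_gt0//; have [bk' _] := bk.
by apply: le_mean; [exact: bmM..|move=> x; rewrite ler_wpM2r// (bpos_ge0 x bk)].
Qed.

Lemma wavg_le k f c : bpos k -> bm f -> (forall x, f x <= c) -> wavg P k f <= c.
Proof.
by move=> bk bf fc; rewrite -(wavg_cst c bk) le_wavg//; exact: bm_cst.
Qed.

Lemma wavg_ge k f c : bpos k -> bm f -> (forall x, c <= f x) -> c <= wavg P k f.
Proof.
by move=> bk bf fc; rewrite -(wavg_cst c bk) le_wavg//; exact: bm_cst.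
Qed.

Lemma wavg_norm_le k f c : bpos k -> bm f -> (forall x, `|f x| <= c) ->
  `|wavg P k f| <= c.
Proof.
move=> bk bf fc; rewrite ler_norml wavg_ge ?wavg_le// => x;
  by have := fc x; rewrite ler_norml => /andP[].
Qed.

Lemma wavg_osc k f y c : bpos k -> bm f -> (forall x, `|f x - f y| <= c) ->
  `|wavg P k f - f y| <= c.
Proof.
move=> bk bf fc; rewrite -(wavg_cst (f y) bk) -wavgB//; last exact: bm_cst.
by apply: wavg_norm_le => //; apply: bmB => //; exact: bm_cst.
Qed.

(* The hypothesis on [k] and [k'] bounds the oscillation of [k' / k] by the
   factor [E]; normalising [k] to the mass of [k'] turns it into a pointwise
   relative error [E - 1]. *)
Lemma wavg_reweight k k' f E c : bpos k -> bpos k' -> bm f -> 1 <= E ->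
  (forall z z0, k' z * k z0 <= E * (k z * k' z0)) ->
  (forall z z0, `|f z - f z0| <= c) ->
  `|wavg P k f - wavg P k' f| <= (E - 1) * c.
Proof.
move=> bk bk' bf E1 kk' fc; have [bmk _] := bk; have [bmk' _] := bk'.
have k0 := mean_gt0 P bk; have k'0 := mean_gt0 P bk'.
set m := wavg P k f.
have fm x : `|f x - m| <= c by rewrite distrC; exact: wavg_osc.
have bfm : bm (fun x => f x - m) by apply: bmB => //; exact: bm_cst.
(* Centring [f] at its [k]-average removes every multiple of [k] from the error. *)
have m0 : mean P (fun x => (f x - m) * k x) = 0.
  rewrite -wavgK// wavgB//; last exact: bm_cst.
  by rewrite wavg_cst// subrr mul0r.
set r := mean P k' / mean P k.
have r0 : 0 < r by rewrite divr_gt0.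
have le1 z : k' z <= E * (r * k z).
  have : k' z * mean P k <= E * (k z * mean P k').
    rewrite -!meanZl//; last exact: bmM (bm_cst _ _) bmk'.
    by apply: le_mean => //; bm_tac.
  by rewrite -ler_pdivlMr//; congr (_ <= _); rewrite /r; ring.
have le2 z : r * k z <= E * k' z.
  have : mean P k' * k z <= E * (mean P k * k' z).
    rewrite -!meanZr//; rewrite -meanZl; last by apply: bmM => //; exact: bm_cst.
    by apply: le_mean => //; bm_tac.
  by rewrite mulrCA -ler_pdivrMl// /r; congr (_ <= _); ring.
have rk0 z : 0 <= r * k z by rewrite mulr_ge0// ?ltW// (bpos_gt0 z bk).
have dk z : `|k' z - r * k z| <= (E - 1) * (r * k z).
  have := le1 z; have := le2 z; have := rk0 z; have := bpos_ge0 z bk'.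
  rewrite ler_norml; set a := r * k z; set b := k' z => b0 a0 h1 h2.
  apply/andP; split; last lra.
  have : a * E <= E * E * b by rewrite -mulrA mulrC ler_wpM2l// (le_trans ler01).
  (* The lower half of the bound amounts to [2 - E <= E^-1], that is [(E - 1) ^+ 2 >= 0]; for
     [E > 2] it is trivial. *)
  move=> h3; suff: (2 - E) * a <= b by lra.
  have [E2|E2] := leP E 2; last first.
    by rewrite (le_trans _ b0)// mulr_le0_ge0//; lra.
  have h4 : (2 - E) * a <= (2 - E) * (E * b) by rewrite ler_wpM2l// subr_ge0.
  have h5 : 0 <= (E - 1) ^+ 2 * b by rewrite mulr_ge0// sqr_ge0.
  by apply: (le_trans h4); rewrite -subr_ge0 (le_trans h5)// le_eqVlt;
    apply/orP; left; apply/eqP; ring.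
have -> : m - wavg P k' f = - wavg P k' (fun x => f x - m).
  by rewrite wavgB// ?wavg_cst// ?opprB//; exact: bm_cst.
rewrite normrN /wavg normrM normfV (gtr0_norm k'0) ler_pdivrMr//.
have -> : mean P (fun x => (f x - m) * k' x) =
    mean P (fun x => (f x - m) * (k' x - r * k x)).
  rewrite -[LHS]subr0 -[X in _ - X](mulr0 r) -m0 -meanZl; last exact: bmM.
  rewrite -meanB; [|exact: bmM|by apply: bmM; [exact: bm_cst|exact: bmM]].
  by apply: eq_mean => x; ring.
have bd : bm (fun x => k' x - r * k x) by apply: bmB => //; apply: bmM => //; exact: bm_cst.
apply: le_trans (mean_norm _ _) _; first exact: bmM.
have -> : (E - 1) * c * mean P k' = mean P (fun x => c * ((E - 1) * (r * k x))).
  rewrite meanZl; last by bm_tac.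
  rewrite meanZl; last by bm_tac.
  by rewrite meanZl// /r divfK ?gt_eqF//; ring.
apply: le_mean.
- by apply: bm_abs; exact: bmM.
- by bm_tac.
by move=> x; rewrite normrM ler_pM.
Qed.

End weighted_average.

(** * The Dobrushin comparison theorem *)

Lemma le_geometric (R : realType) (x a b q : R) : 0 <= q < 1 ->
  (forall k, x <= a + q ^+ k * b) -> x <= a.
Proof.
move=> /andP[q0 q1] xk.
have c : (fun k => a + q ^+ k * b) @ \oo --> a + 0 * b.
  by apply: cvgD; [exact: cvg_cst|apply: cvgMl; apply: cvg_expr; rewrite ger0_norm].
rewrite -[a](addr0) -(mul0r b).
rewrite -(cvg_lim _ c)//; apply: limr_ge; [exact: cvgP c|exact: nearW].
Qed.

Section gibbs_comparison.
Context (R : realType) (V : finType) (d : V -> measure_display)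
  (T : forall v, measurableType (d v)) (psi : forall v, probability (T v) R).
Local Notation XX := (product_space T).
Local Notation PP := (prodP psi : probability XX R).
Implicit Types (f g h : XX -> R) (S : {set V}) (dl u D : V -> R) (M : V -> V -> R).

Definition osc f dl := forall v (x : XX) z, `|f (dfwith x v z) - f x| <= dl v.

(* The mixed difference of [ln h] in the coordinates [v] and [w] is at most
   [M v w] in absolute value. *)
Definition mixed_bound h M := forall v w (x : XX) y z, v != w ->
  h (dfwith (dfwith x w y) v z) * h x <=
  expR (M v w) * (h (dfwith x w y) * h (dfwith x v z)).

(* The oscillation of [ln h' - ln h] in the coordinate [v] is at most [D v]. *)
Definition ratio_bound h h' D := forall v (x : XX) z,
  h' (dfwith x v z) * h x <= expR (D v) * (h (dfwith x v z) * h' x).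

(** Conditional expectation of [f] given all coordinates but [v], under the density [h]: one
    heat-bath update of the site [v]. *)
Definition cond_avg h v f (x : XX) : R :=
  wavg (psi v) (fun z => h (dfwith x v z)) (fun z => f (dfwith x v z)).

Lemma osc_ge0 f dl v : osc f dl -> 0 <= dl v.
Proof. by move=> of_; apply: le_trans (of_ v point point). Qed.

(** The coordinates of [x] are turned into those of [y] one at a time. *)
Lemma osc_total f dl : osc f dl -> forall x y, `|f x - f y| <= \sum_v dl v.
Proof.
move=> of_ x y; pose upds (s : seq V) : XX := foldr (fun v (a : XX) => dfwith a v (y v)) x s.
have uE s v : upds s v = if v \in s then y v else x v.
  elim: s => //= w s IH; rewrite inE; have [<-|wv] := eqVneq w v.
    by rewrite dfwithin.
  by rewrite dfwithout// IH.
have -> : y = upds (enum V).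
  by apply: functional_extensionality_dep => v; rewrite uE mem_enum.
rewrite distrC -big_enum; elim: (enum V) => [|v s IH] /=.
  by rewrite big_nil subrr normr0.
rewrite big_cons; apply: le_trans (ler_distD (f (upds s)) _ _) _.
by rewrite lerD//; exact: of_.
Qed.

Lemma bm_cond_avg h v f : bpos h -> bm f -> bm (cond_avg h v f).
Proof.
move=> bh bf; have [bmh [c c0 ch]] := bh.
have b1 : bm (Ev psi v (fun x => f x * h x)) by apply: bm_Ev; exact: bmM.
have b2 : bpos (Ev psi v h).
  split; first exact: bm_Ev.
  by exists c => // x; apply: mean_ge; [exact: bm_dfwith1|].
exact: bm_div b1 b2.
Qed.

Lemma cond_avg_same h v f x z : cond_avg h v f (dfwith x v z) = cond_avg h v f x.
Proof.
by rewrite /cond_avg; congr (wavg _ _ _); apply/funext => y; rewrite dfwith_same.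
Qed.

Lemma wavg_cond_avg h v f : bpos h -> bm f ->
  wavg PP h (cond_avg h v f) = wavg PP h f.
Proof.
move=> bh bf; have bmh := bpos_bm bh.
have bc := bm_cond_avg v bh bf.
congr (_ / _); rewrite -(mean_Ev psi v (bmM bf bmh)) -(mean_Ev psi v (bmM bc bmh)).
apply: eq_mean => x; rewrite /Ev.
under [in LHS]eq_mean do rewrite cond_avg_same.
rewrite meanZl; last exact: bm_dfwith1.
by rewrite wavgK//; exact: bpos_dfwith1.
Qed.

(** The coordinate [w] acts twice: directly through [f], and through the conditional law at [v]. The
    mixed difference bounds the dependence of that law on [w], and only the oscillation of [f] at
    [v] is exposed to it. *)
Lemma cond_avg_osc h f dl M v : bpos h -> bm f -> osc f dl ->
  mixed_bound h M -> (forall w, 0 <= M v w) ->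
  osc (cond_avg h v f)
    (fun w => if w == v then 0 else dl w + (expR (M v w) - 1) * dl v).
Proof.
move=> bh bf of_ hM M0 w x y; have [e|wv] := eqVneq w v.
  by subst w; rewrite cond_avg_same subrr normr0.
set k := fun z => h (dfwith x v z); set k' := fun z => h (dfwith (dfwith x w y) v z).
have bk : bpos k by exact: bpos_dfwith1.
have bk' : bpos k' by exact: bpos_dfwith1.
have b1 : bm (fun z => f (dfwith x v z)) by exact: bm_dfwith1.
have b2 : bm (fun z => f (dfwith (dfwith x w y) v z)) by exact: bm_dfwith1.
rewrite /cond_avg -/k -/k'.
apply: le_trans (ler_distD (wavg (psi v) k' (fun z => f (dfwith x v z))) _ _) _.
apply: lerD.
  rewrite -wavgB//; apply: wavg_norm_le => //; first exact: bmB.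
  by move=> z; rewrite dfwithC//; exact: of_.
rewrite distrC; apply: wavg_reweight => //.
- by rewrite -[X in X <= _]expR0 ler_expR.
- move=> z z0; rewrite /k /k'.
  have := hM v w (dfwith x v z0) y z; rewrite eq_sym => /(_ wv).
  rewrite (dfwithC x z0 y) 1?eq_sym// !dfwith_same => h1; apply: (le_trans h1).
  by rewrite [X in _ * X]mulrC.
- move=> z z0; have := of_ v (dfwith x v z0) z; by rewrite dfwith_same.
Qed.

Lemma cond_avg_ratio h h' f dl D v x : bpos h -> bpos h' -> bm f -> osc f dl ->
  ratio_bound h h' D -> 0 <= D v ->
  `|cond_avg h v f x - cond_avg h' v f x| <= (expR (D v) - 1) * dl v.
Proof.
move=> bh bh' bf of_ hD D0; apply: wavg_reweight => //.
- exact: bpos_dfwith1.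
- exact: bpos_dfwith1.
- exact: bm_dfwith1.
- by rewrite -[X in X <= _]expR0 ler_expR.
- by move=> z z0; have := hD v (dfwith x v z0) z; rewrite !dfwith_same.
- by move=> z z0; have := of_ v (dfwith x v z0) z; rewrite dfwith_same.
Qed.

(* Replacing [f] by its conditional expectation
   given the coordinates other than [v] lowers [\sum_v u v * dl v] by at least
   the error made at [v], because [u] is a supersolution. *)
Lemma dobrushin_comparison h h' f dl D M u : bpos h -> bpos h' -> bm f ->
  osc f dl -> mixed_bound h M -> ratio_bound h h' D ->
  (forall v w, 0 <= M v w) -> (forall v, 0 <= D v) -> (forall v, 0 <= u v) ->
  (forall v, \sum_(w | w != v) (expR (M v w) - 1) <= 2^-1) ->
  (forall v, expR (D v) - 1 + \sum_(w | w != v) (expR (M v w) - 1) * u w <= u v) ->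
  `|wavg PP h f - wavg PP h' f| <= \sum_v u v * dl v.
Proof.
move=> bh bh' bf of_ hM hD M0 D0 u0 rowA uA.
set n : R := #|V|%:R.
(* Without sites there is a single state; the contraction factor below divides by the number of
   sites. *)
have [V0|V0] := eqVneq #|V| 0%N.
  have Vn (v : V) : False by have := max_card (pred1 v); rewrite card1 V0.
  rewrite big1 => [|v _]; last by case: (Vn v).
  have fc : f = fun=> f point.
    apply/funext => x; congr f; apply: functional_extensionality_dep => v.
    by case: (Vn v).
  by rewrite fc !wavg_cst// subrr normr0.
have n0 : 0 < n by rewrite ltr0n lt0n.
have n1 : 1 <= n by rewrite ler1n lt0n.
(* Updating [v] removes at least half of [dl v] from the total oscillation; averaged over the [n]
   choices of [v], this is a contraction by [1 - 1 / (2 n)]. *)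
set q : R := 1 - (n *+ 2)^-1.
have q01 : 0 <= q < 1.
  have : 0 < (n *+ 2)^-1 <= 1.
    have n2 : 1 <= n *+ 2 by rewrite mulr2n; lra.
    have n20 : 0 < n *+ 2 by exact: lt_le_trans n2.
    by rewrite invr_gt0 n20/= invf_le1.
  by rewrite /q; lra.
suff main k : `|wavg PP h f - wavg PP h' f| <=
    \sum_v u v * dl v + q ^+ k * ((\sum_v dl v) *+ 2) by exact: le_geometric main.
elim: k f dl bf of_ => [|k IH] f dl bf of_.
  have s0 : 0 <= \sum_v u v * dl v.
    by apply: sumr_ge0 => v _; rewrite mulr_ge0// (osc_ge0 v of_).
  rewrite expr0 mul1r; apply: (@le_trans _ _ ((\sum_v dl v) *+ 2)); last first.
    by rewrite lerDr.
  apply: le_trans (ler_distD (f point) _ _) _; rewrite mulr2n lerD//.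
    by apply: wavg_osc => // x; exact: osc_total.
  by rewrite distrC; apply: wavg_osc => // x; exact: osc_total.
set F := `|_|; set U := \sum_v u v * dl v; set L := \sum_v dl v.
have dl0 v : 0 <= dl v by exact: osc_ge0 of_.
have A0 v w : 0 <= expR (M v w) - 1.
  by rewrite subr_ge0 -[X in X <= _]expR0 ler_expR.
have qk0 : 0 <= q ^+ k by rewrite exprn_ge0//; case/andP: q01.
have step v : F <= U + q ^+ k * (L *+ 2 - dl v).
  set dl' := fun w => if w == v then 0 else dl w + (expR (M v w) - 1) * dl v.
  have bc := bm_cond_avg v bh bf; have bc' := bm_cond_avg v bh' bf.
  have oc : osc (cond_avg h v f) dl' by exact: cond_avg_osc.
  have := IH _ _ bc oc; rewrite wavg_cond_avg//.
  set G := `|_|; set U' := \sum_v _; set L' := \sum_v dl' v => GUL.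
  have FG : F <= G + (expR (D v) - 1) * dl v.
    apply: le_trans (ler_distD (wavg PP h' (cond_avg h v f)) _ _) _.
    rewrite lerD2l -[X in _ - X](wavg_cond_avg v bh' bf) -wavgB//.
    apply: wavg_norm_le => //; first exact: bmB.
    by move=> x; exact: cond_avg_ratio.
  have U'U : U' + (expR (D v) - 1) * dl v <= U.
    rewrite /U' /U (bigD1 v)//= [leRHS](bigD1 v)//= /dl' eqxx mulr0 add0r.
    under eq_bigr => w wv do rewrite (negbTE wv) mulrDr mulrCA mulrA.
    rewrite big_split/= -addrA [leRHS]addrC lerD2l -mulr_suml -mulrDl.
    by rewrite ler_wpM2r// addrC.
  have L'L : L' <= L - dl v + 2^-1 * dl v.
    rewrite /L' /L (bigD1 v)//= [X in X - _](bigD1 v)//= /dl' eqxx add0r.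
    rewrite [X in X - _]addrC addrK.
    under eq_bigr => w wv do rewrite (negbTE wv).
    by rewrite big_split/= lerD2l -mulr_suml ler_wpM2r.
  apply: (le_trans FG); rewrite -lerBrDr (le_trans GUL)// lerBrDr.
  rewrite addrAC (le_trans (lerD U'U (lexx _)))// lerD2l ler_wpM2l//; lra.
have : \sum_(v : V) F <= \sum_(v : V) (U + q ^+ k * (L *+ 2 - dl v)).
  by apply: ler_sum => v _.
have sc (c : R) : \sum_(v : V) c = n * c by rewrite sumr_const -mulr_natl.
rewrite sc.
have -> : \sum_(v : V) (U + q ^+ k * (L *+ 2 - dl v)) =
    n * U + q ^+ k * (n * (L *+ 2) - L).
  by rewrite big_split/= -mulr_sumr sumrB !sc.
move=> h1; rewrite -(ler_pM2l n0) (le_trans h1)//.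
have nq : n * q = n - 2^-1.
  by rewrite /q mulrBr mulr1 -[n *+ 2]mulr_natr invfM mulrA divff ?gt_eqF// mul1r.
have -> : n * (U + q ^+ k.+1 * (L *+ 2)) = n * U + q ^+ k * ((n * q) * (L *+ 2)).
  by rewrite exprS; ring.
by have e : 2^-1 * (L *+ 2) = L by [lra]; rewrite nq mulrBl e.
Qed.

End gibbs_comparison.

Lemma expR_le_1D2x (R : realType) (x : R) : 0 <= x <= 2^-1 -> expR x - 1 <= 2 * x.
Proof.
move=> /andP[x0 x1]; have h := expR_ge1Dx (- x).
have e0 := expR_gt0 x; have : expR (- x) * expR x = 1 by rewrite -expRD addNr expR0.
nra.
Qed.

(** * The equation u = s + A u for a contracting nonnegative matrix *)

Section supersolution.
Context (R : realType) (V : finType) (A : V -> V -> R).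
Hypotheses (A_ge0 : forall v w, 0 <= A v w)
  (A_row : forall v, \sum_w A v w <= 2^-1).

(** At a positive maximum [z v], row sums of at most 1/2 would give [z v <= z v / 2]. *)
Lemma maximum_principle (z : V -> R) :
  (forall v, z v <= \sum_w A v w * z w) -> forall v, z v <= 0.
Proof.
move=> zA v0; pose v := [arg max_(v > v0) z v]%O.
have vmax w : z w <= z v by rewrite /v; case: arg_maxP => //= i _; exact.
rewrite (le_trans (vmax v0))// leNgt; apply/negP => zv0.
have : z v <= 2^-1 * z v.
  apply: le_trans (zA v) _; apply: (@le_trans _ _ (\sum_w A v w * z v)).
    by apply: ler_sum => w _; rewrite ler_wpM2l.
  by rewrite -mulr_suml ler_wpM2r// ltW.
lra.
Qed.

(** [2 * c * w] is a supersolution: [A] at most halves [w], so the source [c * w] and the image of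
    [2 * c * w] add up to at most [2 * c * w]. *)
Lemma fixpoint_le (u s w : V -> R) c :
  (forall v, u v = s v + \sum_v' A v v' * u v') ->
  (forall v, s v <= c * w v) ->
  0 <= c -> (forall v, \sum_v' A v v' * w v' <= 2^-1 * w v) ->
  forall v, u v <= 2 * c * w v.
Proof.
move=> uE sw c0 Aw v.
suff : u v - 2 * c * w v <= 0 by rewrite subr_le0.
move: v; apply: maximum_principle => v.
have -> : \sum_v' A v v' * (u v' - 2 * c * w v') =
    \sum_v' A v v' * u v' - 2 * c * \sum_v' A v v' * w v'.
  by rewrite mulr_sumr -sumrB; apply: eq_bigr => v' _; ring.
have := Aw v; have := sw v; rewrite uE; nra.
Qed.

(** [1 - A] has trivial kernel, by the maximum principle for a null vector and its opposite; the
    same principle for [- u] gives the sign of the solution. *)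
Lemma fixpoint_exists (s : V -> R) : (forall v, 0 <= s v) ->
  exists2 u : V -> R, forall v, 0 <= u v & forall v, u v = s v + \sum_w A v w * u w.
Proof.
move=> s0; set n := #|V|.
(* The transpose of [1 - A], since vectors are rows multiplied from the right. *)
pose a : 'M[R]_n := \matrix_(i, j) ((i == j)%:R - A (enum_val j) (enum_val i)).
have mulE (x : 'rV[R]_n) i : (x *m a) 0 i =
    x 0 i - \sum_w A (enum_val i) w * x 0 (enum_rank w).
  rewrite mxE (reindex (@enum_rank V)) /=; last first.
    by exists enum_val => j _; rewrite ?enum_valK ?enum_rankK.
  under eq_bigr do rewrite mxE enum_rankK mulrBr.
  rewrite sumrB; congr (_ - _).
    rewrite (bigD1 (enum_val i))//= enum_valK eqxx mulr1 big1 ?addr0// => w wi.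
    by rewrite (can2_eq enum_rankK enum_valK) (negbTE wi) mulr0.
  by apply: eq_bigr => w _; rewrite mulrC.
have ua : a \in unitmx.
  rewrite unitmxE unitfE; apply/negP => /det0P[x x0 xa0].
  pose z (c : R) v := c * x 0 (enum_rank v).
  have zA c v : z c v <= \sum_w A v w * z c w.
    have : (x *m a) 0 (enum_rank v) = 0 by rewrite xa0 mxE.
    rewrite mulE enum_rankK => /eqP; rewrite subr_eq0 /z => /eqP ->.
    by rewrite mulr_sumr le_eqVlt; apply/orP; left; apply/eqP; apply: eq_bigr => w _; rewrite mulrCA.
  move/negP: x0; apply; apply/eqP/rowP => i; rewrite mxE.
  have := maximum_principle (zA 1) (enum_val i).
  have := maximum_principle (zA (-1)) (enum_val i).
  rewrite /z enum_valK => h1 h2; lra.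
pose x := (\row_i s (enum_val i)) *m invmx a.
pose u v := x 0 (enum_rank v).
have uE v : u v = s v + \sum_w A v w * u w.
  have : (x *m a) 0 (enum_rank v) = s v by rewrite /x mulmxKV// mxE enum_rankK.
  by rewrite mulE enum_rankK /u => <-; rewrite subrK.
exists u => // v; rewrite -oppr_le0; move: v.
apply: maximum_principle => v; rewrite {1}uE opprD.
have -> : \sum_w A v w * - u w = - \sum_w A v w * u w.
  by rewrite -sumrN; apply: eq_bigr => w _; rewrite mulrN.
by rewrite gerDr oppr_le0.
Qed.

End supersolution.

(** * Transitions between good densities *)

Section log_density_bounds.
Context (R : realType) (V : finType) (d : V -> measure_display)
  (T : forall v, measurableType (d v)).
Local Notation XX := (product_space T).
Implicit Types (f g h : XX -> R) (S : {set V}) (D : V -> R) (M : V -> V -> R).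

Lemma mul_expR_le (a1 b1 a2 b2 x y : R) : 0 <= a1 -> 0 <= a2 ->
  a1 <= expR x * b1 -> a2 <= expR y * b2 -> a1 * a2 <= expR (x + y) * (b1 * b2).
Proof.
move=> a10 a20 h1 h2; rewrite expRD mulrACA; exact: ler_pM.
Qed.

Lemma mixed_bound1 M : (forall v w, 0 <= M v w) -> mixed_bound (fun _ : XX => 1 : R) M.
Proof.
move=> M0 v w x y z _; rewrite !mul1r mulr1.
by rewrite -[X in X <= _]expR0 ler_expR.
Qed.

Lemma mixed_boundM h h' M M' : (forall x, 0 <= h x) -> (forall x, 0 <= h' x) ->
  mixed_bound h M -> mixed_bound h' M' ->
  mixed_bound (fun x => h x * h' x) (fun v w => M v w + M' v w).
Proof.
move=> h0 h'0 hM hM' v w x y z vw.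
have := mul_expR_le _ _ (hM v w x y z vw) (hM' v w x y z vw).
rewrite mulrACA [X in _ -> _ <= _ * X]mulrACA; apply; exact: mulr_ge0.
Qed.

Lemma le_mixed_bound h M M' : (forall x, 0 <= h x) ->
  (forall v w, v != w -> M v w <= M' v w) -> mixed_bound h M -> mixed_bound h M'.
Proof.
move=> h0 MM' hM v w x y z vw; apply: le_trans (hM v w x y z vw) _.
by rewrite ler_wpM2r ?mulr_ge0// ler_expR MM'.
Qed.

Lemma mixed_bound_prod (I : Type) (s : seq I) (P : pred I) (h : I -> XX -> R)
    (M : I -> V -> V -> R) :
  (forall i x, P i -> 0 <= h i x) -> (forall i, P i -> mixed_bound (h i) (M i)) ->
  mixed_bound (fun x => \prod_(i <- s | P i) h i x)
    (fun v w => \sum_(i <- s | P i) M i v w).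
Proof.
move=> h0 hM; elim: s => [|i s IH].
  by move=> v w x y z _; rewrite !big_nil expR0 !mulr1.
have [Pi|nPi] := boolP (P i); last first.
  by move=> v w x y z vw; rewrite !big_cons (negbTE nPi); exact: IH.
move=> v w x y z vw; rewrite !big_cons Pi.
by apply: (mixed_boundM (h := h i)) (hM i Pi) IH _ _ _ _ _ vw => x'; rewrite ?prodr_ge0// => *; exact: h0.
Qed.

(** If [h] ignores one of the two coordinates, the two cross products coincide. *)
Lemma mixed_bound_indep h M v0 w0 x y z : (forall x, 0 <= h x) -> 0 <= M v0 w0 ->
  v0 != w0 ->
  (forall x z, h (dfwith x v0 z) = h x) \/ (forall x z, h (dfwith x w0 z) = h x) ->
  h (dfwith (dfwith x w0 y) v0 z) * h x <=
  expR (M v0 w0) * (h (dfwith x w0 y) * h (dfwith x v0 z)).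
Proof.
move=> h0 M0 vw hi; have E1 : 1 <= expR (M v0 w0).
  by rewrite -[X in X <= _]expR0 ler_expR.
have -> : h (dfwith (dfwith x w0 y) v0 z) * h x = h (dfwith x w0 y) * h (dfwith x v0 z).
  by case: hi => hi; [rewrite !hi|rewrite dfwithC 1?eq_sym// !hi mulrC].
by rewrite ler_peMl ?mulr_ge0.
Qed.

Lemma ratio_bound_refl h D : (forall x, 0 <= h x) -> (forall v, 0 <= D v) ->
  ratio_bound h h D.
Proof.
move=> h0 D0 v x z; rewrite ler_peMl ?mulr_ge0//.
by rewrite -[X in X <= _]expR0 ler_expR.
Qed.

Lemma ratio_boundM h1 h2 h1' h2' D D' : (forall x, 0 <= h1 x) ->
  (forall x, 0 <= h2 x) -> (forall x, 0 <= h1' x) -> (forall x, 0 <= h2' x) ->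
  ratio_bound h1 h1' D -> ratio_bound h2 h2' D' ->
  ratio_bound (fun x => h1 x * h2 x) (fun x => h1' x * h2' x)
    (fun v => D v + D' v).
Proof.
move=> ? ? ? ? hD hD' v x z.
have := mul_expR_le _ _ (hD v x z) (hD' v x z).
rewrite mulrACA [X in _ -> _ <= _ * X]mulrACA; apply; exact: mulr_ge0.
Qed.

Lemma ratio_bound_prod (I : Type) (s : seq I) (P : pred I) (h h' : I -> XX -> R)
    (D : I -> V -> R) :
  (forall i x, P i -> 0 <= h i x) -> (forall i x, P i -> 0 <= h' i x) ->
  (forall i, P i -> ratio_bound (h i) (h' i) (D i)) ->
  ratio_bound (fun x => \prod_(i <- s | P i) h i x)
    (fun x => \prod_(i <- s | P i) h' i x) (fun v => \sum_(i <- s | P i) D i v).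
Proof.
move=> h0 h'0 hD; elim: s => [|i s IH].
  by move=> v x z; rewrite !big_nil expR0 !mulr1.
have [Pi|nPi] := boolP (P i); last first.
  by move=> v x z; rewrite !big_cons (negbTE nPi); exact: IH.
move=> v x z; rewrite !big_cons Pi.
by apply: (ratio_boundM (h1 := h i) (h1' := h' i)) (hD i Pi) IH _ _ _ => x';
  rewrite ?prodr_ge0// => *; rewrite ?h0 ?h'0.
Qed.

End log_density_bounds.

(** * The local transition model *)

Section one_step.
Context (R : realType) (V : finType) (d : V -> measure_display)
  (T : forall v, measurableType (d v)) (psi : forall v, probability (T v) R).
Local Notation XX := (product_space T).
Local Notation PP := (prodP psi : probability XX R).
Implicit Types (f g h : XX -> R) (S : {set V}) (D : V -> R) (M : V -> V -> R).

Variables (N : V -> {set V}) (Dl : nat) (e lam sig : R).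
Variable p : forall v, XX -> T v -> R.
Arguments p : clear implicits.

(** [e] bounds the transition densities after normalisation of the reference measures, and [e ^- 4]
    the cross ratios of four of them. The square in [sig_small] accounts for two sites being coupled
    through a site that neighbours both. *)
Record local_model : Prop := LocalModel {
  N_sym : forall v w : V, (w \in N v) = (v \in N w);
  N_card : forall v, (#|N v| <= Dl)%N;
  e_gt0 : 0 < e; e_le1 : e <= 1;
  lam_e : expR lam = e ^- 4; sig_lam : sig = expR lam - 1;
  sig_small : 64 * Dl.+1%:R ^+ 2 * sig <= 1;
  p_meas : forall v, measurable_fun setT (fun u : XX * T v => p v u.1 u.2);
  p_bnd : forall v x z, e <= p v x z <= e^-1;
  p_loc : forall v z, loc (N v) (fun x => p v x z) }.

Hypothesis LM : local_model.

Lemma sig_ge0 : 0 <= sig.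
Proof.
rewrite (sig_lam LM) (lam_e LM) subr_ge0 -exprVn; apply: exprn_ege1.
by rewrite invf_ge1 ?(e_gt0 LM)//; exact: e_le1.
Qed.

Lemma lam_ge0 : 0 <= lam.
Proof.
by rewrite -ler_expR expR0 -subr_ge0 -(sig_lam LM) sig_ge0.
Qed.

Lemma lam_le_sig : lam <= sig.
Proof. by rewrite (sig_lam LM) lerBrDr addrC expR_ge1Dx. Qed.

Lemma sig_bounds : 64 * Dl%:R ^+ 2 * sig <= 1 /\ 64 * Dl%:R * sig <= 1 /\
  64 * sig <= 1.
Proof.
have s0 := sig_ge0; have := sig_small LM.
have -> : Dl.+1%:R = Dl%:R + 1 :> R by rewrite -natr1.
have : 0 <= (Dl%:R : R) by []; set D : R := Dl%:R => D0.
rewrite sqrrD expr1n mulr1 => h; have D2 := sqr_ge0 D.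
split; last split; nra.
Qed.

Definition pS S (x z : XX) : R := \prod_(v in S) p v x (z v).

Lemma pS0 x z : pS finset.set0 x z = 1.
Proof. by rewrite /pS big_set0. Qed.

Lemma p_bpos v : bpos (fun u : XX * T v => p v u.1 u.2).
Proof.
have e0 := e_gt0 LM; split.
  split; first exact: p_meas.
  exists e^-1 => u; have /andP[h1 h2] := p_bnd LM u.1 u.2.
  by rewrite ger0_norm// (le_trans _ h1)// ltW.
by exists e => // u; have /andP[] := p_bnd LM u.1 u.2.
Qed.

Lemma p_bpos2 v : bpos (fun u : XX * XX => p v u.1 (u.2 v)).
Proof.
have m : measurable_fun setT (fun u : XX * XX => (u.1, u.2 v)).
  apply/measurable_fun_pairP; split; first exact: measurable_fst.
  by have := measurableT_comp (@measurable_coord _ _ T v) (@measurable_snd _ _ XX XX).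
by have := bpos_comp (p_bpos v) m.
Qed.

Lemma pS_bpos2 S : bpos (fun u : XX * XX => pS S u.1 u.2).
Proof. by apply: bpos_prod => v _; exact: p_bpos2. Qed.

Lemma bpos_slice1 (F : XX -> XX -> R) x : bpos (fun u : XX * XX => F u.1 u.2) ->
  bpos (F x).
Proof.
by move=> bF; have := bpos_comp bF (measurable_pair1 x).
Qed.

Lemma bpos_slice2 (F : XX -> XX -> R) z : bpos (fun u : XX * XX => F u.1 u.2) ->
  bpos (fun x => F x z).
Proof.
by move=> bF; have := bpos_comp bF (measurable_pair2 z).
Qed.

Lemma pS_bpos1 S z : bpos (fun x => pS S x z).
Proof. exact: bpos_slice2 (pS_bpos2 S). Qed.

Lemma p_bpos1 v z : bpos (fun x => p v x z).
Proof. by have := bpos_comp (p_bpos v) (measurable_pair2 z). Qed.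

Lemma p_gt0 v x z : 0 < p v x z.
Proof. by have /andP[h _] := p_bnd LM x z; apply: lt_le_trans h; exact: e_gt0. Qed.

Lemma pS_gt0 S x z : 0 < pS S x z.
Proof. by apply: prodr_gt0 => v _; exact: p_gt0. Qed.

(** Unnormalised density, on the sites [S], of the state reached by one transition from the density
    [h]. *)
Definition qS S h (z : XX) : R := mean PP (fun x => h x * pS S x z).

Lemma qSE S h z : qS S h z = mean PP (fun x => h x * pS S x z).
Proof. by []. Qed.

Lemma qS_bpos S h : bpos h -> bpos (qS S h).
Proof.
move=> bh.
have bF : bpos (fun u : XX * XX => h u.1 * pS S u.1 u.2).
  by apply: bposM (pS_bpos2 S); exact: bpos_comp bh measurable_fst.
have [bmF [c c0 cF]] := bF; split.
  exact: (bm_mean1 PP (F := fun x z => h x * pS S x z)).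
exists c => // z; apply: mean_ge.
  exact: (bm_slice2 (F := fun x z => h x * pS S x z)).
by move=> x; exact: (cF (x, z)).
Qed.

Lemma bounded_cross (a b c c' : R) : e <= a <= e^-1 -> e <= b <= e^-1 ->
  e <= c <= e^-1 -> e <= c' <= e^-1 -> a * b <= expR lam * (c * c').
Proof.
have e0 := e_gt0 LM.
move=> /andP[h1 h2] /andP[h3 h4] /andP[h5 h6] /andP[h7 h8].
rewrite (lam_e LM) -ler_pdivrMl ?invr_gt0 ?exprn_gt0// invrK.
apply: (@le_trans _ _ (e ^+ 2)); last first.
  by rewrite expr2; apply: ler_pM => //; exact: ltW.
have -> : e ^+ 2 = e ^+ 4 * (e^-1 * e^-1).
  by rewrite -invfM -expr2 -[4%N]/(2 + 2)%N exprD mulfK// expf_neq0// gt_eqF.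
apply: ler_wpM2l; first by rewrite exprn_ge0// ltW.
by apply: ler_pM => //; rewrite ltW// (lt_le_trans e0).
Qed.

Lemma ratio_bound_bounded h h' B : (forall x, e <= h x <= e^-1) ->
  (forall x, e <= h' x <= e^-1) -> loc B h -> loc B h' ->
  ratio_bound h h' (fun v => if v \in B then lam else 0).
Proof.
move=> hb hb' lh lh' v x z; case: ifPn => vB; last first.
  by rewrite (loc_dfwith _ _ lh)// (loc_dfwith _ _ lh')// expR0 mul1r mulrC.
exact: bounded_cross.
Qed.

(** Only the factor at [v] differs between the two sides; the others cancel. *)
Lemma pS_cross S x x' y v z : v \in S ->
  pS S x' (dfwith y v z) * pS S x y <=
  expR lam * (pS S x (dfwith y v z) * pS S x' y).
Proof.
move=> vS; pose r x0 := \prod_(u in S | u != v) p u x0 (y u).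
have r0 x0 : 0 <= r x0 by apply: prodr_ge0 => u _; rewrite ltW// p_gt0.
have E1 x0 : pS S x0 y = p v x0 (y v) * r x0 by rewrite /pS (bigD1 v vS).
have E2 x0 : pS S x0 (dfwith y v z) = p v x0 z * r x0.
  rewrite /pS (bigD1 v vS)/= dfwithin; congr (_ * _).
  by apply: eq_bigr => u /andP[_ uv]; rewrite dfwithout// eq_sym.
rewrite !E1 !E2 mulrACA.
have -> : expR lam * (p v x z * r x * (p v x' (y v) * r x')) =
  expR lam * (p v x z * p v x' (y v)) * (r x' * r x) by ring.
by rewrite ler_wpM2r ?mulr_ge0//; apply: bounded_cross; exact: p_bnd.
Qed.

Lemma mixed_bound_p v z : mixed_bound (fun x => p v x z)
  (fun v' w' => if (v' \in N v) && (w' \in N v) then lam else 0).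
Proof.
have p0 x : 0 <= p v x z by rewrite ltW// p_gt0.
move=> v' w' x y y' vw; case: ifPn => [/andP[v'N w'N]|].
  have := @ratio_bound_bounded (fun x => p v x z) (fun x => p v (dfwith x w' y) z)
    [set: V]%SET.
  have pb x' : e <= p v x' z <= e^-1 by exact: p_bnd.
  move=> /(_ pb (fun x' => pb _)) H.
  have /H/(_ _ v' x y') : loc [set: V]%SET (fun x => p v x z).
    by apply: locS (finset.subsetT _) (p_loc LM z).
  rewrite inE => H'; rewrite [dfwith (dfwith _ _ _) _ _]dfwithC 1?eq_sym//.
  rewrite [X in _ <= _ * X]mulrC; apply: H' => x1 x2 x12.
  by apply: (p_loc LM) => v0 v0N; rewrite (_ : x1 = x2)//;
    apply: functional_extensionality_dep => u; apply: x12; rewrite inE.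
rewrite negb_and => nN; have l := p_loc LM z (v := v).
apply: (@mixed_bound_indep _ _ _ _ (fun x => p v x z) (fun _ _ => 0)) => //.
by case/orP: nN => nN; [left|right] => x' z'; rewrite (loc_dfwith _ _ l).
Qed.

(** Conditioning a state on its successor couples [v] and [w] once for every site [u] whose
    transition reads both. *)
Definition NN (v w : V) : R := \sum_(u | (v \in N u) && (w \in N u)) lam.

Lemma NN_ge0 v w : 0 <= NN v w.
Proof. by apply: sumr_ge0 => u _; exact: lam_ge0. Qed.

Lemma mixed_bound_pS S z : mixed_bound (fun x => pS S x z) NN.
Proof.
apply: le_mixed_bound (mixed_bound_prod (index_enum V) (P := mem S) _
  (fun v _ => mixed_bound_p (v := v) (z v))).
- by move=> x; rewrite ltW// pS_gt0.
- move=> v w _; rewrite /NN [leRHS]big_mkcond [leLHS]big_mkcond/=.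
  apply: ler_sum => u _; case: (u \in S) => //; case: ifP => // _; exact: lam_ge0.
- by move=> v x _; rewrite ltW// p_gt0.
Qed.

(** Only the factors indexed by [B] can differ, and each of them is felt in its own neighbourhood
    only. *)
Lemma ratio_bound_pS S S' z z' (B : {set V}) :
  (forall u, u \notin B -> (u \in S) = (u \in S') /\ z u = z' u) ->
  ratio_bound (fun x => pS S x z) (fun x => pS S' x z')
    (fun v => \sum_(u in B | v \in N u) lam).
Proof.
move=> SS'.
(* Absent factors are replaced by 1, which also lies between [e] and [e^-1], so that both products
   run over all sites. *)
pose F (S : {set V}) (z : XX) u x : R := if u \in S then p u x (z u) else 1.
have pSE S0 z0 : (fun x => pS S0 x z0) = (fun x => \prod_u F S0 z0 u x).
  by apply/funext => x; rewrite /pS big_mkcond.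
have F0 S0 z0 u x : e <= F S0 z0 u x <= e^-1.
  rewrite /F; case: ifP => _; first exact: p_bnd.
  by rewrite (e_le1 LM) invf_ge1 ?(e_gt0 LM)// (e_le1 LM).
have Fge0 S0 z0 u x : 0 <= F S0 z0 u x.
  by have /andP[h _] := F0 S0 z0 u x; rewrite (le_trans _ h)// ltW// (e_gt0 LM).
have lF S0 z0 u : loc (N u) (F S0 z0 u).
  by move=> x x' xx'; rewrite /F; case: ifP => // _; exact: (p_loc LM).
rewrite !pSE.
have -> : (fun v => \sum_(u in B | v \in N u) lam) =
    (fun v => \sum_u if (u \in B) && (v \in N u) then lam else 0).
  by apply/funext => v; rewrite big_mkcond.
apply: ratio_bound_prod => // u _.
have [uB|/SS'[uS zu]] /= := boolP (u \in B); first exact: ratio_bound_bounded.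
have -> : F S z u = F S' z' u by apply/funext => x; rewrite /F uS zu.
exact: ratio_bound_refl.
Qed.

End one_step.

(** * Preservation of good densities by a transition *)

Section decay_of_correlations.
Context (R : realType) (V : finType) (d : V -> measure_display)
  (T : forall v, measurableType (d v)) (psi : forall v, probability (T v) R).
Local Notation XX := (product_space T).
Local Notation PP := (prodP psi : probability XX R).
Implicit Types (f g h : XX -> R) (S : {set V}) (D om : V -> R) (M : V -> V -> R).

Variables (N : V -> {set V}) (Dl : nat) (e lam sig : R).
Variable p : forall v, XX -> T v -> R.
Arguments p : clear implicits.
Hypothesis LM : local_model N Dl e lam sig p.
Local Notation pS := (pS p).
Local Notation qS := (qS psi p).
Local Notation NN := (NN N lam).

(** Testing against all weights that at most double from a site to a neighbour expresses exponential
    decay without naming a distance. The constant weight serves the sampling error, weights decaying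
    away from the boundary of a block serve the bias. *)
Definition slow om := (forall v, 0 <= om v) /\
  forall v w, w \in N v -> om w <= 2 * om v.

Definition good_matrix M := (forall v w, 0 <= M v w) /\
  forall om, slow om -> forall v, \sum_w M v w * om w <= 8^-1 * om v.

(* The correlations of the density [h] decay, uniformly in the number of sites. *)
Definition good h := exists2 M, good_matrix M & mixed_bound h M.

Lemma slow1 : slow (fun=> 1).
Proof. by split => // v w _; rewrite mulr1 ler1n. Qed.

Lemma sum_N_slow om v : slow om -> \sum_(w in N v) om w <= 2 * Dl%:R * om v.
Proof.
move=> [om0 omN]; apply: (@le_trans _ _ (\sum_(w in N v) 2 * om v)).
  by apply: ler_sum => w; exact: omN.
rewrite sumr_const.
have -> : (2 * om v) *+ #|N v| = 2 * #|N v|%:R * om v.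
  by rewrite -[LHS]mulr_natl; ring.
by rewrite ler_wpM2r// ler_wpM2l// ler_nat (N_card LM).
Qed.

Lemma NN_slow om v : slow om ->
  \sum_w NN v w * om w <= 4 * Dl%:R ^+ 2 * lam * om v.
Proof.
move=> so; have [om0 omN] := so; have l0 := lam_ge0 LM.
have -> : \sum_w NN v w * om w = \sum_(u in N v) lam * \sum_(w in N u) om w.
  rewrite /NN; under eq_bigr do rewrite mulr_suml big_mkcond/=.
  rewrite exchange_big/= [RHS]big_mkcond/=; apply: eq_bigr => u _.
  rewrite (N_sym LM); case: ifP => /= _; last by rewrite big1.
  rewrite mulr_sumr [RHS]big_mkcond/=; apply: eq_bigr => w _.
  by [].
apply: (@le_trans _ _ (\sum_(u in N v) lam * (2 * Dl%:R * om u))).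
  by apply: ler_sum => u _; rewrite ler_wpM2l// sum_N_slow.
rewrite -!mulr_sumr; have := sum_N_slow v so => h.
have -> : 4 * Dl%:R ^+ 2 * lam * om v = lam * (2 * Dl%:R * (2 * Dl%:R * om v)) :> R.
  by ring.
by rewrite ler_wpM2l// ler_wpM2l// mulr_ge0.
Qed.

(** Bound on the mixed differences of [h x * pS S x z] in [x], the density of a state given its
    successor. *)
Definition tot M v w : R := M v w + NN v w.

Lemma tot_ge0 M v w : good_matrix M -> 0 <= tot M v w.
Proof. by move=> [M0 _]; rewrite addr_ge0// (NN_ge0 LM). Qed.

(** 1/8 from [M] and 1/16 from [NN], doubled, stay below 1/2; the factor 2 is that of
    [expR x - 1 <= 2 * x]. *)
Lemma tot_slow M om v : good_matrix M -> slow om ->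
  \sum_w 2 * tot M v w * om w <= 2^-1 * om v.
Proof.
move=> [M0 Mom] so; have [om0 _] := so.
have -> : \sum_w 2 * tot M v w * om w =
    2 * (\sum_w M v w * om w + \sum_w NN v w * om w).
  rewrite -big_split mulr_sumr; apply: eq_bigr => w _ /=.
  by rewrite /tot; ring.
have h1 := Mom om so v; have h2 := NN_slow v so.
have [h3 _] := sig_bounds LM; have h4 := lam_le_sig LM; have h5 := om0 v.
have h6 : 64 * Dl%:R ^+ 2 * lam <= 1.
  by apply: le_trans h3; rewrite ler_wpM2l// mulr_ge0.
have : 4 * Dl%:R ^+ 2 * lam * om v <= 16^-1 * om v.
  by rewrite ler_wpM2r//; lra.
lra.
Qed.

Lemma tot_row M v : good_matrix M -> \sum_w 2 * tot M v w <= 2^-1.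
Proof.
move=> gM; have := tot_slow v gM slow1; rewrite mulr1.
by under eq_bigr do rewrite mulr1.
Qed.

Lemma tot_le M v w : good_matrix M -> 0 <= tot M v w <= 2^-1.
Proof.
move=> gM; rewrite tot_ge0//=.
have := tot_row v gM; rewrite (bigD1 w)//=.
have : 0 <= \sum_(i | i != w) 2 * tot M v i.
  by apply: sumr_ge0 => i _; rewrite mulr_ge0// tot_ge0.
have := tot_ge0 v w gM; lra.
Qed.

(** Logarithmic oscillation at [v] caused by altering the transition factors of the sites in [B]. *)
Definition shift (B : {set V}) v : R := \sum_(u in B | v \in N u) lam.

Lemma shift_ge0 B v : 0 <= shift B v.
Proof. by apply: sumr_ge0 => u _; exact: (lam_ge0 LM). Qed.

(** Dobrushin's comparison for smoothing laws, those of a state given its successor: they may differ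
    through the densities of the state and through the transition factors of the sites in [B]. *)
Lemma comparison h h' f dl D M u S S' (z z' : XX) (B : {set V}) :
  bpos h -> bpos h' -> bm f -> osc f dl -> good_matrix M -> mixed_bound h M ->
  ratio_bound h h' D -> (forall v, 0 <= D v) ->
  (forall u, u \notin B -> (u \in S) = (u \in S') /\ z u = z' u) ->
  (forall v, D v + shift B v <= 2^-1) -> (forall v, 0 <= u v) ->
  (forall v, 2 * (D v + shift B v) + \sum_w 2 * tot M v w * u w <= u v) ->
  `|wavg PP (fun x => h x * pS S x z) f - wavg PP (fun x => h' x * pS S' x z') f|
    <= \sum_v u v * dl v.
Proof.
move=> bh bh' bf of_ gM hM hD D0 SS' D1 u0 uA.
have pos S0 z0 x : 0 <= pS S0 x z0 by rewrite ltW// (pS_gt0 LM).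
apply: (@dobrushin_comparison _ _ _ _ psi _ _ _ _ (fun v => D v + shift B v)
  (tot M)) => //.
- exact: bposM bh (pS_bpos1 LM S z).
- exact: bposM bh' (pS_bpos1 LM S' z').
- apply: mixed_boundM => //; last exact: (mixed_bound_pS LM).
  by move=> x; exact: bpos_ge0.
- apply: ratio_boundM => //; [move=> x; exact: bpos_ge0|move=> x; exact: bpos_ge0|].
  exact: (ratio_bound_pS LM).
- by move=> v w; exact: tot_ge0.
- by move=> v; rewrite addr_ge0// shift_ge0.
- move=> v; apply: le_trans (tot_row v gM).
  rewrite [leRHS](bigID (fun w => w != v))/= ler_wpDr//.
    by apply: sumr_ge0 => w _; rewrite mulr_ge0// tot_ge0.
  by apply: ler_sum => w _; exact/expR_le_1D2x/tot_le.
- move=> v; apply: le_trans (uA v); apply: lerD.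
    by apply: expR_le_1D2x; rewrite D1 addr_ge0// shift_ge0.
  rewrite [leRHS](bigID (fun w => w != v))/= ler_wpDr//.
    by apply: sumr_ge0 => w _; rewrite mulr_ge0// mulr_ge0// tot_ge0.
  by apply: ler_sum => w _; rewrite ler_wpM2r//; exact/expR_le_1D2x/tot_le.
Qed.

(** A change of [z v] multiplies [qS] by a smoothing average of a likelihood ratio that reads only
    the coordinates in [N v]. Logarithmic differences of the next density thereby become averages of
    local functions, to which [comparison] applies. *)
Lemma qS_step S h (z : XX) v y : v \in S -> bpos h ->
  qS S h (dfwith z v y) =
  wavg PP (fun x => h x * pS S x z) (fun x => p v x y / p v x (z v)) * qS S h z.
Proof.
move=> vS bh; rewrite /qS wavgK; last exact: bposM bh (pS_bpos1 LM S z).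
apply: eq_mean => x; rewrite mulrCA; congr (_ * _).
rewrite /pS (bigD1 v)//= [in RHS](bigD1 v)//= dfwithin mulrA.
rewrite divfK ?gt_eqF ?(p_gt0 LM)//; congr (_ * _).
by apply: eq_bigr => u /andP[_ uv]; rewrite dfwithout// eq_sym.
Qed.

Lemma likelihood_ratio_osc v (y y' : T v) :
  osc (fun x : XX => p v x y / p v x y')
    (fun w => if w \in N v then e ^- 2 - e ^+ 2 else 0).
Proof.
have e0 := e_gt0 LM.
have b x : e ^+ 2 <= p v x y / p v x y' <= e ^- 2.
  have /andP[h1 h2] := p_bnd LM x y; have /andP[h3 h4] := p_bnd LM x y'.
  have i1 : e <= (p v x y')^-1.
    by rewrite -[e]invrK lef_pV2 ?posrE ?invr_gt0 ?(p_gt0 LM).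
  have i2 : (p v x y')^-1 <= e^-1 by rewrite lef_pV2 ?posrE ?(p_gt0 LM).
  rewrite -exprVn !expr2; apply/andP; split; apply: ler_pM => //; try exact: ltW.
    by rewrite ltW// (p_gt0 LM).
  by rewrite invr_ge0 ltW// (p_gt0 LM).
move=> w x z; case: ifPn => wv.
  have := b x; have := b (dfwith x w z); rewrite ler_norml.
  by move=> /andP[? ?] /andP[? ?]; apply/andP; split; lra.
rewrite (loc_dfwith _ _ (p_loc LM y (v := v)))//.
by rewrite (loc_dfwith _ _ (p_loc LM y' (v := v)))// subrr normr0.
Qed.

Lemma likelihood_ratio_bm v (y y' : T v) : bm (fun x : XX => p v x y / p v x y').
Proof. by apply: bm_div; [apply: bpos_bm|]; exact: (p_bpos1 LM). Qed.

Lemma qS_comparison h h' D M u S S' (z z' : XX) (B : {set V}) v y :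
  bpos h -> bpos h' -> good_matrix M -> mixed_bound h M ->
  ratio_bound h h' D -> (forall v, 0 <= D v) ->
  (forall u, u \notin B -> (u \in S) = (u \in S') /\ z u = z' u) ->
  (forall v, D v + shift B v <= 2^-1) -> (forall v, 0 <= u v) ->
  (forall v, 2 * (D v + shift B v) + \sum_w 2 * tot M v w * u w <= u v) ->
  v \in S -> v \in S' -> z v = z' v ->
  qS S h (dfwith z v y) * qS S' h' z' <=
  expR (sig * \sum_(w in N v) u w) * (qS S h z * qS S' h' (dfwith z' v y)).
Proof.
move=> bh bh' gM hM hD D0 SS' D1 u0 uA vS vS' zz'.
set a := fun x : XX => p v x y / p v x (z v).
have := comparison bh bh' (likelihood_ratio_bm _ _)
  (likelihood_ratio_osc y (z v)) gM hM hD D0 SS' D1 u0 uA.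
rewrite !qS_step// -zz' -/a.
set H := fun x => _; set H' := fun x => h' x * _; set s := \sum_(w in N v) u w.
have -> : \sum_w u w * (if w \in N v then e ^- 2 - e ^+ 2 else 0) =
    s * (e ^- 2 - e ^+ 2).
  by rewrite mulr_suml [RHS]big_mkcond/=; apply: eq_bigr => w _; case: ifP; rewrite ?mulr0.
have e0 := e_gt0 LM.
have bH' : bpos H' by exact: bposM bh' (pS_bpos1 LM S' z').
have a2 : e ^+ 2 <= wavg PP H' a.
  apply: wavg_ge => //; first exact: likelihood_ratio_bm.
  move=> x; have /andP[h1 h2] := p_bnd LM x y; have /andP[h3 h4] := p_bnd LM x (z v).
  rewrite expr2; apply: ler_pM => //; try exact: ltW.
  by rewrite -[e]invrK lef_pV2 ?posrE ?invr_gt0 ?(p_gt0 LM).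
set r := wavg PP H a; set r' := wavg PP H' a => dr.
have q0 : 0 <= qS S h z by rewrite ltW// mean_gt0//; exact: bposM bh (pS_bpos1 LM S z).
have q'0 : 0 <= qS S' h' z' by rewrite ltW// mean_gt0.
have rr' : r <= expR (sig * s) * r'.
  have s0 : 0 <= s by apply: sumr_ge0 => w _.
  have r'0 : 0 < r' by rewrite (lt_le_trans _ a2)// exprn_gt0.
  apply: (@le_trans _ _ ((1 + sig * s) * r')); last first.
    by rewrite ler_wpM2r ?expR_ge1Dx// ltW.
  rewrite mulrDl mul1r; have : r <= r' + s * (e ^- 2 - e ^+ 2).
    by rewrite -lerBlDl (le_trans (ler_norm _)).
  move=> h1; apply: (le_trans h1); rewrite lerD2l mulrAC [leLHS]mulrC ler_wpM2r//.
  (* The range of the likelihood ratio divided by its least value is exactly [sig], which turns the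
     additive error into a relative one. *)
  have -> : e ^- 2 - e ^+ 2 = sig * e ^+ 2.
    rewrite (sig_lam LM) (lam_e LM) mulrBl mul1r; congr (_ - _).
    have -> : e ^- 4 = e ^- 2 / e ^+ 2 by rewrite -invfM -exprD.
    by rewrite divfK// expf_neq0// gt_eqF.
  by rewrite ler_wpM2l// (sig_ge0 LM).
set Q := qS S h z; set Q' := qS S' h' z'.
have -> : r * Q * Q' = r * (Q * Q') by ring.
have -> : expR (sig * s) * (Q * (r' * Q')) = expR (sig * s) * r' * (Q * Q') by ring.
by rewrite ler_wpM2r// mulr_ge0.
Qed.

Lemma qS_ratio h h' D om c S S' (B : {set V}) v (z : XX) y :
  bpos h -> bpos h' -> good h -> ratio_bound h h' D -> (forall v, 0 <= D v) ->
  (forall u, u \notin B -> (u \in S) = (u \in S')) ->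
  slow om -> 0 <= c -> (forall v, D v + shift B v <= c * om v) ->
  (forall v, D v + shift B v <= 2^-1) ->
  v \in S -> v \in S' ->
  qS S' h' (dfwith z v y) * qS S h z <=
  expR (8 * Dl%:R * sig * c * om v) * (qS S h (dfwith z v y) * qS S' h' z).
Proof.
move=> bh bh' [M gM hM] hD D0 SS' so c0 Dc D1 vS vS'; have [om0 _] := so.
set x := dfwith z v y.
(* Taking [x] as the base point and [z v] as the new value exchanges the two sides of the ratio
   bound. *)
have H : qS S h (dfwith x v (z v)) * qS S' h' x <=
    expR (sig * \sum_(w in N v) 4 * c * om w) *
      (qS S h x * qS S' h' (dfwith x v (z v))).
  (* [4 * c * om] is a supersolution: [2 * c * om] from the source, and half of itself from the
     interaction. Summed over [N v] it gives the factor 8. *)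
  apply: (@qS_comparison h h' D M (fun v => 4 * c * om v) S S' x x B) => //.
  - by move=> u uB; split; first exact: SS'.
  - by move=> w; rewrite !mulr_ge0.
  - move=> w; have h1 := Dc w; have h2 := tot_slow w gM so.
    have -> : \sum_w0 2 * tot M w w0 * (4 * c * om w0) =
        4 * c * \sum_w0 2 * tot M w w0 * om w0.
      by rewrite mulr_sumr; apply: eq_bigr => w0 _; ring.
    have : 4 * c * \sum_w0 2 * tot M w w0 * om w0 <= 4 * c * (2^-1 * om w).
      by rewrite ler_wpM2l// mulr_ge0.
    have := om0 w; lra.
move: H; rewrite /x dfwith_same dfwith_id mulrC => H; apply: (le_trans H).
rewrite ler_wpM2r//.
  by rewrite mulr_ge0// ltW// mean_gt0//; [exact: bposM bh (pS_bpos1 LM _ _)|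
    exact: bposM bh' (pS_bpos1 LM _ _)].
rewrite ler_expR -mulr_sumr.
have s0 := sig_ge0 LM; have h1 := sum_N_slow v so.
have -> : 8 * Dl%:R * sig * c * om v = sig * (4 * c * (2 * Dl%:R * om v)) by ring.
by rewrite ler_wpM2l// ler_wpM2l// mulr_ge0.
Qed.

Lemma shift1 u v : shift [set u]%SET v = if v \in N u then lam else 0.
Proof.
rewrite /shift; case: ifPn => vu.
  rewrite (eq_bigl (pred1 u)) ?big_pred1_eq// => w.
  by rewrite !inE; case: eqP => // ->; rewrite vu.
rewrite big1// => w; rewrite !inE => /andP[/eqP ->].
by rewrite (negbTE vu).
Qed.

Lemma qS_indep S h (z : XX) v y : v \notin S -> qS S h (dfwith z v y) = qS S h z.
Proof.
move=> vS; apply: eq_mean => x; congr (_ * _); apply: eq_bigr => u uS.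
by rewrite dfwithout//; apply: contraNneq vS => ->.
Qed.

Lemma loc_qS S h : loc S (qS S h).
Proof.
move=> z z' zz'; apply: eq_mean => x; congr (_ * _); apply: eq_bigr => u uS.
by rewrite zz'.
Qed.

(** The old matrix enters the new one only through the resolvent of [2 * tot M], which is bounded on
    slow weights, and in front of it stand the small factors [sig] and [lam]. The bound 1/8 is thus
    restored at every step instead of deteriorating with time. *)
Lemma good_qS S h : bpos h -> good h -> good (qS S h).
Proof.
move=> bh [M gM hM]; have l0 := lam_ge0 LM; have s0 := sig_ge0 LM.
have A0 v w : 0 <= 2 * tot M v w by rewrite mulr_ge0// tot_ge0.
(* Changing [z w] alters the single factor [p w], which is felt on the sites that it reads. *)
pose s w v : R := 2 * (if v \in N w then lam else 0).
have s_ge0 w v : 0 <= s w v by rewrite mulr_ge0//; case: ifP.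
have : forall w, exists u : V -> R, (forall v, 0 <= u v) /\
    forall v, u v = s w v + \sum_v' 2 * tot M v v' * u v'.
  move=> w; have [u u0 uE] := fixpoint_exists A0 (fun v => tot_row v gM) (s_ge0 w).
  by exists u.
move=> /choice[U HU].
have U0 v w : 0 <= U w v by have [] := HU w.
have bq := qS_bpos psi LM S bh.
have q0 z : 0 <= qS S h z by exact: bpos_ge0.
pose M' v w := sig * \sum_(v' in N v) U w v'.
have M'0 v w : 0 <= M' v w by rewrite mulr_ge0// sumr_ge0.
exists M'; last first.
  move=> v w x y z vw.
  have [vS|vS] := boolP (v \in S); last first.
    by apply: mixed_bound_indep => //; left=> x' z'; exact: qS_indep.
  have [wS|wS] := boolP (w \in S); last first.
    by apply: mixed_bound_indep => //; right=> x' z'; exact: qS_indep.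
  apply: (@qS_comparison h h (fun=> 0) M (U w) S S _ _ [set w]%SET) => //.
  - by apply: ratio_bound_refl => // x'; exact: bpos_ge0.
  - by move=> u; rewrite inE => uw; rewrite dfwithout// eq_sym.
  - move=> u; rewrite add0r shift1; case: ifP => _ //.
    by have [_ [_ h3]] := sig_bounds LM; have := lam_le_sig LM; lra.
  - move=> u; have [_ ->] := HU w; by rewrite add0r shift1.
  - by rewrite dfwithout// eq_sym.
split=> // om so v; have [om0 _] := so.
(* By linearity the weighted sum of the solutions solves the same equation with the summed source,
   so that one comparison bounds all of them together. *)
pose Y v := \sum_w U w v * om w.
have YE v' : Y v' = \sum_w s w v' * om w + \sum_v'' 2 * tot M v' v'' * Y v''.
  under [X in _ + X]eq_bigr do rewrite mulr_sumr.
  rewrite exchange_big/= -big_split/=; apply: eq_bigr => w _.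
  have [_ {1}->] := HU w; rewrite mulrDl; congr (_ + _).
  by rewrite mulr_suml; apply: eq_bigr => v'' _; rewrite mulrA.
have sY v' : \sum_w s w v' * om w <= 4 * lam * Dl%:R * om v'.
  have -> : \sum_w s w v' * om w = 2 * lam * \sum_(w in N v') om w.
    rewrite mulr_sumr [RHS]big_mkcond; apply: eq_bigr => w _.
    by rewrite /s (N_sym LM); case: ifP; rewrite ?mulr0 ?mul0r.
  have -> : 4 * lam * Dl%:R * om v' = 2 * lam * (2 * Dl%:R * om v') by ring.
  by rewrite ler_wpM2l ?mulr_ge0// sum_N_slow.
have Yom v' : Y v' <= 2 * (4 * lam * Dl%:R) * om v'.
  apply: (@fixpoint_le _ _ _ A0 (fun v => tot_row v gM) _ _ _ _ YE sY).
    by rewrite !mulr_ge0.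
  by move=> v''; exact: tot_slow.
have -> : \sum_w M' v w * om w = sig * \sum_(v' in N v) Y v'.
  rewrite /Y exchange_big/= mulr_sumr; apply: eq_bigr => w _.
  by rewrite /M' -mulrA mulr_suml.
apply: (@le_trans _ _ (sig * \sum_(v' in N v) 2 * (4 * lam * Dl%:R) * om v')).
  by rewrite ler_wpM2l// ler_sum.
rewrite -mulr_sumr.
have h1 := sum_N_slow v so; have [h2 [_ h3]] := sig_bounds LM.
have h4 := lam_le_sig LM; have h5 := om0 v.
apply: (@le_trans _ _ (sig * (2 * (4 * lam * Dl%:R) * (2 * Dl%:R * om v)))).
  by rewrite ler_wpM2l// ler_wpM2l// !mulr_ge0.
have -> : sig * (2 * (4 * lam * Dl%:R) * (2 * Dl%:R * om v)) =
    (64 * Dl%:R ^+ 2 * sig) * ((4^-1 * lam) * om v) by field.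
have h6 : 0 <= 4^-1 * lam * om v by rewrite !mulr_ge0.
apply: (@le_trans _ _ (4^-1 * lam * om v)); first by rewrite -[leRHS]mul1r ler_wpM2r.
by rewrite ler_wpM2r//; lra.
Qed.

Definition site_prod (s : forall v, T v -> R) S (x : XX) : R :=
  \prod_(v in S) s v (x v).

Lemma good_eq h h' : h =1 h' -> good h -> good h'.
Proof. by move=> /funext ->. Qed.

(** The logarithm is a sum of one-site functions and has no mixed differences. Conditioning on
    observations therefore does not affect goodness, and their lower bound does not enter the
    smallness condition. *)
Lemma mixed_bound_site (s : forall v, T v -> R) S : (forall v x, 0 <= s v x) ->
  mixed_bound (site_prod s S) (fun _ _ => 0).
Proof.
move=> s0.
apply: le_mixed_bound (mixed_bound_prod (index_enum V) (P := mem S)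
  (h := fun v x => s v (x v)) (M := fun _ _ _ => 0) _ _).
- by move=> x; apply: prodr_ge0 => v _.
- by move=> v w _; rewrite big1.
- by [].
move=> u _ v w x y z vw.
apply: (@mixed_bound_indep _ _ _ _ (fun x => s u (x u)) (fun _ _ => 0)) => //.
have [vu|vu] := eqVneq v u; last by left=> x' z'; rewrite dfwithout.
by subst v; right => x' z'; rewrite dfwithout// eq_sym.
Qed.

Lemma good_site h (s : forall v, T v -> R) S : bpos h -> (forall v x, 0 <= s v x) ->
  good h -> good (fun x => site_prod s S x * h x).
Proof.
move=> bh s0 [M gM hM]; exists M => //.
have s0' x : 0 <= site_prod s S x by apply: prodr_ge0.
apply: le_mixed_bound (mixed_boundM _ _ (mixed_bound_site S s0) hM).
- by move=> x; rewrite mulr_ge0//; exact: bpos_ge0.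
- by move=> v w _; rewrite add0r.
- by [].
- by move=> x; exact: bpos_ge0.
Qed.

Lemma ratio_bound_site h h' D (s : forall v, T v -> R) S : bpos h -> bpos h' ->
  (forall v x, 0 <= s v x) -> ratio_bound h h' D ->
  ratio_bound (fun x => site_prod s S x * h x) (fun x => site_prod s S x * h' x) D.
Proof.
move=> bh bh' s0 hD v x z; rewrite mulrACA [X in _ <= _ * X]mulrACA.
rewrite [leRHS]mulrCA ler_wpM2l//.
by rewrite mulr_ge0//; apply: prodr_ge0.
Qed.

Lemma good1 : good (fun=> 1).
Proof.
exists (fun _ _ => 0); last exact: mixed_bound1.
split => // om [om0 _] v; rewrite big1 => [|w _]; last by rewrite mul0r.
by rewrite mulr_ge0.
Qed.

(** The matrix is block diagonal: each row meets at most one of the disjoint sets. *)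
Lemma good_prod_disjoint (Q : {set {set V}}) (h : {set V} -> XX -> R) :
  finset.trivIset Q -> (forall K, K \in Q -> bpos (h K)) ->
  (forall K, K \in Q -> loc K (h K)) -> (forall K, K \in Q -> good (h K)) ->
  good (fun x => \prod_(K in Q) h K x).
Proof.
move=> tQ bh lh gh.
have /choice[M HM] : forall K, exists M, K \in Q -> good_matrix M /\ mixed_bound (h K) M.
  by move=> K; have [KQ|_] := boolP (K \in Q); [have [M] := gh K KQ; exists M|exists (fun _ _ => 0)].
pose M' (K : {set V}) (v w : V) : R := if (v \in K) && (w \in K) then M K v w else 0.
have M0 K v w : K \in Q -> 0 <= M K v w by move=> /HM[[]].
have M'0 K v w : K \in Q -> 0 <= M' K v w.
  by move=> KQ; rewrite /M'; case: ifP => // _; exact: M0.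
have h0 K x : K \in Q -> 0 <= h K x by move=> /bh bK; exact: bpos_ge0.
exists (fun v w => \sum_(K in Q) M' K v w); last first.
  apply: mixed_bound_prod => [K x|K KQ]; first exact: h0.
  move=> v w x y z vw.
  have [vK|vK] := boolP (v \in K); last first.
    apply: mixed_bound_indep => //; [by move=> x'; exact: h0|exact: M'0|].
    by left => x' z'; exact: loc_dfwith (lh K KQ) vK.
  have [wK|wK] := boolP (w \in K); last first.
    apply: mixed_bound_indep => //; [by move=> x'; exact: h0|exact: M'0|].
    by right => x' z'; exact: loc_dfwith (lh K KQ) wK.
  by have [_ hM] := HM K KQ; rewrite /M' vK wK; exact: hM.
split=> [v w|om so v]; first by apply: sumr_ge0 => K KQ; exact: M'0.
have [om0 _] := so.
under eq_bigr do rewrite mulr_suml.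
rewrite exchange_big/=.
have [[K KQ vK]|nK] := pselect (exists2 K, K \in Q & v \in K); last first.
  rewrite big1 => [|K KQ]; first by rewrite mulr_ge0.
  rewrite big1// => w _; rewrite /M' ifF ?mul0r//.
  by apply/negbTE/negP => /andP[vK _]; apply: nK; exists K.
rewrite (bigD1 K)//= [X in _ + X]big1 ?addr0 => [|K' /andP[K'Q K'K]].
  have [[_ gM] _] := HM K KQ; apply: le_trans (gM om so v).
  apply: ler_sum => w _; rewrite ler_wpM2r// /M'; case: ifP => // _; exact: M0.
rewrite big1// => w _; rewrite /M' ifF ?mul0r//.
apply/negbTE/negP => /andP[vK' _]; move/negP: K'K; apply.
by apply/eqP; rewrite -(def_pblock tQ K'Q vK') (def_pblock tQ KQ vK).
Qed.

End decay_of_correlations.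

(** * Bias of the block filter *)

Section block_filter_bias.
Context (R : realType) (V : finType) (d : V -> measure_display)
  (T : forall v, measurableType (d v)) (psi : forall v, probability (T v) R).
Local Notation XX := (product_space T).
Local Notation PP := (prodP psi : probability XX R).
Implicit Types (f h : XX -> R) (S J K : {set V}) (D om : V -> R).

Variables (N : V -> {set V}) (Dl : nat) (e lam sig : R).
Variable p : forall v, XX -> T v -> R.
Arguments p : clear implicits.
Hypothesis LM : local_model N Dl e lam sig p.
Local Notation pS := (pS p).
Local Notation qS := (qS psi p).
Local Notation good := (good N).
Local Notation slow := (slow N).

(** With an empty product of transitions, the smoothing comparison becomes one of [h] and [h']
    themselves. The 8 is the 4 of the supersolution [4 * c * om] times the oscillation 2 of [f]. *)
Lemma gibbs_close h h' f D om c J : bpos h -> bpos h' -> good h ->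
  ratio_bound h h' D -> (forall v, 0 <= D v) -> slow om -> 0 <= c ->
  (forall v, D v <= c * om v) -> (forall v, D v <= 2^-1) ->
  bm f -> (forall x, `|f x| <= 1) -> loc J f ->
  `|wavg PP h f - wavg PP h' f| <= 8 * c * \sum_(v in J) om v.
Proof.
move=> bh bh' [M gM hM] hD D0 so c0 Dc D1 bf f1 lf; have [om0 _] := so.
have of_ : osc f (fun v => if v \in J then 2 else 0).
  move=> v x z; case: ifPn => vJ; last by rewrite (loc_dfwith _ _ lf)// subrr normr0.
  by rewrite (le_trans (ler_normB _ _))// -[2]/(1 + 1) lerD.
have h0 k : (fun x => k x * pS finset.set0 x point) = k.
  by apply/funext => x; rewrite pS0 mulr1.
have s0 v : shift N lam finset.set0 v = 0.
  by rewrite /shift big1// => u; rewrite inE.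
have := @comparison _ _ _ _ psi _ _ _ _ _ _ LM h h' f _ D M (fun v => 4 * c * om v)
  finset.set0 finset.set0 point point finset.set0 bh bh' bf of_ gM hM hD D0.
rewrite !h0 => H; apply: le_trans (H _ _ _ _) _.
- by [].
- by move=> v; rewrite s0 addr0.
- by move=> v; rewrite !mulr_ge0.
- move=> v; rewrite s0 addr0; have h2 := tot_slow LM v gM so.
  have -> : \sum_w 2 * tot N lam M v w * (4 * c * om w) =
      4 * c * \sum_w 2 * tot N lam M v w * om w.
    by rewrite mulr_sumr; apply: eq_bigr => w _; ring.
  have : 4 * c * \sum_w 2 * tot N lam M v w * om w <= 4 * c * (2^-1 * om v).
    by rewrite ler_wpM2l// mulr_ge0.
  have := Dc v; lra.
rewrite mulr_sumr [leRHS]big_mkcond/=; apply: ler_sum => v _.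
by case: ifP => _; rewrite ?mulr0//; rewrite le_eqVlt; apply/orP; left; apply/eqP; ring.
Qed.

Variable P : {set {set V}}.
Hypothesis partP : finset.partition P [set: V]%SET.
Variable gl : nat -> forall v, T v -> R.
Arguments gl : clear implicits.
Hypothesis gl_bpos : forall k v, bpos (gl k v).
Local Notation gS k := (site_prod (gl k)).

Lemma gl_ge0 k v x : 0 <= gl k v x.
Proof. exact: bpos_ge0. Qed.

Lemma gS_bpos k S : bpos (gS k S).
Proof.
apply: bpos_prod => v _.
exact: (bpos_comp (gl_bpos k v) (@measurable_coord _ _ T v)).
Qed.

Lemma loc_gS k S : loc S (gS k S).
Proof. by move=> x x' xx'; apply: eq_bigr => v vS; rewrite xx'. Qed.

Lemma partP_triv : finset.trivIset P.
Proof. by have /and3P[] := partP. Qed.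

Lemma partP_cover v : v \in finset.cover P.
Proof. by have /and3P[/eqP -> _ _] := partP; rewrite inE. Qed.

Lemma pblockP v : finset.pblock P v \in P.
Proof. by rewrite pblock_mem// partP_cover. Qed.

Lemma mem_pblockP v : v \in finset.pblock P v.
Proof. by rewrite mem_pblock partP_cover. Qed.

Lemma pblock_eq K v : K \in P -> v \in K -> finset.pblock P v = K.
Proof. exact: def_pblock partP_triv. Qed.

Lemma gS_blocks k x : gS k [set: V]%SET x = \prod_(K in P) gS k K x.
Proof.
exact: (set_partition_big _ partP).
Qed.

Definition full_step k h (z : XX) : R := gS k [set: V]%SET z * qS [set: V]%SET h z.

Definition block_step k h (z : XX) : R := \prod_(K in P) (gS k K z * qS K h z).

Variable x0 : XX.

(** The initial law is a point mass without density. The recursion starts after the first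
    transition, so that the index [n] below stands for time [n.+1]. *)
Definition first_density (z : XX) : R := gS 1%N [set: V]%SET z * pS [set: V]%SET x0 z.

Definition full_density n := iteri n (fun k h => full_step k.+2 h) first_density.

Definition block_density n := iteri n (fun k h => block_step k.+2 h) first_density.

Lemma first_density_bpos : bpos first_density.
Proof.
apply: bposM; first exact: gS_bpos.
exact: (bpos_slice1 (F := fun x z => pS _ x z) x0 (pS_bpos2 LM _)).
Qed.

Lemma full_step_bpos k h : bpos h -> bpos (full_step k h).
Proof. by move=> bh; apply: bposM; [exact: gS_bpos|exact: (qS_bpos psi LM)]. Qed.

Lemma block_step_bpos k h : bpos h -> bpos (block_step k h).
Proof.
move=> bh; apply: bpos_prod => K _.
by apply: bposM; [exact: gS_bpos|exact: (qS_bpos psi LM)].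
Qed.

Lemma full_density_bpos n : bpos (full_density n).
Proof.
by elim: n => [|n IH]; [exact: first_density_bpos|exact: full_step_bpos].
Qed.

Lemma block_density_bpos n : bpos (block_density n).
Proof.
by elim: n => [|n IH]; [exact: first_density_bpos|exact: block_step_bpos].
Qed.

Lemma good_first_density : good first_density.
Proof.
have b1 : bpos (fun _ : XX => 1 : R) by exact: bpos_cst.
have p0 v x : 0 <= p v x0 x by rewrite ltW// (p_gt0 LM).
have g1 := good_site (N := N) [set: V]%SET b1 p0 (good1 R T N).
have b2 : bpos (fun x => site_prod (p^~ x0) [set: V]%SET x * 1).
  apply: eq_bpos (bpos_slice1 (F := fun x z => pS _ x z) x0 (pS_bpos2 LM [set: V]%SET)).
  by move=> x; rewrite mulr1.
have := good_site (N := N) [set: V]%SET b2 (gl_ge0 1) g1.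
by apply: good_eq => x; rewrite mulr1.
Qed.

Lemma good_full_density n : good (full_density n).
Proof.
elim: n => [|n IH]; first exact: good_first_density.
have bf := full_density_bpos n.
by apply: good_site; [exact: (qS_bpos psi LM)|exact: gl_ge0|exact: (good_qS psi LM)].
Qed.

(** [om K] will be [exp (- beta1 d(v, boundary K))] inside [K] and 1 outside. *)
Variable om : {set V} -> V -> R.
Hypothesis om_slow : forall K, K \in P -> slow (om K).
Hypothesis om_le1 : forall K v, om K v <= 1.
Hypothesis om_out : forall K v, K \in P -> v \notin K -> om K v = 1.
Hypothesis om_bdry : forall K v, K \in P -> v \in K -> ~~ (N v \subset K) -> om K v = 1.

Let ga := lam * Dl%:R.

(** The bound reproduces itself: the discrepancy left by the preceding step and that of the cut
    transitions are each at most [ga * om K], and a step contracts their sum by [8 * Dl * sig],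
    which is at most 1/8. *)
Lemma block_bias_ratio n : ratio_bound (full_density n) (block_density n)
  (fun v => ga * om (finset.pblock P v) v).
Proof.
have l0 := lam_ge0 LM; have s0 := sig_ge0 LM.
have ga0 : 0 <= ga by rewrite mulr_ge0.
have [_ [h1 h2]] := sig_bounds LM.
have ga1 : 64 * ga <= 1.
  apply: le_trans h1; rewrite mulrAC -mulrA ler_wpM2l// ler_wpM2r//.
  exact: lam_le_sig LM.
have om0 K v : K \in P -> 0 <= om K v by move=> /om_slow[].
have D0 v : 0 <= ga * om (finset.pblock P v) v by rewrite mulr_ge0// om0// pblockP.
elim: n => [|n IH].
  by apply: ratio_bound_refl => // x; exact: (bpos_ge0 x first_density_bpos).
move=> v x z; set K := finset.pblock P v.
have KP : K \in P by exact: pblockP.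
have vK : v \in K by exact: mem_pblockP.
have bf := full_density_bpos n; have bb := block_density_bpos n.
have key : qS K (block_density n) (dfwith x v z) * qS [set: V]%SET (full_density n) x <=
  expR (8 * Dl%:R * sig * (2 * ga) * om K v) *
  (qS [set: V]%SET (full_density n) (dfwith x v z) * qS K (block_density n) x).
  have Dle w : ga * om (finset.pblock P w) w + shift N lam (~: K) w <= 2 * ga * om K w.
    have -> : 2 * ga * om K w = ga * om K w + ga * om K w by ring.
    apply: lerD.
      (* Outside [K] the weight [om K] is 1 and dominates the weight of any other block. *)
      rewrite ler_wpM2l//; have [wK|wK] := boolP (w \in K); first by rewrite (pblock_eq KP wK).
      by rewrite (om_out KP wK).
    have [[u [uK wu]]|nu] := pselect (exists u, u \notin K /\ w \in N u); last first.
      rewrite /shift big1 ?mulr_ge0 ?om0// => u; rewrite inE => /andP[uK wu].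
      by case: nu; exists u.
    (* A cut transition connects [w] with a site outside [K], so that [w] is outside [K] as well or
       on its boundary. *)
    have -> : om K w = 1.
      have [wK|wK] := boolP (w \in K); last exact: om_out.
      apply: om_bdry => //; apply/negP => /fintype.subsetP/(_ u).
      by rewrite (N_sym LM) wu (negbTE uK) => /(_ isT).
    rewrite mulr1 /ga.
    apply: (@le_trans _ _ (\sum_(u in N w) lam)); last first.
      by rewrite sumr_const -[leLHS]mulr_natr ler_wpM2l// ler_nat (N_card LM).
    rewrite /shift [leLHS]big_mkcond [leRHS]big_mkcond; apply: ler_sum => u' _.
    by rewrite (N_sym LM); case: (u' \in ~: K); case: ifP.
  apply: (@qS_ratio _ _ _ _ psi _ _ _ _ _ _ LM (full_density n) (block_density n)
    (fun v => ga * om (finset.pblock P v) v) (om K) (2 * ga) [set: V]%SET K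
    (~: K)%SET) => //.
  - exact: good_full_density.
  - by move=> u; rewrite !inE negbK => ->.
  - exact: om_slow.
  - by rewrite mulr_ge0.
  - move=> w; apply: le_trans (Dle w) _.
    have : 2 * ga * om K w <= 2 * ga * 1 by rewrite ler_wpM2l ?mulr_ge0.
    lra.
have E1 : expR (8 * Dl%:R * sig * (2 * ga) * om K v) <= expR (ga * om K v).
  rewrite ler_expR ler_wpM2r// ?om0//.
  have -> : 8 * Dl%:R * sig * (2 * ga) = (64 * Dl%:R * sig) * (4^-1 * ga) by field.
  apply: (@le_trans _ _ (1 * (4^-1 * ga))); last by lra.
  by rewrite ler_wpM2r//; lra.
have rest y : block_density n.+1 y = gS n.+2 [set: V]%SET y *
    (qS K (block_density n) y * \prod_(K' in P | K' != K) qS K' (block_density n) y).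
  rewrite /block_density/= -/(block_density n) /block_step big_split/= -gS_blocks.
  by rewrite (bigD1 K KP).
have restv : \prod_(K' in P | K' != K) qS K' (block_density n) (dfwith x v z) =
    \prod_(K' in P | K' != K) qS K' (block_density n) x.
  apply: eq_bigr => K' /andP[K'P K'K]; apply: qS_indep.
  by apply: contraNN K'K => vK'; rewrite -(pblock_eq K'P vK').
rewrite !rest restv /full_density/= -/(full_density n) /full_step.
set r := \prod_(_ in _ | _) _; have r0 : 0 <= r.
  by apply: prodr_ge0 => K' _; apply: bpos_ge0; exact: (qS_bpos psi LM).
set a := gS _ _ _; set a' := gS _ _ _.
have a0 : 0 <= a by apply: (bpos_ge0 _ (gS_bpos _ _)).
have a'0 : 0 <= a' by apply: (bpos_ge0 _ (gS_bpos _ _)).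
move: key; set b := qS K _ _; set b' := qS _ _ x; set c := qS _ _ (dfwith _ _ _).
set c' := qS K _ _ => key.
have -> : a * (b * r) * (a' * b') = (a * r * a') * (b * b') by ring.
have -> : expR (ga * om K v) * (a * c * (a' * (c' * r))) =
  (a * r * a') * (expR (ga * om K v) * (c * c')) by ring.
rewrite ler_wpM2l ?mulr_ge0//; apply: (le_trans key); rewrite ler_wpM2r//.
have bq1 := qS_bpos psi LM [set: V]%SET bf; have bq2 := qS_bpos psi LM K bb.
by rewrite mulr_ge0//; [exact: bpos_ge0 bq1|exact: bpos_ge0 bq2].
Qed.

Lemma block_bias n K J f : K \in P -> J \subset K -> bm f ->
  (forall x, `|f x| <= 1) -> loc J f ->
  `|wavg PP (full_density n) f - wavg PP (block_density n) f| <=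
  \sum_(v in J) om K v.
Proof.
move=> KP JK bf f1 lf; have l0 := lam_ge0 LM.
have ga0 : 0 <= ga by rewrite mulr_ge0.
have [_ [h1 h2]] := sig_bounds LM.
have ga1 : 64 * ga <= 1.
  apply: le_trans h1; rewrite mulrAC -mulrA ler_wpM2l// ler_wpM2r//.
  exact: lam_le_sig LM.
have om0 K' v : K' \in P -> 0 <= om K' v by move=> /om_slow[].
have := @gibbs_close _ _ f _ (om K) ga J (full_density_bpos n)
  (block_density_bpos n) (good_full_density n) (block_bias_ratio n).
move=> H; apply: le_trans (H _ _ _ _ _ _ _ _) _ => //.
- by move=> v; rewrite mulr_ge0// om0// pblockP.
- exact: om_slow.
- move=> v; rewrite ler_wpM2l//; have [vK|vK] := boolP (v \in K).
    by rewrite (pblock_eq KP vK).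
  by rewrite (om_out KP vK).
- move=> v; have : ga * om (finset.pblock P v) v <= ga * 1 by rewrite ler_wpM2l.
  lra.
rewrite -[leRHS]mul1r ler_wpM2r//; last lra.
by apply: sumr_ge0 => v _; exact: om0.
Qed.

End block_filter_bias.

(** * Computation tree of the block filter *)

Section computation_tree.
Context (R : realType) (V : finType) (d : V -> measure_display)
  (T : forall v, measurableType (d v)) (psi : forall v, probability (T v) R).
Local Notation XX := (product_space T).
Local Notation PP := (prodP psi : probability XX R).
Implicit Types (a b f h : XX -> R) (S J K : {set V}) (D om : V -> R).

Variables (N : V -> {set V}) (Dl : nat) (e lam sig : R).
Variable p : forall v, XX -> T v -> R.
Arguments p : clear implicits.
Hypothesis LM : local_model N Dl e lam sig p.
Local Notation pS := (pS p).
Local Notation qS := (qS psi p).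
Local Notation good := (good N).

Variable P : {set {set V}}.
Hypothesis partP : finset.partition P [set: V]%SET.
Variable gl : nat -> forall v, T v -> R.
Arguments gl : clear implicits.
Hypothesis gl_bpos : forall k v, bpos (gl k v).
Local Notation gS k := (site_prod (gl k)).

(** In the theorem [Qn K] collects the blocks at distance at most [r] from [K]; the tree relies only
    on the two properties that follow. *)
Variable Qn : {set V} -> {set {set V}}.
Hypothesis Qn_sub : forall K, K \in P -> Qn K \subset P.
Hypothesis Qn_cover : forall K v, K \in P -> v \in K ->
  N v \subset finset.cover (Qn K).

Let tP : finset.trivIset P := partP_triv partP.

Lemma Qn_P K K' : K \in P -> K' \in Qn K -> K' \in P.
Proof. by move=> /Qn_sub/fintype.subsetP; apply. Qed.

Lemma Qn_triv K : K \in P -> finset.trivIset (Qn K).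
Proof. by move=> KP; apply: trivIsetS tP; exact: Qn_sub. Qed.

Lemma loc_pS K z : K \in P -> loc (finset.cover (Qn K)) (fun x => pS K x z).
Proof.
move=> KP; apply: loc_prod => v vK; apply: locS (p_loc LM (z v)).
exact: Qn_cover.
Qed.

(* Unnormalised laws of block [K] at time [k + m], for a block filter that at
   time [k - 1] is pinned to deterministic states, chosen independently for each
   leaf of the tree of blocks that influence [K]. *)
Inductive pinned (k : nat) : nat -> {set V} -> (XX -> R) -> Prop :=
| Pinned0 K x : pinned k 0 K (fun z => gS k K z * pS K x z)
| PinnedS m K (dd : {set V} -> XX -> R) :
    (forall K', K' \in Qn K -> pinned k m K' (dd K')) ->
    pinned k m.+1 K
      (fun z => gS (k + m.+1) K z * qS K (fun y => \prod_(K' in Qn K) dd K' y) z).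

(** One fixed pinned law, whose averages serve as centring constants. *)
Fixpoint pin (k m : nat) K : XX -> R := if m is m'.+1 then
    fun z => gS (k + m) K z * qS K (fun y => \prod_(K' in Qn K) pin k m' K' y) z
  else fun z => gS k K z * pS K point z.

Lemma pinned_pin k m K : pinned k m K (pin k m K).
Proof. by elim: m K => [|m IH] K; [exact: Pinned0|exact: PinnedS]. Qed.

Lemma loc_pS2 K x : loc K (pS K x).
Proof. by move=> z z' zz'; apply: eq_bigr => v vK; rewrite zz'. Qed.

Lemma pS_bposr S x : bpos (pS S x).
Proof. exact: (bpos_slice1 (F := fun x z => pS S x z) x (pS_bpos2 LM S)). Qed.

Lemma pinned_props k m K dd : K \in P -> pinned k m K dd ->
  [/\ bpos dd, loc K dd & good dd].
Proof.
move=> KP pd; elim: m K dd / pd KP => [K x|m K dd _ IH] KP.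
  split.
  - by apply: bposM; [exact: gS_bpos|exact: pS_bposr].
  - by apply: locM; [exact: loc_gS|exact: loc_pS2].
  - have b1 : bpos (fun _ : XX => 1 : R) by exact: bpos_cst.
    have p0 v y : 0 <= p v x y by rewrite ltW// (p_gt0 LM).
    have g1 := good_site (N := N) K b1 p0 (good1 R T N).
    have b2 : bpos (fun y => site_prod (p^~ x) K y * 1).
      by apply: eq_bpos (pS_bposr K x) => y; rewrite mulr1.
    have := good_site (N := N) K b2 (gl_ge0 gl_bpos k) g1.
    by apply: good_eq => y; rewrite mulr1.
have bd K' : K' \in Qn K -> bpos (dd K') by move=> KQ; have [] := IH K' KQ (Qn_P KP KQ).
have bp : bpos (fun y => \prod_(K' in Qn K) dd K' y) by exact: bpos_prod.
split.
- by apply: bposM; [exact: gS_bpos|exact: (qS_bpos psi LM)].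
- by apply: locM; [exact: loc_gS|exact: loc_qS].
apply: good_site; [exact: (qS_bpos psi LM)|exact: gl_ge0|].
apply: (good_qS psi LM) => //; apply: good_prod_disjoint => //.
- exact: Qn_triv.
- by move=> K' KQ; have [] := IH K' KQ (Qn_P KP KQ).
- by move=> K' KQ; have [] := IH K' KQ (Qn_P KP KQ).
Qed.

Definition rho : R := 8 * Dl%:R * sig.

Lemma rho_ge0 : 0 <= rho.
Proof. by rewrite /rho !mulr_ge0// (sig_ge0 LM). Qed.

Lemma rho_le1 : rho <= 1.
Proof.
have [_ [h _]] := sig_bounds LM; rewrite /rho.
have := rho_ge0; rewrite /rho; lra.
Qed.

Lemma lam_rho m : 0 <= lam * rho ^+ m <= 64^-1.
Proof.
have l0 := lam_ge0 LM; have r0 := rho_ge0.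
rewrite mulr_ge0 ?exprn_ge0//=.
apply: (@le_trans _ _ (lam * 1)).
  by rewrite ler_wpM2l// exprn_ile1// rho_le1.
by have [_ [_ h]] := sig_bounds LM; have := lam_le_sig LM; lra.
Qed.

Lemma sum_disjoint_le (Q : {set {set V}}) (v : V) (c : R) : finset.trivIset Q ->
  0 <= c -> \sum_(K in Q) (if v \in K then c else 0) <= c.
Proof.
move=> tQ c0; have [[K KQ vK]|nK] := pselect (exists2 K, K \in Q & v \in K); last first.
  rewrite big1// => K KQ; case: ifP => // vK; by case: nK; exists K.
rewrite (bigD1 K)//= vK big1 ?addr0// => K' /andP[K'Q K'K].
case: ifP => // vK'; move/negP: K'K; case; apply/eqP.
by rewrite -(def_pblock tQ K'Q vK') (def_pblock tQ KQ vK).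
Qed.

Lemma ratio_bound_loc h h' K (c : R) : (forall x, 0 <= h x) -> (forall x, 0 <= h' x) ->
  loc K h -> loc K h' ->
  (forall v x z, v \in K -> h' (dfwith x v z) * h x <= expR c * (h (dfwith x v z) * h' x)) ->
  ratio_bound h h' (fun v => if v \in K then c else 0).
Proof.
move=> h0 h'0 lh lh' H v x z; case: ifPn => vK; first exact: H.
by rewrite (loc_dfwith _ _ lh vK) (loc_dfwith _ _ lh' vK) expR0 mul1r mulrC.
Qed.

(** At a leaf the two pinned states act on each site through one transition factor, hence [lam]. A
    level of the tree contracts by [rho], and the children do not add up: they are disjoint, so that
    a site lies in at most one of them. *)
Lemma pinned_ratio k m K dd dd' : K \in P -> pinned k m K dd -> pinned k m K dd' ->
  ratio_bound dd dd' (fun v => if v \in K then lam * rho ^+ m else 0).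
Proof.
have l0 := lam_ge0 LM.
move=> KP pd; elim: m K dd / pd KP dd' => [K x|m K dd pdd IH] KP dd' pd'.
  inversion pd' as [K0 x' E1 E2|]; subst K0.
  have p0 y v z : 0 <= p v y z by rewrite ltW// (p_gt0 LM).
  have -> : (fun v => if v \in K then lam * rho ^+ 0 else 0) =
      (fun v => if v \in K then lam else 0).
    by apply/funext => v; rewrite expr0 mulr1.
  apply: (ratio_bound_site K) (gl_ge0 gl_bpos k) _; do ?exact: pS_bposr.
  have pS0 y z : 0 <= pS K y z by rewrite ltW// (pS_gt0 LM).
  apply: ratio_bound_loc => //; do ?exact: loc_pS2.
  by move=> v y z vK; exact: (pS_cross LM).
inversion pd' as [|m' K0 dd2 pdd2 E1 E2 E3]; subst m' K0.
have bd K' : K' \in Qn K -> bpos (dd K').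
  by move=> KQ; have [] := pinned_props (Qn_P KP KQ) (pdd K' KQ).
have bd2 K' : K' \in Qn K -> bpos (dd2 K').
  by move=> KQ; have [] := pinned_props (Qn_P KP KQ) (pdd2 K' KQ).
have bp : bpos (fun y => \prod_(K' in Qn K) dd K' y) by exact: bpos_prod.
have bp2 : bpos (fun y => \prod_(K' in Qn K) dd2 K' y) by exact: bpos_prod.
have bq := qS_bpos psi LM K bp; have bq2 := qS_bpos psi LM K bp2.
apply: (ratio_bound_site K bq bq2 (gl_ge0 gl_bpos _)).
have q0 y := bpos_ge0 y bq; have q20 y := bpos_ge0 y bq2.
apply: ratio_bound_loc => //; do ?exact: loc_qS.
move=> v y z vK; have /andP[c0 c1] := lam_rho m.
have -> : lam * rho ^+ m.+1 = 8 * Dl%:R * sig * (lam * rho ^+ m) * 1.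
  by rewrite exprS /rho; ring.
have sh w : shift N lam finset.set0 w = 0 by rewrite /shift big1// => u; rewrite inE.
apply: (@qS_ratio _ _ _ _ psi _ _ _ _ _ _ LM _ _
  (fun v => \sum_(K' in Qn K) (if v \in K' then lam * rho ^+ m else 0))
  (fun=> 1) (lam * rho ^+ m) K K finset.set0) => //.
- have gp K' (KQ : K' \in Qn K) := pinned_props (Qn_P KP KQ) (pdd K' KQ).
  apply: good_prod_disjoint; first exact: Qn_triv.
  + by move=> K' /gp[].
  + by move=> K' /gp[].
  + by move=> K' /gp[].
- apply: ratio_bound_prod => [K' x /bd b1|K' x /bd2 b2|K' KQ].
  + exact: bpos_ge0.
  + exact: bpos_ge0.
  + exact: IH KQ (Qn_P KP KQ) _ (pdd2 K' KQ).
- by move=> w; apply: sumr_ge0 => K' _; case: ifP.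
- exact: slow1.
- by move=> w; rewrite sh addr0 mulr1; apply: sum_disjoint_le => //; exact: Qn_triv.
- move=> w; rewrite sh addr0 (le_trans (sum_disjoint_le _ _ c0))//; first exact: Qn_triv.
  by apply: le_trans c1 _; lra.
Qed.

Lemma pinned_close k m K J dd dd' f : K \in P -> pinned k m K dd -> pinned k m K dd' ->
  bm f -> (forall x, `|f x| <= 1) -> loc J f ->
  `|wavg PP dd f - wavg PP dd' f| <= rho ^+ m * #|J|%:R.
Proof.
move=> KP pd pd' bf f1 lf.
have [bd _ gd] := pinned_props KP pd; have [bd' _ _] := pinned_props KP pd'.
have /andP[c0 c1] := lam_rho m; have r0 : 0 <= rho ^+ m by rewrite exprn_ge0// rho_ge0.
have := @gibbs_close _ _ _ _ psi _ _ _ _ _ _ LM dd dd' f _ (fun=> 1) (lam * rho ^+ m) J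
  bd bd' gd (pinned_ratio KP pd pd').
move=> H; apply: le_trans (H _ _ _ _ _ _ _ _) _ => //.
- by move=> v; case: ifP.
- exact: slow1.
- by move=> v; rewrite mulr1; case: ifP.
- by move=> v; case: ifP => _; lra.
rewrite sumr_const ler_wpM2r//.
have [_ [_ h]] := sig_bounds LM; have := lam_le_sig LM => h2.
have -> : 8 * (lam * rho ^+ m) = (8 * lam) * rho ^+ m by ring.
by rewrite -[leRHS]mul1r ler_wpM2r//; lra.
Qed.

(* [dd] is a mixture of pinned laws, expressed by duality. *)
Definition mixed k m K dd := forall a, bm a ->
  (forall dd', pinned k m K dd' -> 0 <= mean PP (fun z => a z * dd' z)) ->
  0 <= mean PP (fun z => a z * dd z).

(** Adjoint of [qS K]: it moves a test function one step back in time. *)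
Definition dual K b (y : XX) : R := mean PP (fun z => b z * pS K y z).

Lemma bm_dual2 K b : bm b -> bm (fun u : XX * XX => b u.2 * pS K u.1 u.2).
Proof.
move=> bb; apply: bmM; first exact: bm_comp bb measurable_snd.
exact: bpos_bm (pS_bpos2 LM K).
Qed.

Lemma bm_dual K b : bm b -> bm (dual K b).
Proof.
by move=> bb; have := bm_mean2 PP (F := fun y z => b z * pS K y z) (bm_dual2 K bb).
Qed.

Lemma bpos_dual K b : bpos b -> bpos (dual K b).
Proof.
move=> bb; have [bb1 [c c0 cb]] := bb; split; first exact: bm_dual.
have [_ [c' c'0 cS]] := pS_bpos2 LM K.
exists (c * c'); first exact: mulr_gt0.
move=> y; apply: mean_ge.
  exact: (bm_slice1 (F := fun y z => b z * pS K y z) y (bm_dual2 K bb1)).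
by move=> z; apply: ler_pM; [exact: ltW|exact: ltW|exact: cb|exact: (cS (y, z))].
Qed.

Lemma loc_dual K b : K \in P -> loc (finset.cover (Qn K)) (dual K b).
Proof.
by move=> KP y y' yy'; apply: eq_mean => z; rewrite (loc_pS z KP yy').
Qed.

Lemma mean_qS K b h : bm b -> bm h ->
  mean PP (fun z => b z * qS K h z) = mean PP (fun y => h y * dual K b y).
Proof.
move=> bb bh.
pose F (y z : XX) := h y * b z * pS K y z.
have bF : bm (fun u : XX * XX => F u.1 u.2).
  apply: bmM; last exact: bpos_bm (pS_bpos2 LM K).
  by apply: bmM; [exact: bm_comp bh measurable_fst|exact: bm_comp bb measurable_snd].
transitivity (mean PP (fun z => mean PP (fun y => F y z))).
  apply: eq_mean => z; rewrite -meanZl.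
    by apply: eq_mean => y; rewrite /F; ring.
  by apply: bmM => //; exact: bpos_bm (pS_bpos1 LM K z).
rewrite -mean_fubini//; apply: eq_mean => y; rewrite -meanZl.
  by apply: eq_mean => z; rewrite /F; ring.
exact: (bm_slice1 (F := fun y z => b z * pS K y z) y (bm_dual2 K bb)).
Qed.

Lemma mean_gqS K k b h : bm b -> bm h ->
  mean PP (fun z => b z * (gS k K z * qS K h z)) =
  mean PP (fun y => h y * dual K (fun z => b z * gS k K z) y).
Proof.
move=> bb bh; rewrite -mean_qS//; last first.
  by apply: bmM => //; exact: bpos_bm (gS_bpos gl_bpos k K).
by apply: eq_mean => z; rewrite mulrA.
Qed.

(** Multilinearity: one factor at a time is replaced by a pinned law, while the others belong to the
    test function. *)
Lemma mixed_prod k m (l : seq {set V}) (dd : {set V} -> XX -> R) a : uniq l ->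
  (forall K, K \in l -> K \in P) ->
  (forall K, K \in l -> mixed k m K (dd K) /\ bm (dd K)) -> bm a ->
  (forall ee : {set V} -> XX -> R, (forall K, K \in l -> pinned k m K (ee K)) ->
    0 <= mean PP (fun y => (\prod_(K <- l) ee K y) * a y)) ->
  0 <= mean PP (fun y => (\prod_(K <- l) dd K y) * a y).
Proof.
elim: l a => [|K l IH] a /= ul lP ml ba H.
  have := H dd; rewrite (@eq_mean _ _ _ _ (fun y => (\prod_(K <- [::]) dd K y) * a y) (fun y => (\prod_(K <- [::]) dd K y) * a y))//.
  by apply.
move: ul => /andP[Kl ul].
have Kh : K \in K :: l by rewrite inE eqxx.
have lh K' : K' \in l -> K' \in K :: l by rewrite inE => ->; rewrite orbT.
have bl : bm (fun y => \prod_(K' <- l) dd K' y).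
  rewrite (_ : (fun y => _) = (fun y => \prod_(K' <- l | K' \in l) dd K' y)).
    by apply: bm_prod => K' K'l; have [] := ml K' (lh _ K'l).
  by apply/funext => y; rewrite big_seq.
have [mK bK] := ml K Kh.
rewrite (@eq_mean _ _ _ _ _ (fun y => ((\prod_(K' <- l) dd K' y) * a y) * dd K y)); last first.
  by move=> y; rewrite big_cons; ring.
apply: mK => [|e1 pe1]; first exact: bmM.
have [[be1 _] _ _] := pinned_props (lP K Kh) pe1.
rewrite (@eq_mean _ _ _ _ _ (fun y => (\prod_(K' <- l) dd K' y) * (a y * e1 y))); last first.
  by move=> y; rewrite mulrA.
apply: IH => //.
- by move=> K' /lh; exact: lP.
- by move=> K' /lh; exact: ml.
- exact: bmM.
move=> ee pe; have := H (fun K' => if K' == K then e1 else ee K').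
rewrite (@eq_mean _ _ _ _ _ (fun y => (\prod_(K' <- l) ee K' y) * (a y * e1 y))); last first.
  move=> y; rewrite big_cons eqxx.
  under eq_big_seq => K' K'l.
    have -> : (K' == K) = false by apply/negbTE; apply: contraNneq Kl => <-.
    over.
  by ring.
apply => K'; rewrite inE; have [->//|_ /=] := eqVneq K' K; exact: pe.
Qed.

(** Unrolled recursion of the block marginals, with [h] at every leaf. A block may occur in several
    branches; blocking discards the correlations between siblings, so that each occurrence can be
    varied separately. *)
Fixpoint node k h (m : nat) K : XX -> R := if m is m'.+1 then
    fun z => gS (k + m) K z * qS K (fun y => \prod_(K' in Qn K) node k h m' K' y) z
  else fun z => gS k K z * qS K h z.

Lemma node_bpos k h m K : bpos h -> bpos (node k h m K).
Proof.
move=> bh; elim: m K => [|m IH] K.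
  by apply: bposM; [exact: gS_bpos|exact: (qS_bpos psi LM)].
apply: bposM; [exact: gS_bpos|apply: (qS_bpos psi LM)].
by apply: bpos_prod => K' _.
Qed.

Lemma loc_node k h m K : loc K (node k h m K).
Proof. by case: m => [|m]; apply: locM; do ?[exact: loc_gS|exact: loc_qS]. Qed.

(** At a leaf [h] is a nonnegative mixture of point masses, and the rest of the tree is multilinear
    in its leaves. *)
Lemma node_mixed k h m K : bpos h -> K \in P -> mixed k m K (node k h m K).
Proof.
move=> bh; elim: m K => [|m IH] K KP a ba H.
  rewrite mean_gqS//; last exact: bpos_bm.
  apply: mean_ge0 => y.
  rewrite mulr_ge0 ?(bpos_ge0 y bh)//.
  have := H _ (Pinned0 k K y).
  by congr (0 <= _); apply: eq_mean => z; rewrite mulrA.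
have bn K' : K' \in Qn K -> bpos (node k h m K') by move=> _; exact: node_bpos.
have bp : bm (fun y => \prod_(K' in Qn K) node k h m K' y).
  by apply: bm_prod => K' /bn/bpos_bm.
rewrite mean_gqS//.
set al := dual K _.
have bal : bm al by apply: bm_dual; apply: bmM => //; exact: bpos_bm (gS_bpos gl_bpos _ _).
rewrite (@eq_mean _ _ _ _ _ (fun y => (\prod_(K' <- enum (Qn K)) node k h m K' y) * al y)); last first.
  by move=> y; rewrite big_enum.
apply: (@mixed_prod k m) => //.
- exact: enum_uniq.
- by move=> K'; rewrite mem_enum; exact: Qn_P.
- move=> K'; rewrite mem_enum => KQ; split; last exact: bpos_bm (node_bpos _ _ _ bh).
  by apply: IH; exact: Qn_P KP KQ.
move=> ee pe.
have pe' K' : K' \in Qn K -> pinned k m K' (ee K').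
  by move=> KQ; apply: pe; rewrite mem_enum.
have := H _ (PinnedS pe').
rewrite mean_gqS//; last first.
  apply: bm_prod => K' KQ.
  by have [[]] := pinned_props (Qn_P KP KQ) (pe' _ KQ).
by congr (0 <= _); apply: eq_mean => y; rewrite big_enum.
Qed.

Variable err : {set V} -> R.

Fixpoint tree_err (m : nat) K : R :=
  if m is m'.+1 then \sum_(K' in Qn K) tree_err m' K' else err K.

Variable C : R.
Hypothesis C_ge : forall K, K \in P -> (e ^- 2) ^+ #|K| <= C.

Lemma pS_ratio K x x' z : K \in P -> pS K x z <= C * pS K x' z.
Proof.
move=> KP; have e0 := e_gt0 LM.
apply: le_trans (_ : (e ^- 2) ^+ #|K| * pS K x' z <= _); last first.
  by rewrite ler_wpM2r ?C_ge// ltW// (pS_gt0 LM).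
rewrite -prodr_const -big_split/=; apply: ler_prod => v _.
have /andP[h1 h2] := p_bnd LM x (z v); have /andP[h3 h4] := p_bnd LM x' (z v).
rewrite (le_trans (ltW e0))//= (le_trans h2)//.
have -> : e^-1 = e ^- 2 * e.
  by rewrite expr2 invfM -mulrA mulVf ?mulr1// gt_eqF.
by rewrite ler_wpM2l// invr_ge0 exprn_ge0// ltW.
Qed.

(** Written as two positivity statements, the bound passes from pinned laws to mixtures, which are
    characterised by positivity. *)
Lemma abs_mean_leP (w al be : XX -> R) ga : bm w -> bm al -> bm be ->
  (`|mean PP (fun y => w y * al y)| <= ga * mean PP (fun y => w y * be y)) <->
  (forall s : bool, 0 <= mean PP (fun y => w y * (ga * be y + (-1) ^+ s * al y))).
Proof.
move=> bw bal bbe.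
have E (s : bool) : mean PP (fun y => w y * (ga * be y + (-1) ^+ s * al y)) =
    ga * mean PP (fun y => w y * be y) + (-1) ^+ s * mean PP (fun y => w y * al y).
  rewrite -!meanZl; [|exact: bmM..]; rewrite -meanD; do ?[by apply: bmM; [exact: bm_cst|exact: bmM]].
  by apply: eq_mean => y; ring.
split=> [H s|H].
  rewrite E; move: H; rewrite ler_norml => /andP[h1 h2].
  by case: s; rewrite ?expr1 ?expr0; lra.
have := H true; have := H false; rewrite !E expr1 expr0 => h1 h2.
by rewrite ler_norml; apply/andP; split; lra.
Qed.

Lemma quotient_change (A B A' B' x y g : R) : 0 < B -> 0 < B' ->
  `|A - A'| <= g * x * B -> `|B - B'| <= x * B -> `|A'| <= g * B' -> 
  `|A / B - A' / B'| <= 2 * g * x.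
Proof.
move=> B0 B'0 hA hB hA'.
have -> : A / B - A' / B' = ((A - A') - A' / B' * (B - B')) / B.
  by field; rewrite !gt_eqF.
rewrite normrM normfV (gtr0_norm B0) ler_pdivrMr//.
apply: le_trans (ler_normB _ _) _.
have -> : 2 * g * x * B = g * x * B + g * (x * B) by ring.
apply: lerD => //; rewrite normrM; apply: ler_pM => //.
by rewrite normrM normfV (gtr0_norm B'0) ler_pdivrMr.
Qed.

Variables h h' : XX -> R.
Hypothesis bh : bpos h.
Hypothesis bh' : bpos h'.
Hypothesis h_err : forall K c f, K \in P -> bm f -> loc (finset.cover (Qn K)) f ->
  0 <= c -> (forall x, `|f x| <= c) -> `|wavg PP h f - wavg PP h' f| <= err K * c.

(** The hypothesis bounds a quotient by [ga] under all pinned laws. It persists for mixtures, hence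
    at every stage of exchanging the leaves [h] for [h'] one by one, while an exchange changes the
    quotient only through a relative error [err * C]. The smallness of [ga] is thus kept in front of
    the sum of the leaf errors. *)
Lemma tree_compare k m K (a b : XX -> R) ga : K \in P -> bm a -> bpos b -> 0 <= ga ->
  (forall dd, pinned k m K dd ->
    `|mean PP (fun z => a z * dd z)| <= ga * mean PP (fun z => b z * dd z)) ->
  `|mean PP (fun z => a z * node k h m K z) / mean PP (fun z => b z * node k h m K z) -
    mean PP (fun z => a z * node k h' m K z) / mean PP (fun z => b z * node k h' m K z)|
  <= 2 * ga * (tree_err m K * C).
Proof.
elim: m K a b => [|m IH] K a b KP ba bb ga0 H /=.
  have bmb := bpos_bm bb; have bgS := gS_bpos gl_bpos k K.
  have bmh := bpos_bm bh; have bmh' := bpos_bm bh'.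
  rewrite !mean_gqS//.
  set al := dual K _; set be := dual K _.
  have bal : bm al by apply: bm_dual; apply: bmM => //; exact: bpos_bm.
  have bbe : bpos be by apply: bpos_dual; exact: bposM.
  have alb y : `|al y| <= ga * be y.
    have := H _ (Pinned0 k K y); congr (`|_| <= _ * _);
      by apply: eq_mean => z; rewrite mulrA.
  (* All states lead to [K] with comparable densities, so that the denominator bounds its own test
     function pointwise and the error becomes relative. *)
  have beC y y' : be y <= C * be y'.
    rewrite /be /dual -meanZl; last first.
      exact: (bm_slice1 (F := fun y z => b z * gS k K z * pS K y z) y'
        (bm_dual2 K (bpos_bm (bposM bb bgS)))).
    apply: le_mean.
    - exact: (bm_slice1 (F := fun y z => b z * gS k K z * pS K y z) y
        (bm_dual2 K (bpos_bm (bposM bb bgS)))).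
    - apply: bmM; first exact: bm_cst.
      exact: (bm_slice1 (F := fun y z => b z * gS k K z * pS K y z) y'
        (bm_dual2 K (bpos_bm (bposM bb bgS)))).
    move=> z; rewrite mulrCA ler_wpM2l ?pS_ratio//.
    by rewrite mulr_ge0//; [exact: bpos_ge0 bb|exact: bpos_ge0 bgS].
  set B := wavg PP h be; set A := wavg PP h al.
  have E0 (w : XX -> R) u : bpos w -> mean PP (fun y => w y * u y) = wavg PP w u * mean PP w.
    by move=> bw; rewrite wavgK//; apply: eq_mean => y; rewrite mulrC.
  have cancel (x y z : R) : 0 < z -> (x * z) / (y * z) = x / y.
    by move=> z0; rewrite invfM mulrACA divff ?gt_eqF// mulr1.
  rewrite !E0// (cancel _ _ _ (mean_gt0 PP bh)) (cancel _ _ _ (mean_gt0 PP bh')).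
  rewrite -/A -/B.
  have B0 : 0 < B by rewrite divr_gt0 ?mean_gt0//; exact: bposM.
  have beB y : be y <= C * B.
    rewrite -[C * B](_ : wavg PP h (fun y' => C * be y') = _).
      by apply: wavg_ge => //; apply: bmM; [exact: bm_cst|exact: bpos_bm].
    rewrite /B /wavg mulrA; congr (_ / _).
    rewrite -meanZl; last by apply: bmM; exact: bpos_bm.
    by apply: eq_mean => y'; rewrite mulrA.
  have CB0 : 0 <= C * B by rewrite (le_trans _ (beB point))//; exact: bpos_ge0 bbe.
  apply: quotient_change => //.
  - by rewrite divr_gt0 ?mean_gt0//; exact: bposM.
  - have -> : ga * (err K * C) * B = err K * (ga * (C * B)) by ring.
    apply: h_err => //; [exact: loc_dual|by rewrite mulr_ge0|].
    by move=> y; rewrite (le_trans (alb y))// ler_wpM2l.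
  - rewrite -mulrA; apply: h_err => //.
    + exact: bpos_bm.
    + exact: loc_dual.
    + by move=> y; rewrite ger0_norm//; exact: bpos_ge0 bbe.
  - rewrite normrM normfV (gtr0_norm (mean_gt0 PP bh')).
    rewrite ler_pdivrMr ?mean_gt0// /wavg mulrA divfK ?gt_eqF ?mean_gt0//.
    have bh1 := bpos_bm bh'; have bb1 := bpos_bm bbe.
    apply: le_trans (mean_norm _ _) _; first exact: bmM.
    rewrite -meanZl; last exact: bmM.
    apply: le_mean; [by apply: bm_abs; exact: bmM|by apply: bmM; [exact: bm_cst|exact: bmM]|].
    move=> y; rewrite normrM (ger0_norm (bpos_ge0 y bh')) mulrA.
    by rewrite ler_wpM2r//; exact: bpos_ge0 bh'.
have bgS := gS_bpos gl_bpos (k + m.+1) K.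
have bn k' h0 m' K' : bpos h0 -> bm (node k' h0 m' K') by move=> /(node_bpos k' m' K')/bpos_bm.
have bpn h0 (l : seq {set V}) : bpos h0 -> bpos (fun y => \prod_(K' <- l) node k h0 m K' y).
  by move=> b0; apply: bpos_prod => K' _; exact: node_bpos.
have bmb := bpos_bm bb.
have bpQ h0 : bpos h0 -> bm (fun y => \prod_(K' in Qn K) node k h0 m K' y).
  by move=> b0; apply: bm_prod => K' _; exact: bn.
rewrite !mean_gqS//; do ?exact: bpQ.
set al := dual K _; set be := dual K _.
have bal : bm al by apply: bm_dual; apply: bmM => //; exact: bpos_bm.
have bbe : bpos be by apply: bpos_dual; exact: bposM.
have pprops K' ee : K' \in P -> pinned k m K' ee -> bm ee.
  by move=> K'P pe; have [[]] := pinned_props K'P pe.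
have H2 (ee : {set V} -> XX -> R) : (forall K', K' \in enum (Qn K) -> pinned k m K' (ee K')) ->
    `|mean PP (fun y => (\prod_(K' <- enum (Qn K)) ee K' y) * al y)| <=
    ga * mean PP (fun y => (\prod_(K' <- enum (Qn K)) ee K' y) * be y).
  move=> pe; have pe' K' : K' \in Qn K -> pinned k m K' (ee K').
    by move=> KQ; apply: pe; rewrite mem_enum.
  have bee : bm (fun y => \prod_(K' in Qn K) ee K' y).
    by apply: bm_prod => K' KQ; apply: pprops (pe' _ KQ); exact: Qn_P KP KQ.
  have := H _ (PinnedS pe'); rewrite !mean_gqS//.
  by congr (`|_| <= _ * _); apply: eq_mean => y; rewrite big_enum.
have enumE h0 u : mean PP (fun y => (\prod_(K' in Qn K) node k h0 m K' y) * u y) =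
    mean PP (fun y => (\prod_(K' <- enum (Qn K)) node k h0 m K' y) * u y).
  by apply: eq_mean => y; rewrite big_enum.
rewrite !enumE -big_enum/=.
have lP K' : K' \in enum (Qn K) -> K' \in P by rewrite mem_enum; exact: Qn_P.
(* The children are exchanged one after the other; those not concerned are absorbed into the test
   functions [al] and [be]. *)
elim: (enum (Qn K)) (enum_uniq (mem (Qn K))) lP al be bal bbe H2
    => [|K1 l IHl] /= ul lP al be bal bbe H2.
  have Z h0 u : mean PP (fun y => (\prod_(K' <- [::]) node k h0 m K' y) * u y) =
      mean PP u by apply: eq_mean => y; rewrite big_nil mul1r.
  by rewrite !Z subrr normr0 big_nil mul0r mulr0.
have K1P : K1 \in P by apply: lP; rewrite inE eqxx.
have lP' K' : K' \in l -> K' \in P by move=> K'l; apply: lP; rewrite inE K'l orbT.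
have /andP[K1l ul'] := ul.
have bmbe := bpos_bm bbe.
have comb (ee : {set V} -> XX -> R) e1 u :
    (forall K', K' \in l -> pinned k m K' (ee K')) -> pinned k m K1 e1 ->
  exists2 ee' : {set V} -> XX -> R,
    (forall K', K' \in K1 :: l -> pinned k m K' (ee' K')) &
    forall y, (\prod_(K' <- K1 :: l) ee' K' y) * u y =
      (\prod_(K' <- l) ee K' y) * (u y * e1 y).
  move=> pe pe1; exists (fun K' => if K' == K1 then e1 else ee K').
    by move=> K'; rewrite inE; have [->//|_ /=] := eqVneq K' K1; exact: pe.
  move=> y; rewrite big_cons eqxx.
  under eq_big_seq => K' K'l.
    have -> : (K' == K1) = false by apply/negbTE; apply: contraNneq K1l => <-.
    over.
  by ring.
pose G (s : bool) y := ga * be y + (-1) ^+ s * al y.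
have bG s : bm (G s).
  by apply: bmD; apply: bmM => //; exact: bm_cst.
have nl h0 : bpos h0 -> bm (fun y => \prod_(K' <- l) node k h0 m K' y).
  by move=> b0; apply: bpos_bm; exact: bpn.
have HG ee s : (forall K', K' \in K1 :: l -> pinned k m K' (ee K')) ->
    0 <= mean PP (fun y => (\prod_(K' <- K1 :: l) ee K' y) * G s y).
  move=> pe; have be' : bm (fun y => \prod_(K' <- K1 :: l) ee K' y).
    rewrite (_ : (fun y => _) = (fun y => \prod_(K' <- K1 :: l | K' \in K1 :: l) ee K' y)).
      by apply: bm_prod => K' K'l; apply: pprops (pe _ K'l); exact: lP.
    by apply/funext => y; rewrite big_seq.
  by have /abs_mean_leP := H2 ee pe; apply.
(* First [K1] is exchanged, with the remaining siblings still started from [h]. *)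
have prem1 dd : pinned k m K1 dd ->
    `|mean PP (fun y => (\prod_(K' <- l) node k h m K' y) * al y * dd y)| <=
    ga * mean PP (fun y => (\prod_(K' <- l) node k h m K' y) * be y * dd y).
  move=> pdd; have bdd := pprops _ _ K1P pdd.
  rewrite !(eq_mean PP (fun y => mulrAC (\prod_(K' <- l) node k h m K' y) _ (dd y))).
  apply/abs_mean_leP => //; first by apply: bmM => //; exact: nl.
  move=> s; rewrite (@eq_mean _ _ _ _ _ (fun y => (\prod_(K' <- l) node k h m K' y) * (G s y * dd y))); last first.
    by move=> y; rewrite /G; ring.
  apply: (@mixed_prod k m) => //.
  - by move=> K' K'l; split; [apply: node_mixed => //; exact: lP'|exact: bn].
  - exact: bmM.
  move=> ee pe; have [ee' pe' eeE] := comb ee dd (G s) pe pdd.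
  by rewrite -(eq_mean PP eeE); exact: HG.
(* Then the remaining siblings, with [K1] already started from [h']. *)
have prem2 ee : (forall K', K' \in l -> pinned k m K' (ee K')) ->
    `|mean PP (fun y => (\prod_(K' <- l) ee K' y) * (node k h' m K1 y * al y))| <=
    ga * mean PP (fun y => (\prod_(K' <- l) ee K' y) * (node k h' m K1 y * be y)).
  move=> pe; have bee : bm (fun y => \prod_(K' <- l) ee K' y).
    rewrite (_ : (fun y => _) = (fun y => \prod_(K' <- l | K' \in l) ee K' y)).
      by apply: bm_prod => K' K'l; apply: pprops (pe _ K'l); exact: lP'.
    by apply/funext => y; rewrite big_seq.
  rewrite !(eq_mean PP (fun y => mulrA (\prod_(K' <- l) ee K' y) (node k h' m K1 y) _)).
  apply/abs_mean_leP => //; first by apply: bmM => //; exact: bn.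
  move=> s; rewrite (@eq_mean _ _ _ _ _ (fun y => ((\prod_(K' <- l) ee K' y) * G s y) * node k h' m K1 y)); last first.
    by move=> y; rewrite /G; ring.
  apply: node_mixed => //; first exact: bmM.
  move=> dd pdd; have [ee' pe' eeE] := comb ee dd (G s) pe pdd.
  have := HG _ s pe'; rewrite (eq_mean PP eeE).
  by congr (0 <= _); apply: eq_mean => y; rewrite mulrA.
have h1 := IH K1 (fun y => (\prod_(K' <- l) node k h m K' y) * al y)
  (fun y => (\prod_(K' <- l) node k h m K' y) * be y) K1P
  (bmM (nl _ bh) bal) (bposM (bpn _ l bh) bbe) ga0 prem1.
have h2 := IHl ul' lP' (fun y => node k h' m K1 y * al y)
  (fun y => node k h' m K1 y * be y) (bmM (bn k h' m K1 bh') bal)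
  (bposM (node_bpos k m K1 bh') bbe) prem2.
have E1 h0 u : mean PP (fun y => (\prod_(K' <- K1 :: l) node k h0 m K' y) * u y) =
    mean PP (fun y => (\prod_(K' <- l) node k h0 m K' y) * u y * node k h0 m K1 y).
  by apply: eq_mean => y; rewrite big_cons; ring.
have E2 h0 h1' u : mean PP (fun y => (\prod_(K' <- l) node k h0 m K' y) * u y * node k h1' m K1 y) =
    mean PP (fun y => (\prod_(K' <- l) node k h0 m K' y) * (node k h1' m K1 y * u y)).
  by apply: eq_mean => y; ring.
rewrite !E1.
have -> : 2 * ga * ((\sum_(K' <- K1 :: l) tree_err m K') * C) =
    2 * ga * (tree_err m K1 * C) + 2 * ga * ((\sum_(K' <- l) tree_err m K') * C).
  by rewrite big_cons; ring.
apply: le_trans (ler_distD _ _ _) _.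
apply: lerD h1 _; rewrite !E2; exact: h2.
Qed.

Fixpoint block_iter k h0 (m : nat) : XX -> R :=
  if m is m'.+1 then block_step psi p P gl (k + m) (block_iter k h0 m')
  else block_step psi p P gl k h0.

(** The blocks outside [Q] share no coordinate with [a] and factor out. *)
Lemma prodP_indep (Q : {set {set V}}) (F : {set V} -> XX -> R) a : Q \subset P ->
  (forall K, K \in P -> bpos (F K) /\ loc K (F K)) -> bm a ->
  loc (finset.cover Q) a ->
  mean PP (fun y => a y * \prod_(K in P) F K y) =
  mean PP (fun y => a y * \prod_(K in Q) F K y) *
  mean PP (fun y => \prod_(K in P :\: Q) F K y).
Proof.
move=> QP HF ba la.
have split_prod y : \prod_(K in P) F K y =
    (\prod_(K in Q) F K y) * \prod_(K in P :\: Q) F K y.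
  by rewrite (big_setID Q)/= (finset.setIidPr QP).
rewrite -(mean_indep psi (S := finset.cover Q)); first last.
- by apply: bm_prod => K; rewrite inE => /andP[_ /HF[/bpos_bm]].
- apply: bmM => //; apply: bm_prod => K /(fintype.subsetP QP)/HF[/bpos_bm]//.
- apply: loc_prod => K; rewrite inE => /andP[KQ KP].
  apply: locS (HF K KP).2; apply/fintype.subsetP => v vK; rewrite inE.
  apply/negP => /finset.bigcupP[K' K'Q vK'].
  have K'P := fintype.subsetP QP _ K'Q.
  by move/negP: KQ; apply; rewrite -(pblock_eq partP KP vK) (pblock_eq partP K'P vK').
- apply: locM => //; apply: loc_prod => K KQ.
  apply: locS (HF K (fintype.subsetP QP _ KQ)).2.
  by apply/fintype.subsetP => v vK; apply/finset.bigcupP; exists K.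
by apply: eq_mean => y; rewrite split_prod mulrA.
Qed.

Lemma qS_prodP (F : {set V} -> XX -> R) K :
  (forall K, K \in P -> bpos (F K) /\ loc K (F K)) -> K \in P ->
  exists2 c, 0 < c & forall z, qS K (fun y => \prod_(K' in P) F K' y) z =
    c * qS K (fun y => \prod_(K' in Qn K) F K' y) z.
Proof.
move=> HF KP; exists (mean PP (fun y => \prod_(K' in P :\: Qn K) F K' y)).
  by apply: mean_gt0; apply: bpos_prod => K'; rewrite inE => /andP[_ /HF[]].
move=> z; rewrite !qSE [RHS]mulrC.
transitivity (mean PP (fun y => pS K y z * \prod_(K' in P) F K' y)).
  by apply: eq_mean => y; rewrite mulrC.
rewrite (@prodP_indep (Qn K))//; last 3 first.
- exact: Qn_sub.
- exact: bpos_bm (pS_bpos1 LM K z).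
- exact: loc_pS.
by congr (_ * _); apply: eq_mean => y; rewrite mulrC.
Qed.

(** In the next density on a block [K], the blocks beyond [Qn K] integrate to a constant, which
    normalisation will remove. *)
Lemma block_iter_node k h0 m : bpos h0 -> exists2 c, 0 < c &
  forall y, block_iter k h0 m y = c * \prod_(K in P) node k h0 m K y.
Proof.
move=> b0; elim: m => [|m [c c0 IH]].
  by exists 1 => // y; rewrite mul1r.
have HF K : K \in P -> bpos (node k h0 m K) /\ loc K (node k h0 m K).
  by move=> _; split; [exact: node_bpos|exact: loc_node].
have /choice[cc Hcc] : forall K, exists c, K \in P -> 0 < c /\
    forall z, qS K (fun y => \prod_(K' in P) node k h0 m K' y) z =
    c * qS K (fun y => \prod_(K' in Qn K) node k h0 m K' y) z.
  move=> K; have [KP|_] := boolP (K \in P); last by exists 0.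
  by have [cK cK0 E] := qS_prodP HF KP; exists cK.
exists (\prod_(K in P) (c * cc K)).
  by apply: prodr_gt0 => K /Hcc[h1 _]; exact: mulr_gt0.
move=> y; rewrite /= /block_step -big_split/=; apply: eq_bigr => K KP.
rewrite mulrCA; congr (_ * _).
have -> : block_iter k h0 m = (fun y => c * \prod_(K in P) node k h0 m K y).
  by apply/funext.
have [_ E] := Hcc K KP; rewrite -mulrA -E !qSE -meanZl.
  by apply: eq_mean => x; rewrite mulrA.
apply: bmM; last exact: bpos_bm (pS_bpos1 LM K y).
by apply: bm_prod => K' /HF[/bpos_bm].
Qed.

Lemma wavg_block_iter k h0 m K f : bpos h0 -> K \in P -> bm f -> loc K f ->
  wavg PP (block_iter k h0 m) f = wavg PP (node k h0 m K) f.
Proof.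
move=> b0 KP bf lf; have [c c0 E] := block_iter_node k m b0.
have HF K' : K' \in P -> bpos (node k h0 m K') /\ loc K' (node k h0 m K').
  by move=> _; split; [exact: node_bpos|exact: loc_node].
have K1P : [set K]%SET \subset P by rewrite finset.sub1set.
have lc a : loc K a -> loc (finset.cover [set K]%SET) a.
  by apply: locS; rewrite /finset.cover finset.big_set1.
have bN : bpos (fun y => \prod_(K in P) node k h0 m K y).
  by apply: bpos_prod => K' /HF[].
have R1 a : bm a -> loc K a ->
    mean PP (fun y => a y * block_iter k h0 m y) =
    mean PP (fun y => a y * node k h0 m K y) *
    (c * mean PP (fun y => \prod_(K' in P :\: [set K]%SET) node k h0 m K' y)).
  move=> ba la; rewrite (@eq_mean _ _ _ _ _ (fun y => c * (a y * \prod_(K in P) node k h0 m K y))).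
    rewrite meanZl; last by apply: bmM => //; exact: bpos_bm.
    rewrite (prodP_indep K1P HF ba (lc _ la)) mulrCA; congr (_ * _).
    by apply: eq_mean => y; rewrite finset.big_set1.
  by move=> y; rewrite E mulrCA.
have R2 := R1 (fun=> 1) (bm_cst _ 1) (@loc_cst _ _ _ _ _ 1).
rewrite /wavg R1//.
rewrite (@eq_mean _ _ _ _ (block_iter k h0 m) (fun y => 1 * block_iter k h0 m y)); last first.
  by move=> y; rewrite mul1r.
rewrite R2 (@eq_mean _ _ _ _ (fun y => 1 * node k h0 m K y) (node k h0 m K)); last first.
  by move=> y; rewrite mul1r.
rewrite invfM mulrACA divff ?mulr1// gt_eqF// mulr_gt0// mean_gt0//.
by apply: bpos_prod => K'; rewrite inE => /andP[_ /HF[]].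
Qed.

Lemma block_stability k m K J f : K \in P -> J \subset K -> bm f ->
  (forall x, `|f x| <= 1) -> loc J f ->
  `|wavg PP (block_iter k h m) f - wavg PP (block_iter k h' m) f| <=
  2 * (rho ^+ m * #|J|%:R) * (tree_err m K * C).
Proof.
move=> KP JK bf f1 lf.
have lfK : loc K f by apply: locS JK lf.
rewrite !(@wavg_block_iter _ _ _ K)//.
have bn h0 : bpos h0 -> bpos (node k h0 m K) by exact: node_bpos.
(* Centred at this value, [f] has an average of at most [rho ^+ m * #|J|] under every pinned law:
   this is the hypothesis of [tree_compare] with [b] equal to 1. *)
set c := wavg PP (pin k m K) f.
have bpin : bpos (pin k m K) by have [] := pinned_props KP (pinned_pin k m K).
have bfc : bm (fun z => f z - c) by apply: bmB => //; exact: bm_cst.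
have -> : wavg PP (node k h m K) f - wavg PP (node k h' m K) f =
    wavg PP (node k h m K) (fun z => f z - c) -
    wavg PP (node k h' m K) (fun z => f z - c).
  have b1 := bn h bh; have b2 := bn h' bh'.
  by rewrite !wavgB ?wavg_cst//; do ?[exact: bm_cst]; ring.
rewrite /wavg -(eq_mean PP (fun z => mul1r (node k h m K z))).
rewrite -(eq_mean PP (fun z => mul1r (node k h' m K z))).
apply: (tree_compare (b := fun=> 1)) => //.
- exact: bpos_cst.
- by rewrite mulr_ge0// exprn_ge0// rho_ge0.
move=> dd pdd; have [bd _ _] := pinned_props KP pdd.
rewrite (eq_mean PP (fun z => mul1r (dd z))) -wavgK// normrM.
rewrite (gtr0_norm (mean_gt0 PP bd)); apply: ler_wpM2r.
  by rewrite ltW// mean_gt0.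
rewrite wavgB//; last exact: bm_cst.
by rewrite wavg_cst//; exact: (pinned_close KP pdd (pinned_pin k m K) bf f1 lf).
Qed.

End computation_tree.

(** * Measures given by densities *)

Section layer_cake.
Context (R : realType).

(** The sum is the integer part of [y]. *)
Lemma sum_threshold (n : nat) (y : R) : 0 <= y <= n%:R ->
  y - 1 <= \sum_(j < n) (j.+1%:R <= y)%R%:R <= y.
Proof.
elim: n => [|n IH] /andP[y0 yn].
  by rewrite big_ord0; apply/andP; split; lra.
rewrite big_ord_recr/=; have [yn'|yn'] := leP y n%:R.
  have /IH : 0 <= y <= n%:R by rewrite y0.
  have -> : (n.+1%:R <= y) = false.
    by apply/negbTE; rewrite -ltNge (le_lt_trans yn')// ltr_nat.
  by rewrite addr0.
have -> : \sum_(j < n) ((j.+1%:R : R) <= y)%R%:R = n%:R :> R.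
  rewrite (eq_bigr (fun=> 1)) => [|j _]; last first.
    have -> : (j.+1%:R : R) <= y by apply: le_trans (ltW yn'); rewrite ler_nat.
    by [].
  by rewrite sumr_const card_ord.
have E : (n.+1%:R : R) = n%:R + 1 by rewrite -natr1.
have [h|h] := boolP ((n.+1%:R : R) <= y); rewrite /= ?addr0.
  by move: yn h; rewrite E => yn h; apply/andP; split; lra.
by move: yn h; rewrite E -ltNge => yn h; apply/andP; split; lra.
Qed.

End layer_cake.

Section bounded_functionals.
Context (R : realType) d (T : measurableType d).
Implicit Types (f g : T -> R) (Phi : (T -> R) -> R).

Record bounded_functional Phi : Prop := BoundedFunctional {
  bfD : forall f g, bm f -> bm g -> Phi (fun x => f x + g x) = Phi f + Phi g;
  bfZ : forall c f, bm f -> Phi (fun x => c * f x) = c * Phi f;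
  bf_bound : exists2 M, 0 <= M &
    forall f c, bm f -> (forall x, `|f x| <= c) -> `|Phi f| <= M * c }.

Lemma bf_sum Phi (n : nat) (F : 'I_n -> T -> R) : bounded_functional Phi ->
  (forall i, bm (F i)) -> Phi (fun x => \sum_i F i x) = \sum_i Phi (F i).
Proof.
move=> bP bF; elim: n F bF => [|n IH] F bF.
  rewrite big_ord0 -[RHS](mul0r (Phi (fun=> 0))) -bfZ//; last exact: bm_cst.
  by congr Phi; apply/funext => x; rewrite big_ord0 mul0r.
rewrite big_ord_recr/= -IH// -bfD//; last by apply: bm_sum => i _.
by congr Phi; apply/funext => x; rewrite big_ord_recr.
Qed.

(** Staircase functions approximate uniformly a function with values in [0, 1], and boundedness
    passes to the limit; an affine change of the function reduces the general case to this one. *)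
Lemma bfunctional_ext Phi Psi : bounded_functional Phi -> bounded_functional Psi ->
  (forall A, measurable A -> Phi \1_A = Psi \1_A) ->
  forall f, bm f -> Phi f = Psi f.
Proof.
move=> bP bS PS.
suff main f : bm f -> (forall x, 0 <= f x <= 1) -> Phi f = Psi f.
  move=> f bf; have [C C0 fC] := bm_bound bf.
  pose c := (2 * C + 1)^-1; have c0 : 0 < c by rewrite invr_gt0; lra.
  pose g x := c * (f x + C).
  have bg : bm g by apply: bmM; [exact: bm_cst|apply: bmD => //; exact: bm_cst].
  have g01 x : 0 <= g x <= 1.
    have := fC x; rewrite ler_norml => /andP[h1 h2].
    have h3 : 0 <= f x + C by lra.
    rewrite /g (mulr_ge0 (ltW c0) h3)/= /c mulrC ler_pdivrMr; lra.
  have one : Phi (fun=> 1) = Psi (fun=> 1).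
    by have := PS setT measurableT; congr (Phi _ = Psi _);
      apply/funext => x; rewrite indicE mem_set.
  have E Q : bounded_functional Q -> Q f = c^-1 * Q g - C * Q (fun=> 1).
    move=> bQ; rewrite -bfZ//.
    have -> : (fun x => c^-1 * g x) = (fun x => f x + C * 1).
      by apply/funext => x; rewrite /g mulrA mulVf ?mul1r ?mulr1// gt_eqF.
    rewrite bfD//; last by apply: bmM; exact: bm_cst.
    by rewrite bfZ ?addrK//; exact: bm_cst.
  by rewrite (E _ bP) (E _ bS) (main g) ?one.
move=> bf f01.
have [M M0 HM] := bf_bound bP; have [M' M'0 HM'] := bf_bound bS.
apply/eqP; rewrite -subr_eq0 -normr_le0.
apply/ler_addgt0Pr => ep ep0; rewrite add0r.
have [n n0 Mn] : exists2 n : nat, (0 < n)%N & (M + M') / n%:R <= ep.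
  exists (Num.truncn ((M + M') / ep)).+1 => //.
  rewrite ler_pdivrMr// mulrC -ler_pdivrMr//.
  by rewrite ltW// truncnS_gt.
have n0' : 0 < (n%:R : R) by rewrite ltr0n.
pose A (j : 'I_n) := [set x | (j.+1%:R : R) <= n%:R * f x].
have mA j : measurable (A j).
  have bnf : bm (fun x => n%:R * f x) by apply: bmM => //; exact: bm_cst.
  have := measurable_fun_ler (measurable_cst (j.+1%:R : R)) (bm_meas bnf).
  by move=> /(_ measurableT [set true] I); rewrite setTI.
pose fn x := \sum_(j < n) n%:R^-1 * (\1_(A j) x : R).
have bA j : bm (fun x => n%:R^-1 * (\1_(A j) x : R)).
  by apply: bmM; [exact: bm_cst|exact: bm_indic].
have bfn : bm fn by apply: bm_sum => j _.
have ffn x : `|f x - fn x| <= n%:R^-1.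
  have /andP[f0 f1] := f01 x.
  have -> : fn x = n%:R^-1 * \sum_(j < n) (j.+1%:R <= n%:R * f x)%R%:R.
    by rewrite mulr_sumr; apply: eq_bigr => j _; rewrite indicE /A; congr (_ * _%:R); congr nat_of_bool;
      apply/idP/idP; rewrite inE.
  have /sum_threshold/andP[] : 0 <= n%:R * f x <= n%:R.
    by rewrite mulr_ge0//= -[leRHS]mulr1 ler_wpM2l.
  set s := \sum_(j < n) _ => h1 h2.
  have -> : f x - n%:R^-1 * s = n%:R^-1 * (n%:R * f x - s).
    by rewrite mulrBr mulrA mulVf ?mul1r// gt_eqF.
  rewrite normrM ger0_norm ?invr_ge0// -[leRHS]mulr1 ler_wpM2l ?invr_ge0//.
  by rewrite ler_norml; apply/andP; split; lra.
have Efn : Phi fn = Psi fn.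
  rewrite /fn !bf_sum//; apply: eq_bigr => j _.
  by rewrite !bfZ ?PS//; exact: bm_indic.
have dec Q : bounded_functional Q -> Q f = Q fn + Q (fun x => f x - fn x).
  move=> bQ; rewrite -bfD//; last exact: bmB.
  by congr Q; apply/funext => x; ring.
rewrite (dec _ bP) (dec _ bS) Efn opprD addrACA subrr add0r.
apply: le_trans (ler_normB _ _) _; apply: le_trans Mn; rewrite mulrDl.
by apply: lerD; [apply: HM|apply: HM'] => //; exact: bmB.
Qed.

Lemma bf_mean (P : probability T R) q : bm q ->
  bounded_functional (fun f => mean P (fun x => f x * q x)).
Proof.
move=> bq; split.
- move=> f g bf bg; rewrite -meanD; [|exact: bmM..].
  by apply: eq_mean => x; rewrite mulrDl.
- move=> c f bf; rewrite -meanZl; last exact: bmM.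
  by apply: eq_mean => x; rewrite mulrA.
- have [C C0 qC] := bm_bound bq; exists C => // f c bf fc.
  apply: mean_norm_le; first exact: bmM.
  by move=> x; rewrite normrM mulrC ler_pM.
Qed.

End bounded_functionals.

Section density_measure.
Context (R : realType) d (T : measurableType d) (P : probability T R).

Record pdensity := PDensity {
  pd_fun :> T -> R;
  pd_bm : bm pd_fun;
  pd_ge0 : forall x, 0 <= pd_fun x;
  pd_mean : mean P pd_fun = 1 }.

Variable q : pdensity.

Definition dens (A : set T) : \bar R := (\int[P]_(x in A) (q x)%:E)%E.

Let dens0 : dens set0 = 0%E.
Proof. by rewrite /dens integral_set0. Qed.

Let dens_ge0 A : (0 <= dens A)%E.
Proof. by apply: integral_ge0 => x _; rewrite lee_fin pd_ge0. Qed.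

Let dens_sigma_additive : semi_sigma_additive dens.
Proof.
apply: semi_sigma_additive_nng_induced.
- by apply/measurable_EFinP; case: (pd_bm q).
- by move=> x; rewrite lee_fin pd_ge0.
Qed.

HB.instance Definition _ := isMeasure.Build _ _ _ dens
  dens0 dens_ge0 dens_sigma_additive.

Let dens_setT : dens setT = 1%E.
Proof. by rewrite /dens -EFin_mean ?pd_mean//; exact: pd_bm. Qed.

HB.instance Definition _ := Measure_isProbability.Build _ _ _ dens dens_setT.

Lemma densE A : measurable A -> dens A = (mean P (fun x => \1_A x * q x))%:E.
Proof.
move=> mA; rewrite EFin_mean; last by apply: bmM; [exact: bm_indic|exact: pd_bm].
rewrite /dens integral_mkcond; apply: eq_integral => x _.
rewrite patchE indicE; case: ifP => _; rewrite ?mul1r ?mul0r//.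
Qed.

Lemma mean_dens f : bm f ->
  mean (dens : probability T R) f = mean P (fun x => f x * q x).
Proof.
pose Psi f := mean P (fun x => f x * q x).
pose Phi f := mean (dens : probability T R) (fun x => f x * 1).
move=> bf; transitivity (Phi f).
  by apply: eq_mean => x; rewrite mulr1.
apply: (@bfunctional_ext _ _ _ Phi Psi) => //.
- by apply: bf_mean; exact: bm_cst.
- by apply: bf_mean; exact: pd_bm.
move=> A mA; rewrite /Phi (eq_mean _ (fun x => mulr1 (\1_A x))).
by apply: EFin_inj; rewrite mean_indic// -densE.
Qed.

End density_measure.

Section raw_integral.
Local Open Scope ereal_scope.
Context (R : realType) d (T : measurableType d).
Import HBNNSimple.

(* [eq_measure_integral] for a set function [rho] that is not known to be a
   measure on all sets. *)
Lemma raw_integral (rho : set T -> \bar R) (m : {measure set T -> \bar R}) D f :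
  (forall A, measurable A -> rho A = m A) ->
  \int[rho]_(x in D) f x = \int[m]_(x in D) f x.
Proof.
move=> rm; rewrite /integral.
have E : sintegral rho \o (@NonNegSimpleFun.sort d T R) =
    sintegral m \o (@NonNegSimpleFun.sort d T R).
  apply/funext => h /=; apply: eq_fsbigr => r _.
  by rewrite rm.
congr (ereal_sup _ - ereal_sup _); apply/seteqP; split => _ [h hf <-] /=;
  exists h => //; have := congr1 (fun F => F h) E => //=.
Qed.

End raw_integral.

(** * Sampling errors *)

Section index_functions.
Context (R : realType) (B : finType) (n : nat).
Hypothesis n_gt0 : (0 < n)%N.
Local Notation idx := {ffun B -> 'I_n}.
Implicit Types (Q : {set B}) (c : idx) (b : B).

Definition mix Q c c' : idx := [ffun b => if b \in Q then c b else c' b].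

Lemma card_idx_gt0 : 0 < (#|{: idx}|%:R : R).
Proof. by rewrite ltr0n card_ffun card_ord expn_gt0 n_gt0. Qed.

(** Exchanging the coordinates in [Q] between [c] and [c'] is an involution on pairs: independence
    of coordinates in counting form. *)
Lemma sum_mix Q (W : idx -> idx -> R) :
  \sum_(c : idx) \sum_(c' : idx) W c c' = \sum_(c : idx) \sum_(c' : idx) W (mix Q c c') (mix Q c' c).
Proof.
rewrite !pair_bigA/=.
pose h (u : idx * idx) := (mix Q u.1 u.2, mix Q u.2 u.1).
have hK : involutive h.
  by move=> [c c']; rewrite /h/=; congr (_, _); apply/ffunP => b; rewrite !ffunE;
    case: (b \in Q).
by rewrite (reindex_inj (inv_inj hK)).
Qed.

(** Transposing two values permutes the index functions, so that all values of [c b] are equally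
    frequent. *)
Lemma sum_idx_eq b i : n%:R * \sum_(c : idx) (c b == i)%:R = #|{: idx}|%:R :> R.
Proof.
have E j : \sum_(c : idx) (c b == j)%:R = \sum_(c : idx) (c b == i)%:R :> R.
  pose h c : idx := [ffun b => tperm i j (c b)].
  have hK : involutive h by move=> c; apply/ffunP => b'; rewrite !ffunE tpermK.
  rewrite (reindex_inj (inv_inj hK)); apply: eq_bigr => c _.
  by rewrite ffunE (can2_eq (tpermK i j) (tpermK i j)) tpermR.
transitivity (\sum_(j < n) \sum_(c : idx) (c b == j)%:R : R).
  by rewrite (eq_bigr _ (fun j _ => E j)) sumr_const card_ord -[RHS]mulr_natl.
rewrite exchange_big/= (eq_bigr (fun=> 1)) => [|c _]; first by rewrite sumr_const.
rewrite (bigD1 (c b))//= eqxx big1 ?addr0// => j /negbTE jc.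
by rewrite eq_sym jc.
Qed.

Lemma sum_idx_coord b (F : 'I_n -> R) :
  n%:R * \sum_(c : idx) F (c b) = #|{: idx}|%:R * \sum_i F i.
Proof.
have -> : \sum_(c : idx) F (c b) = \sum_i \sum_(c : idx) F i * (c b == i)%:R.
  rewrite exchange_big/=; apply: eq_bigr => c _.
  rewrite (bigD1 (c b))//= eqxx mulr1 big1 ?addr0// => j /negbTE jc.
  by rewrite eq_sym jc mulr0.
rewrite !mulr_sumr; apply: eq_bigr => i _.
by rewrite -mulr_sumr mulrCA sum_idx_eq mulrC.
Qed.

Lemma sum_idx_pair b b' :
  n%:R * \sum_(c : idx) \sum_(c' : idx) (c b == c' b')%:R = #|{: idx}|%:R ^+ 2 :> R.
Proof.
rewrite exchange_big/= mulr_sumr (eq_bigr (fun=> #|{: idx}|%:R)) => [|c' _].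
  by rewrite sumr_const -[LHS]mulr_natl expr2.
exact: sum_idx_eq.
Qed.

(** Under the uniform law on index functions, [c b] is uniform and independent of the other
    coordinates. *)
Lemma sum_idx_resample b (W : 'I_n -> idx -> R) :
  (forall i c c', (forall b', b' != b -> c b' = c' b') -> W i c = W i c') ->
  n%:R * \sum_(c : idx) W (c b) c = \sum_i \sum_(c : idx) W i c.
Proof.
move=> HW; have c0 := card_idx_gt0.
apply: (mulfI (lt0r_neq0 c0)); rewrite [in RHS]exchange_big/= mulrCA.
have -> : #|{: idx}|%:R * \sum_(c : idx) W (c b) c = \sum_(c : idx) \sum_(c' : idx) W (c' b) c.
  rewrite [RHS]exchange_big/= (sum_mix [set b]%SET) mulr_sumr; apply: eq_bigr => c _.
  rewrite (eq_bigr (fun=> W (c b) c)) => [|c' _]; first by rewrite sumr_const mulr_natl.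
  rewrite ffunE inE eqxx; apply: HW => b' /negbTE bb'.
  by rewrite ffunE inE bb'.
rewrite !mulr_sumr; apply: eq_bigr => c _.
exact: (sum_idx_coord b (W^~ c)).
Qed.

Lemma sum_idx_collision b b' : b != b' ->
  n%:R * \sum_(c : idx) (c b == c b')%:R = #|{: idx}|%:R :> R.
Proof.
move=> bb'; rewrite (sum_idx_resample (b := b) (W := fun i c => (i == c b')%:R)).
  rewrite exchange_big/= (eq_bigr (fun=> 1)) => [|c _]; first by rewrite sumr_const.
  by rewrite (bigD1 (c b'))//= eqxx big1 ?addr0// => j /negbTE ->.
by move=> i c c' cc'; rewrite cc'// eq_sym.
Qed.

Lemma sum_idx_indep Q (F H : idx -> R) :
  (forall c c', (forall b, b \in Q -> c b = c' b) -> F c = F c') ->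
  (forall c c', (forall b, b \notin Q -> c b = c' b) -> H c = H c') ->
  (\sum_(c : idx) F c) * (\sum_(c : idx) H c) = #|{: idx}|%:R * \sum_(c : idx) F c * H c.
Proof.
move=> HF HH; rewrite mulr_suml.
transitivity (\sum_(c : idx) \sum_(c' : idx) F c * H c').
  by apply: eq_bigr => c _; rewrite mulr_sumr.
rewrite (sum_mix Q) mulr_sumr; apply: eq_bigr => c _.
rewrite (eq_bigr (fun=> F c * H c)) => [|c' _].
  by rewrite sumr_const mulr_natl.
congr (_ * _); first by apply: HF => b bQ; rewrite ffunE bQ.
by apply: HH => b bQ; rewrite ffunE (negbTE bQ).
Qed.

Definition good_pair Q c c' := [forall b in Q, forall b' in Q,
  [&& (b != b') ==> (c b != c b'), (b != b') ==> (c' b != c' b') & c b != c' b']].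

Lemma good_pairP Q c c' : good_pair Q c c' ->
  [/\ {in Q &, injective c}, {in Q &, injective c'} &
      forall b b', b \in Q -> b' \in Q -> c b != c' b'].
Proof.
move=> g; have h b b' : b \in Q -> b' \in Q ->
  [&& (b != b') ==> (c b != c b'), (b != b') ==> (c' b != c' b') & c b != c' b'].
  by move=> bQ b'Q; have /'forall_implyP/(_ b bQ)/'forall_implyP/(_ b' b'Q) := g.
split=> b b' bQ b'Q; have /and3P[h1 h2 h3] := h _ _ bQ b'Q => //.
  by move/eqP => E; apply/eqP; apply: contraTT h1 => bb'; rewrite bb' E.
by move/eqP => E; apply/eqP; apply: contraTT h2 => bb'; rewrite bb' E.
Qed.

(** Union bound over pairs of elements of [Q] and three kinds of coincidence, each of frequency at
    most [1 / n]. *)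
Lemma sum_bad_pair Q :
  \sum_(c : idx) \sum_(c' : idx) (~~ good_pair Q c c')%:R <=
  #|{: idx}|%:R ^+ 2 * (3 * #|Q|%:R ^+ 2 / n%:R) :> R.
Proof.
have n0 : 0 < (n%:R : R) by rewrite ltr0n.
pose t (b b' : B) (c c' : idx) : R := ((b != b') && (c b == c b'))%:R +
  ((b != b') && (c' b == c' b'))%:R + (c b == c' b')%:R.
have t0 b b' c c' : 0 <= t b b' c c' by rewrite /t !addr_ge0.
apply: (@le_trans _ _ (\sum_(c : idx) \sum_(c' : idx) \sum_(b in Q) \sum_(b' in Q) t b b' c c')).
  apply: ler_sum => c _; apply: ler_sum => c' _.
  have s0 : 0 <= \sum_(b in Q) \sum_(b' in Q) t b b' c c' by do 2!apply: sumr_ge0 => ? _.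
  have [//|] := boolP (good_pair Q c c').
  rewrite negb_forall_in => /exists_inP[b bQ].
  rewrite negb_forall_in => /exists_inP[b' b'Q] h.
  apply: (@le_trans _ _ (t b b' c c')).
    move: h; rewrite /t.
    case: (b != b'); case: (c b == c b'); case: (c' b == c' b');
      case: (c b == c' b') => //= _; lra.
  rewrite (bigD1 b)//= (bigD1 b')//= -addrA lerDl addr_ge0//.
    by apply: sumr_ge0.
  by do 2!apply: sumr_ge0 => ? _.
have E b b' : \sum_(c : idx) \sum_(c' : idx) t b b' c c' <= 3 * (#|{: idx}|%:R ^+ 2 / n%:R).
  have h3 := sum_idx_pair b b'.
  have h b1 b2 : \sum_(c : idx) ((b1 != b2) && (c b1 == c b2))%:R <= #|{: idx}|%:R / n%:R :> R.
    rewrite ler_pdivlMr// mulrC; have [->|bb'] := eqVneq b1 b2.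
      by rewrite big1// mulr0.
    by rewrite sum_idx_collision.
  have -> : \sum_(c : idx) \sum_(c' : idx) t b b' c c' =
      #|{: idx}|%:R * \sum_(c : idx) ((b != b') && (c b == c b'))%:R +
      #|{: idx}|%:R * \sum_(c : idx) ((b != b') && (c b == c b'))%:R +
      \sum_(c : idx) \sum_(c' : idx) (c b == c' b')%:R.
    rewrite /t; under eq_bigr do rewrite !big_split/=.
    rewrite !big_split/=; congr (_ + _ + _); last by rewrite sumr_const mulr_natl.
    by rewrite mulr_sumr; apply: eq_bigr => c _; rewrite sumr_const mulr_natl.
  have -> : \sum_(c : idx) \sum_(c' : idx) (c b == c' b')%:R = #|{: idx}|%:R ^+ 2 / n%:R :> R.
    by apply/(canRL (mulfK (lt0r_neq0 n0))); rewrite mulrC.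
  have h1 : #|{: idx}|%:R * \sum_(c : idx) ((b != b') && (c b == c b'))%:R <=
      #|{: idx}|%:R ^+ 2 / n%:R :> R.
    by rewrite expr2 -mulrA ler_wpM2l.
  lra.
have -> : \sum_(c : idx) \sum_(c' : idx) \sum_(b in Q) \sum_(b' in Q) t b b' c c' =
    \sum_(b in Q) \sum_(b' in Q) \sum_(c : idx) \sum_(c' : idx) t b b' c c'.
  under eq_bigr do rewrite exchange_big/=.
  rewrite exchange_big/=; apply: eq_bigr => b _.
  under eq_bigr do rewrite exchange_big/=.
  by rewrite exchange_big.
apply: (@le_trans _ _ (\sum_(b in Q) \sum_(b' in Q) 3 * (#|{: idx}|%:R ^+ 2 / n%:R))).
  by apply: ler_sum => b _; apply: ler_sum => b' _.
rewrite !sumr_const -!mulrnA -[leLHS]mulr_natl natrM.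
by rewrite le_eqVlt; apply/orP; left; apply/eqP; rewrite expr2; ring.
Qed.

End index_functions.

Section product_independence.
Context (R : realType) (V : finType) (d : V -> measure_display)
  (T : forall v, measurableType (d v)) (psi : forall v, probability (T v) R).
Local Notation XX := (product_space T).
Local Notation PP := (prodP psi : probability XX R).

Lemma mean_coord v (f : T v -> R) : bm f ->
  mean PP (fun x => f (x v)) = mean (psi v) f.
Proof.
move=> bf; have bfv : bm (fun x : XX => f (x v)) by exact: bm_comp bf (@measurable_coord _ _ T v).
rewrite -(mean_Ev psi v bfv) -[RHS](mean_cst PP); apply: eq_mean => x.
by apply: eq_mean => z; rewrite dfwithin.
Qed.

Lemma mean_prod_indep (I : finType) (Q : {set I}) (S : I -> {set V})
    (F : I -> XX -> R) :
  (forall i, i \in Q -> bm (F i) /\ loc (S i) (F i)) ->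
  (forall i j, i \in Q -> j \in Q -> i != j -> [disjoint (S i) & (S j)]%B) ->
  mean PP (fun x => \prod_(i in Q) F i x) = \prod_(i in Q) mean PP (F i).
Proof.
have [n] := ubnP #|Q|; elim: n Q => // n IH Q Qn HF dis.
have [->|[i iQ]] := finset.set_0Vmem Q.
  by rewrite big_set0 -[RHS](mean_cst PP); apply: eq_mean => x; rewrite big_set0.
have iD j : j \in (Q :\ i)%SET -> j != i /\ j \in Q by rewrite !inE => /andP.
rewrite (big_setD1 i iQ)/= -IH; first last.
- by move=> j k /iD[_ jQ] /iD[_ kQ]; exact: dis.
- by move=> j /iD[_ jQ]; exact: HF.
- by move: Qn; rewrite (cardsD1 i) iQ add1n ltnS.
have [bFi lFi] := HF i iQ.
rewrite -(mean_indep psi lFi)//.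
- by apply: eq_mean => x; rewrite (big_setD1 i iQ).
- apply: loc_prod => j /iD[ji jQ]; have [_ lFj] := HF j jQ.
  apply: locS lFj; apply/fintype.subsetP => v vj; rewrite inE.
  by apply/negP => vi; have := dis _ _ jQ iQ ji; rewrite disjoint_subset =>
    /fintype.subsetP/(_ v vj); rewrite inE vi.
- by apply: bm_prod => j /iD[_ /HF[]].
Qed.

Lemma mean_box (Q : probability XX R) (A : forall v, set (T v)) :
  (forall v, measurable (A v)) ->
  Q (box A) = (mean Q (fun x => \prod_v \1_(A v) (x v)))%:E.
Proof.
move=> mA; rewrite -mean_indic; last exact: measurable_box.
congr _%:E; apply: eq_mean => x; rewrite indicE.
have [/set_mem xA|xA] := boolP (x \in box A).
  by rewrite big1// => v _; rewrite indicE mem_set.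
suff [v vA] : exists v, x v \notin A v.
  by rewrite (bigD1 v)//= indicE (negbTE vA) mul0r.
apply: contra_notP (negP xA) => nv; apply/mem_set => v.
by apply/set_mem; apply: contra_notT nv => ?; exists v.
Qed.

Lemma bm_box_fun (A : forall v, set (T v)) (S : {set V}) :
  (forall v, measurable (A v)) -> bm (fun x : XX => \prod_(v in S) (\1_(A v) (x v) : R)).
Proof.
move=> mA; apply: bm_prod => v _.
exact: bm_comp (bm_indic R (mA v)) (@measurable_coord _ _ T v).
Qed.

End product_independence.

(** * Recombined particles and their variance *)

Section particle_law.
Context (R : realType) (V : finType) (d : V -> measure_display)
  (T : forall v, measurableType (d v)) (psi : forall v, probability (T v) R).
Local Notation XX := (product_space T).
Local Notation PP := (prodP psi : probability XX R).
Implicit Types (f : XX -> R) (K S : {set V}) (x : XX).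

Variables (N : V -> {set V}) (Dl : nat) (e lam sig : R).
Variable p : forall v, XX -> T v -> R.
Arguments p : clear implicits.
Hypothesis LM : local_model N Dl e lam sig p.
Local Notation pS := (pS p).
Variable P : {set {set V}}.
Hypothesis partP : finset.partition P [set: V]%SET.
Hypothesis p_int : forall v x, mean (psi v) (p v x) = 1.

Lemma pS_bounds S x (z : XX) : e ^+ #|S| <= pS S x z <= (e^-1) ^+ #|S|.
Proof.
have e0 := e_gt0 LM; have pb v := p_bnd LM (v := v) x (z v).
rewrite -!prodr_const; apply/andP; split; apply: ler_prod => v _.
  by have /andP[-> _] := pb v; rewrite ltW.
by have /andP[h1 ->] := pb v; rewrite (le_trans (ltW e0) h1).
Qed.

Lemma loc_pS_target S x : loc S (pS S x).
Proof. by move=> z z' zz'; apply: eq_bigr => v vK; rewrite zz'. Qed.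

Lemma pS_bpos_target S x : bpos (pS S x).
Proof. exact: (bpos_slice1 (F := fun x z => pS S x z) x (pS_bpos2 LM S)). Qed.

Lemma mean_pS S x : mean PP (pS S x) = 1.
Proof.
have bp v : bm (p v x).
  by have := bm_slice1 (F := fun x (z : T v) => p v x z) x (bpos_bm (p_bpos LM v)).
rewrite (mean_prod_indep psi (S := fun v => [set v]%SET)).
- by rewrite big1// => v _; rewrite mean_coord.
- move=> v _; split; first exact: bm_comp (bp v) (@measurable_coord _ _ T v).
  by move=> z z' zz'; rewrite zz' ?inE.
- by move=> v w _ _ vw; rewrite disjoints1 inE.
Qed.

Lemma mean_pS_marginal K f x : bm f -> loc K f ->
  mean PP (fun z => f z * pS [set: V]%SET x z) = mean PP (fun z => f z * pS K x z).
Proof.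
move=> bf lf; rewrite -[RHS]mulr1 -(mean_pS (~: K)%SET x) -(mean_indep psi (S := K)).
- apply: eq_mean => z; rewrite -mulrA; congr (_ * _).
  transitivity (\prod_(v in [set: V]%SET) p v x (z v)) => //.
  rewrite (big_setID K)/= finset.setTI; congr (_ * _).
  by apply: eq_bigl => v; rewrite !inE andbT.
- by apply: locM => //; exact: loc_pS_target.
- exact: loc_pS_target.
- by apply: bmM => //; exact: bpos_bm (pS_bpos_target _ _).
- exact: bpos_bm (pS_bpos_target _ _).
Qed.

Variable mu : probability XX R.

Definition pred_dens S z : R := mean mu (fun x => pS S x z).

Lemma pred_dens_bounds S (z : XX) : e ^+ #|S| <= pred_dens S z <= (e^-1) ^+ #|S|.
Proof.
have b := bpos_bm (pS_bpos1 LM S z).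
by apply/andP; split; [apply: mean_ge|apply: mean_le] => // x;
  have /andP[] := pS_bounds S x z.
Qed.

Lemma pred_dens_bpos S : bpos (pred_dens S).
Proof.
split; first exact: (bm_mean1 mu (F := fun x z => pS S x z) (bpos_bm (pS_bpos2 LM S))).
exists (e ^+ #|S|) => [|z]; first by rewrite exprn_gt0// (e_gt0 LM).
by have /andP[] := pred_dens_bounds S z.
Qed.

Lemma loc_pred_dens S : loc S (pred_dens S).
Proof.
by move=> z z' zz'; apply: eq_mean => x; exact: loc_pS_target.
Qed.

(** The transition factors of the sites outside [K] integrate to 1. *)
Lemma mean_pred_dens K f : bm f -> loc K f ->
  mean PP (fun z => f z * pred_dens [set: V]%SET z) = mean PP (fun z => f z * pred_dens K z).
Proof.
move=> bf lf.
have E S : mean PP (fun z => f z * pred_dens S z) =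
    mean mu (fun x => mean PP (fun z => f z * pS S x z)).
  have b2 : bm (fun u : XX * XX => f u.2 * pS S u.1 u.2).
    by apply: bmM; [exact: bm_comp bf measurable_snd|exact: bpos_bm (pS_bpos2 LM S)].
  rewrite (mean_fubini mu PP (F := fun x z => f z * pS S x z))//.
  apply: eq_mean => z; rewrite -meanZl//; exact: bpos_bm (pS_bpos1 LM S z).
by rewrite !E; apply: eq_mean => x; exact: mean_pS_marginal.
Qed.

Lemma mean_pred_dens1 K : mean PP (pred_dens K) = 1.
Proof.
rewrite -(mean_fubini mu PP (F := fun x z => pS K x z)); last first.
  exact: bpos_bm (pS_bpos2 LM K).
by rewrite -[RHS](mean_cst mu); apply: eq_mean => x; exact: mean_pS.
Qed.

Definition pred_law : pdensity PP :=
  PDensity (bpos_bm (pred_dens_bpos [set: V]%SET))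
    (fun z => bpos_ge0 z (pred_dens_bpos _)) (mean_pred_dens1 _).

Definition block_dens z : R := \prod_(K in P) pred_dens K z.

Lemma mean_prod_blocks (F : {set V} -> XX -> R) (Q : {set {set V}}) : Q \subset P ->
  (forall K, K \in P -> bm (F K) /\ loc K (F K)) ->
  mean PP (fun z => \prod_(K in Q) F K z) = \prod_(K in Q) mean PP (F K).
Proof.
move=> QP HF; apply: (mean_prod_indep psi (S := id)) => [K|K K'] KQ; first exact/HF/(fintype.subsetP QP).
move=> K'Q KK'; have /finset.trivIsetP := partP_triv partP; apply => //;
  exact: (fintype.subsetP QP).
Qed.

Lemma block_dens_bpos : bpos block_dens.
Proof. by apply: bpos_prod => K _; exact: pred_dens_bpos. Qed.

Lemma mean_block_dens : mean PP block_dens = 1.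
Proof.
rewrite mean_prod_blocks// => [|K KP]; first by apply: big1 => K _; exact: mean_pred_dens1.
by split; [exact: bpos_bm (pred_dens_bpos K)|exact: loc_pred_dens].
Qed.

Definition block_law : pdensity PP :=
  PDensity (bpos_bm block_dens_bpos) (fun z => bpos_ge0 z block_dens_bpos) mean_block_dens.

Variable n : nat.
Local Notation SS := (product_space (fun _ : 'I_n => XX)).
Local Notation idx := {ffun {set V} -> 'I_n}.

(** The product of the empirical block marginals is the uniform mixture of these recombined
    particles. Index functions live on all subsets of [V] and not only on blocks: the additional
    values repeat every term equally often and leave averages unchanged. *)
Definition glue (c : idx) (X : SS) : XX := fun v => X (c (finset.pblock P v)) v.

Lemma measurable_glue c : measurable_fun setT (glue c).
Proof.
apply: measurable_to_product => v.
by have := measurableT_comp (@measurable_coord _ _ T v)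
  (@measurable_coord _ _ (fun _ : 'I_n => XX) (c (finset.pblock P v))).
Qed.

Definition samples : probability SS R := prodP (fun _ : 'I_n => dens pred_law).

(** Blocks read from distinct particles are independent, and each has the predicted block
    marginal. *)
Lemma mean_glue_law (Q : {set {set V}}) (c : idx) f : Q \subset P ->
  {in Q &, injective c} -> bm f -> loc (finset.cover Q) f ->
  mean samples (fun X => f (glue c X)) = mean PP (fun z => f z * block_dens z).
Proof.
move=> QP cinj bf lf; set U := finset.cover Q.
(* Outside the blocks of [Q] the indices may collide; freezing those coordinates makes the two laws
   equal. *)
pose fix_out (z : XX) : XX := upd U point z.
have mfix : measurable_fun setT fix_out.
  by have := measurableT_comp (@measurable_upd _ _ T U) (measurable_pair1 (point : XX)).
have fE z : f z = f (fix_out z) by apply: lf => v vU; rewrite /fix_out /upd vU.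
have mfg : measurable_fun setT (fun X => fix_out (glue c X)).
  exact: measurableT_comp mfix (measurable_glue c).
rewrite -(mean_dens block_law bf).
rewrite (eq_mean _ (fun X => fE (glue c X))) (eq_mean _ fE).
rewrite -(mean_image samples mfg bf) -(mean_image _ mfix bf).
apply: eq_mean_measure; apply: box_unique => A mA.
have bT : bm (fun z : XX => \prod_v (\1_(A v) (z v) : R)).
  by apply: bm_prod => v _; exact: bm_comp (bm_indic R (mA v)) (@measurable_coord _ _ T v).
rewrite !mean_box//= !mean_image//.
have bA S := bm_box_fun R S mA; congr _%:E.
pose a K (z : XX) : R := \prod_(v in K) \1_(A v) (z v).
pose a0 : R := \prod_(v in ~: U) \1_(A v) ((point : XX) v).
have la K : loc K (a K) by move=> z z' zz'; apply: eq_bigr => v vK; rewrite zz'.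
have split_a z : \prod_v (\1_(A v) (fix_out z v) : R) = a0 * \prod_(K in Q) a K z.
  have -> : \prod_(K in Q) a K z = \prod_(v in U) \1_(A v) (z v).
    by rewrite finset.big_trivIset//; exact: finset.trivIsetS (partP_triv partP).
  rewrite mulrC (bigID (mem U))/=; congr (_ * _).
    by apply: eq_bigr => v vU; rewrite /fix_out /upd vU.
  by apply: eq_big => [v|v]; rewrite ?inE// => vU; rewrite /fix_out /upd (negbTE vU).
rewrite (eq_mean _ (fun X => split_a (glue c X))) (eq_mean _ split_a).
have bP : bm (fun z => \prod_(K in Q) a K z) by apply: bm_prod => K _; exact: bA.
rewrite !meanZl//; last exact: bm_comp bP (measurable_glue c).
congr (_ * _); rewrite mean_dens//=.
have aglue K X : K \in Q -> a K (glue c X) = a K (X (c K)).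
  move=> KQ; apply: eq_bigr => v vK.
  by rewrite /glue (pblock_eq partP (fintype.subsetP QP _ KQ) vK).
transitivity (\prod_(K in Q) mean PP (fun z => a K z * pred_dens K z)).
  transitivity (mean samples (fun X => \prod_(K in Q) a K (X (c K)))).
    by apply: eq_mean => X; apply: eq_bigr => K; exact: aglue.
  rewrite (mean_prod_indep _ (S := fun K => [set c K]%SET)).
  - apply: eq_bigr => K KQ; rewrite (mean_coord _ (v := c K) (bA K)) mean_dens//=.
    exact: mean_pred_dens.
  - move=> K KQ; split; first by have := bm_comp (bA K) (@measurable_coord _ _ (fun _ : 'I_n => XX) (c K)).
    by move=> X X' XX'; rewrite XX' ?inE.
  - by move=> K K' KQ K'Q KK'; rewrite disjoints1 inE; apply: contraNN KK' => /eqP/cinj ->.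
have HF K : K \in P -> bpos (pred_dens K) /\ loc K (pred_dens K).
  by move=> _; split; [exact: pred_dens_bpos|exact: loc_pred_dens].
rewrite (@prodP_indep _ _ _ _ psi _ partP Q)//; last first.
  by apply: loc_prod => K KQ; apply: locS (la K); exact: finset.bigcup_sup.
rewrite mean_prod_blocks ?finset.subsetDl// => [|K /HF[/bpos_bm]//].
rewrite [X in _ * X]big1 ?mulr1 => [|K _]; last exact: mean_pred_dens1.
rewrite -(mean_prod_blocks (F := fun K z => a K z * pred_dens K z))//.
  by apply: eq_mean => z; rewrite big_split.
move=> K /HF[/bpos_bm b1 l1]; split; first exact: bmM (bA K) b1.
exact: locM.
Qed.

Hypothesis n_gt0 : (0 < n)%N.

Definition avg (F : idx -> R) : R := (#|{: idx}|%:R)^-1 * \sum_(c : idx) F c.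

Let c_gt0 : 0 < (#|{: idx}|%:R : R) := card_idx_gt0 R {set V} n_gt0.

Lemma avg_ge (F : idx -> R) C : (forall c, C <= F c) -> C <= avg F.
Proof.
move=> FC; rewrite /avg mulrC ler_pdivlMr//.
apply: le_trans (ler_sum _ (fun c _ => FC c)).
by rewrite sumr_const -[leRHS]mulr_natr.
Qed.

Lemma bm_avg_glue f : bm f -> bm (fun X : SS => avg (fun c => f (glue c X))).
Proof.
move=> bf; apply: bmM; first exact: bm_cst.
by apply: bm_sum => c _; exact: bm_comp bf (measurable_glue c).
Qed.

(* Glued particles with disjoint sets of indices are independent, so that only a
   fraction O(1/n) of the pairs of index functions contributes to the second moment. *)
Lemma glue_variance (Q : {set {set V}}) f Phi : Q \subset P -> bm f ->
  loc (finset.cover Q) f -> (forall x, `|f x| <= Phi) ->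
  mean samples (fun X =>
    (avg (fun c => f (glue c X)) - mean PP (fun z => f z * block_dens z)) ^+ 2) <=
  12 * #|Q|%:R ^+ 2 * Phi ^+ 2 / n%:R.
Proof.
move=> QP bf lf fPhi; set th := mean PP _.
have Phi0 : 0 <= Phi by apply: le_trans (fPhi point).
have thPhi : `|th| <= Phi.
  rewrite /th -(mean_dens block_law bf); exact: mean_norm_le.
pose u (c : idx) (X : SS) := f (glue c X) - th.
have bfg c : bm (fun X => f (glue c X)) by exact: bm_comp bf (measurable_glue c).
have bu c : bm (u c) by apply: bmB => //; exact: bm_cst.
have uPhi c X : `|u c X| <= 2 * Phi.
  by rewrite (le_trans (ler_normB _ _))// mulr_natl mulr2n lerD.
have E X : (avg (fun c => f (glue c X)) - th) ^+ 2 =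
    #|{: idx}|%:R ^- 2 * \sum_(c : idx) \sum_(c' : idx) u c X * u c' X.
  have -> : avg (fun c => f (glue c X)) - th = #|{: idx}|%:R^-1 * \sum_(c : idx) u c X.
    rewrite /avg /u sumrB mulrBr; congr (_ - _).
    by rewrite sumr_const -[th *+ _]mulr_natl mulrA mulVf ?mul1r// lt0r_neq0.
  rewrite exprMn exprVn; congr (_ * _); rewrite expr2 mulr_suml.
  by apply: eq_bigr => c _; rewrite mulr_sumr.
rewrite (eq_mean _ E) meanZl; last first.
  by apply: bm_sum => c _; apply: bm_sum => c' _; exact: bmM.
rewrite mean_sum; last by move=> c; apply: bm_sum => c' _; exact: bmM.
(* A pair without collisions contributes nothing, by independence and centring; any other pair
   contributes at most [(2 * Phi) ^+ 2]. *)
have Ecc c c' : mean samples (fun X => u c X * u c' X) <=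
    4 * Phi ^+ 2 * (~~ good_pair Q c c')%:R.
  have [|_] := boolP (good_pair Q c c'); last first.
    rewrite mulr1; apply: mean_le; first exact: bmM.
    move=> X; apply: le_trans (ler_norm _) _; rewrite normrM.
    have -> : 4 * Phi ^+ 2 = (2 * Phi) * (2 * Phi) by ring.
    by apply: ler_pM.
  move=> /good_pairP[ic ic' dis]; rewrite mulr0.
  have lu (c0 : idx) (S : {set 'I_n}) : (forall K, K \in Q -> c0 K \in S) -> loc S (u c0).
    move=> HS X X' XX'; rewrite /u; congr (_ - _); apply: lf => v.
    move=> /finset.bigcupP[K KQ vK]; rewrite /glue.
    by rewrite (pblock_eq partP (fintype.subsetP QP _ KQ) vK) XX'// HS.
  rewrite (mean_indep _ (S := [set c K | K in Q]%SET))//.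
  - rewrite meanB//; last exact: bm_cst.
    by rewrite (mean_glue_law QP ic bf lf) mean_cst subrr mul0r.
  - by apply: lu => K KQ; exact: imset_f.
  - apply: lu => K' K'Q; rewrite inE; apply/imsetP => -[K KQ E'].
    by have := dis K K' KQ K'Q; rewrite E' eqxx.
have n0 : 0 < (n%:R : R) by rewrite ltr0n.
apply: (@le_trans _ _ (#|{: idx}|%:R ^- 2 *
    (4 * Phi ^+ 2 * \sum_(c : idx) \sum_(c' : idx) (~~ good_pair Q c c')%:R))).
  rewrite ler_wpM2l ?invr_ge0 ?exprn_ge0//.
  rewrite mulr_sumr; apply: ler_sum => c _; rewrite mean_sum; last by move=> c'; exact: bmM.
  by rewrite mulr_sumr; apply: ler_sum.
have h := sum_bad_pair R n_gt0 Q.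
rewrite mulrC ler_pdivrMr ?exprn_gt0//.
apply: (@le_trans _ _ (4 * Phi ^+ 2 * (#|{: idx}|%:R ^+ 2 * (3 * #|Q|%:R ^+ 2 / n%:R)))).
  by rewrite ler_wpM2l// mulr_ge0// exprn_ge0.
by rewrite le_eqVlt; apply/orP; left; apply/eqP; ring.
Qed.

Variable gl : forall v, T v -> R.
Arguments gl : clear implicits.
Variable kap : R.
Hypothesis kap_gt0 : 0 < kap.
Hypothesis kap_le1 : kap <= 1.
Hypothesis gl_bnd : forall v (x : T v), kap <= gl v x <= kap^-1.
Hypothesis gl_meas : forall v, measurable_fun setT (gl v).
Local Notation gS := (site_prod gl).

Lemma site_bpos v : bpos (gl v).
Proof.
split; last by exists kap => // x; have /andP[] := gl_bnd x.
split=> //; exists kap^-1 => x; have /andP[h1 h2] := gl_bnd x.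
by rewrite ger0_norm// (le_trans (ltW kap_gt0)).
Qed.

Lemma site_prod_bnd S (x : XX) : kap ^+ #|S| <= gS S x <= kap ^- #|S|.
Proof.
have k0 := kap_gt0.
rewrite -exprVn -!prodr_const; apply/andP; split; apply: ler_prod => v _.
  by have /andP[-> _] := gl_bnd (x v); rewrite ltW.
by have /andP[h1 ->] := gl_bnd (x v); rewrite (le_trans (ltW k0) h1).
Qed.

Lemma site_prod_bpos S : bpos (gS S : XX -> R).
Proof. by apply: bpos_prod => v _; exact: bpos_comp (site_bpos v) (@measurable_coord _ _ T v). Qed.

Lemma loc_site_prod S : loc S (gS S : XX -> R).
Proof. by move=> x x' xx'; apply: eq_bigr => v vS; rewrite xx'. Qed.

Definition emp (X : SS) f : R :=
  (\sum_(c : idx) f (glue c X) * gS [set: V]%SET (glue c X)) /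
  \sum_(c : idx) gS [set: V]%SET (glue c X).

(** Unnormalised law after one block step without sampling, started from [mu]. *)
Definition start (z : XX) : R := \prod_(K in P) (gS K z * pred_dens K z).

Lemma start_bpos : bpos start.
Proof. by apply: bpos_prod => K _; apply: bposM; [exact: site_prod_bpos|exact: pred_dens_bpos]. Qed.

(** The weights of the blocks outside [Q] depend on other coordinates of [c] and cancel, so that
    only the likelihood on the cover of [Q] has to be bounded. *)
Lemma emp_loc (Q : {set {set V}}) X f : Q \subset P -> loc (finset.cover Q) f ->
  emp X f = avg (fun c => f (glue c X) * gS (finset.cover Q) (glue c X)) /
            avg (fun c => gS (finset.cover Q) (glue c X)).
Proof.
move=> QP lf; set U := finset.cover Q.
have gE x : gS [set: V]%SET x = gS U x * gS (~: U)%SET x.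
  transitivity (\prod_(v in [set: V]%SET) gl v (x v)) => //.
  rewrite (big_setID U)/= finset.setTI; congr (_ * _).
  by apply: eq_bigl => v; rewrite !inE andbT.
have lg (h : XX -> R) : loc U h -> forall c c' : idx, (forall b, b \in Q -> c b = c' b) ->
    h (glue c X) = h (glue c' X).
  move=> lh c c' cc'; apply: lh => v /finset.bigcupP[K KQ vK].
  by rewrite /glue (pblock_eq partP (fintype.subsetP QP _ KQ) vK) cc'.
have lo (c c' : idx) : (forall b, b \notin Q -> c b = c' b) ->
    gS (~: U)%SET (glue c X) = gS (~: U)%SET (glue c' X).
  move=> cc'; apply: loc_site_prod => v; rewrite inE => vU; rewrite /glue cc'//.
  by apply: contraNN vU => vQ; apply/finset.bigcupP; exists (finset.pblock P v) => //;
    exact: mem_pblockP.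
have key (h : XX -> R) : loc U h ->
    \sum_(c : idx) h (glue c X) * gS [set: V]%SET (glue c X) =
    avg (fun c => h (glue c X) * gS U (glue c X)) *
      \sum_(c : idx) gS (~: U)%SET (glue c X).
  move=> lh; rewrite /avg -mulrA.
  rewrite (sum_idx_indep (Q := Q) (F := fun c => h (glue c X) * gS U (glue c X))); first last.
  - exact: lo.
  - by move=> c c' cc'; rewrite (lg h lh c c' cc') (lg _ (@loc_site_prod U) c c' cc').
  rewrite mulrA mulVf ?mul1r ?lt0r_neq0//.
  by apply: eq_bigr => c _; rewrite gE mulrA.
have key1 : \sum_(c : idx) gS [set: V]%SET (glue c X) =
    avg (fun c => gS U (glue c X)) * \sum_(c : idx) gS (~: U)%SET (glue c X).
  transitivity (\sum_(c : idx) 1 * gS [set: V]%SET (glue c X)).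
    by apply: eq_bigr => c _; rewrite mul1r.
  rewrite (key (fun=> 1))//; congr (_ * _); congr (_ * _).
  by apply: eq_bigr => c _; rewrite mul1r.
rewrite /emp key// key1 invfM mulrACA divff ?mulr1//.
apply: lt0r_neq0; rewrite (bigD1 [ffun=> Ordinal n_gt0])//= ltr_pwDl//.
  exact: bpos_gt0 (site_prod_bpos _).
by apply: sumr_ge0 => c _; exact: bpos_ge0 (site_prod_bpos _).
Qed.

Lemma wavg_start_loc (Q : {set {set V}}) f : Q \subset P -> bm f ->
  loc (finset.cover Q) f ->
  wavg PP start f = mean PP (fun z => f z * gS (finset.cover Q) z * block_dens z) /
    mean PP (fun z => gS (finset.cover Q) z * block_dens z).
Proof.
move=> QP bf lf; set U := finset.cover Q.
have HF K : K \in P -> bpos (fun z => gS K z * pred_dens K z) /\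
    loc K (fun z => gS K z * pred_dens K z).
  move=> _; split; first by apply: bposM; [exact: site_prod_bpos|exact: pred_dens_bpos].
  by apply: locM; [exact: loc_site_prod|exact: loc_pred_dens].
have HF' K : K \in P -> bpos (pred_dens K) /\ loc K (pred_dens K).
  by move=> _; split; [exact: pred_dens_bpos|exact: loc_pred_dens].
have gU z : \prod_(K in Q) gS K z = gS U z.
  transitivity (\prod_(v in finset.cover Q) gl v (z v)) => //.
  by rewrite finset.big_trivIset//; exact: finset.trivIsetS (partP_triv partP).
pose A := mean PP (fun z => \prod_(K in P :\: Q) (gS K z * pred_dens K z)).
pose A' := mean PP (fun z => \prod_(K in P :\: Q) pred_dens K z).
have A0 : A != 0.
  by rewrite lt0r_neq0// mean_gt0//; apply: bpos_prod => K; rewrite inE => /andP[_ /HF[]].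
have A'0 : A' != 0.
  by rewrite lt0r_neq0// mean_gt0//; apply: bpos_prod => K; rewrite inE => /andP[_ /HF'[]].
have key h : bm h -> loc U h -> mean PP (fun z => h z * start z) =
    mean PP (fun z => h z * gS U z * block_dens z) / A' * A.
  move=> bh lh; have bg := bpos_bm (site_prod_bpos U).
  rewrite (prodP_indep psi partP QP HF bh lh) (prodP_indep psi partP QP HF' (bmM bh bg) (locM lh (@loc_site_prod U))).
  rewrite -/A -/A' mulfK//; congr (_ * _); apply: eq_mean => z.
  by rewrite big_split/= gU mulrA.
have key1 : mean PP start = mean PP (fun z => gS U z * block_dens z) / A' * A.
  rewrite -(eq_mean PP (fun z => mul1r (start z))) key//; last exact: bm_cst.
  by congr (_ / _ * _); apply: eq_mean => z; rewrite mul1r.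
rewrite /wavg key// key1 !invfM invrK.
set a := mean _ _; set b := mean _ _.
by rewrite -[RHS]mulr1 -[in RHS](divff A0) -[in RHS](mulr1 (a / b)) -[in RHS](divff A'0); ring.
Qed.

(* a / b - th / t = (a - th) / b - (th / t) * (b - t) / b *)
Lemma ratio_error (a b th t g Phi : R) : 0 < g -> g <= b -> 0 < t -> `|th| <= Phi * t ->
  0 <= Phi ->
  (a / b - th / t) ^+ 2 <= 2 * g ^- 2 * ((a - th) ^+ 2 + Phi ^+ 2 * (b - t) ^+ 2).
Proof.
move=> g0 gb t0 thP P0; have b0 : 0 < b by exact: lt_le_trans gb.
have rP : (th / t) ^+ 2 <= Phi ^+ 2.
  by rewrite -(real_normK (num_real (th / t))) ler_sqr ?nnegrE// normrM (gtr0_norm (x := t^-1)) ?invr_gt0// ler_pdivrMr.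
have -> : a / b - th / t = ((a - th) - (th / t) * (b - t)) / b.
  by field; rewrite !gt_eqF.
rewrite exprMn exprVn; set r := th / t in rP *.
have h : ((a - th) - r * (b - t)) ^+ 2 <= 2 * ((a - th) ^+ 2 + Phi ^+ 2 * (b - t) ^+ 2).
  have h1 : r ^+ 2 * (b - t) ^+ 2 <= Phi ^+ 2 * (b - t) ^+ 2 by rewrite ler_wpM2r// sqr_ge0.
  have h2 := sqr_ge0 ((a - th) + r * (b - t)).
  have -> : 2 * ((a - th) ^+ 2 + Phi ^+ 2 * (b - t) ^+ 2) =
    ((a - th) - r * (b - t)) ^+ 2 + ((a - th) + r * (b - t)) ^+ 2 +
    2 * (Phi ^+ 2 * (b - t) ^+ 2 - r ^+ 2 * (b - t) ^+ 2) by ring.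
  lra.
have hb : b ^- 2 <= g ^- 2.
  by rewrite lef_pV2 ?posrE ?exprn_gt0// ler_sqr// nnegrE; exact: ltW.
rewrite [leRHS]mulrAC; apply: ler_pM => //; first exact: sqr_ge0.
by rewrite invr_ge0 sqr_ge0.
Qed.

(** [48 = 2 * (12 + 12)]: the factor of [ratio_error] and the variances of numerator and
    denominator. Of the 4 in the exponent, 2 come from the lower bound of the denominator and 2 from
    the size of the weighted test functions. *)
Lemma sampling_error (Q : {set {set V}}) f Phi : Q \subset P -> bm f ->
  loc (finset.cover Q) f -> (forall x, `|f x| <= Phi) ->
  mean samples (fun X => (emp X f - wavg PP start f) ^+ 2) <=
  48 * #|Q|%:R ^+ 2 * kap ^- (4 * #|finset.cover Q|) * Phi ^+ 2 / n%:R.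
Proof.
move=> QP bf lf fPhi; set U := finset.cover Q.
have Phi0 : 0 <= Phi by apply: le_trans (fPhi point).
have n0 : 0 < (n%:R : R) by rewrite ltr0n.
have bg : bm (gS U : XX -> R) := bpos_bm (site_prod_bpos U).
have bfg : bm (fun z => f z * gS U z) by exact: bmM.
pose th := mean PP (fun z => f z * gS U z * block_dens z).
pose t := mean PP (fun z => gS U z * block_dens z).
pose k := kap ^+ #|U|; have k0 : 0 < k by rewrite exprn_gt0.
have bgb : bpos (fun z => gS U z * block_dens z).
  by apply: bposM; [exact: site_prod_bpos|exact: block_dens_bpos].
have t0 : 0 < t by exact: mean_gt0.
have thP : `|th| <= Phi * t.
  rewrite /t -meanZl; last exact: bpos_bm bgb.
  have bth : bm (fun z => f z * gS U z * block_dens z).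
    by apply: bmM => //; exact: bpos_bm block_dens_bpos.
  apply: le_trans (mean_norm PP bth) _; apply: le_mean; first exact: bm_abs.
    by apply: bmM; [exact: bm_cst|exact: bpos_bm bgb].
  move=> z; rewrite -mulrA normrM (ger0_norm (bpos_ge0 z bgb)).
  by rewrite ler_wpM2r// (bpos_ge0 z bgb).
have ba := bm_avg_glue bfg; have bb := bm_avg_glue bg.
have sqb (h : SS -> R) c : bm h -> bm (fun X : SS => (h X - c) ^+ 2).
  by move=> bh; apply: (@eq_bm _ _ _ (fun X => (h X - c) * (h X - c))) => [x|]; [rewrite expr2|apply: bmM; apply: bmB => //; exact: bm_cst].
have s1 := sqb _ th ba; have s2 := sqb _ t bb.
apply: (@le_trans _ _ (mean samples (fun X => 2 * k ^- 2 *
    ((avg (fun c => f (glue c X) * gS U (glue c X)) - th) ^+ 2 +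
     Phi ^+ 2 * (avg (fun c => gS U (glue c X)) - t) ^+ 2)))).
  apply: le_mean.
  - have bd : bm (fun X : SS => avg (fun c => f (glue c X) * gS U (glue c X)) / avg (fun c => gS U (glue c X))).
      apply: bm_div => //; split=> //; exists k => // X; apply: avg_ge => c.
      by have /andP[] := site_prod_bnd U (glue c X).
    apply: eq_bm (sqb _ (wavg PP start f) bd) => X /=.
    by rewrite (emp_loc X QP lf).
  - by apply: bmM; [exact: bm_cst|apply: bmD => //; apply: bmM => //; exact: bm_cst].
  move=> X; rewrite (emp_loc X QP lf) (wavg_start_loc QP bf lf).
  apply: ratio_error => //; apply: avg_ge => c.
  by have /andP[] := site_prod_bnd U (glue c X).
rewrite meanZl; last by apply: bmD => //; apply: bmM => //; exact: bm_cst.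
rewrite meanD//; last by apply: bmM => //; exact: bm_cst.
rewrite meanZl//.
have gk (z : XX) : `|gS U z| <= k^-1.
  have /andP[h1 h2] := site_prod_bnd U z; rewrite ger0_norm//.
  by rewrite (le_trans _ h1)// ltW.
have v1 : mean samples (fun X =>
    (avg (fun c => f (glue c X) * gS U (glue c X)) - th) ^+ 2) <=
    12 * #|Q|%:R ^+ 2 * (Phi * k^-1) ^+ 2 / n%:R.
  apply: (@glue_variance Q (fun z => f z * gS U z)) => // [|z].
    by apply: locM => //; exact: loc_site_prod.
  by rewrite normrM ler_pM.
have v2 := @glue_variance Q _ (k^-1) QP bg (@loc_site_prod U) gk.
rewrite -/t in v2.
apply: (@le_trans _ _ (2 * k ^- 2 * (12 * #|Q|%:R ^+ 2 * (Phi * k^-1) ^+ 2 / n%:R +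
    Phi ^+ 2 * (12 * #|Q|%:R ^+ 2 * k^-1 ^+ 2 / n%:R)))).
  rewrite ler_wpM2l//; first by rewrite mulr_ge0// invr_ge0 exprn_ge0// ltW.
  by apply: lerD => //; rewrite ler_wpM2l ?sqr_ge0.
have -> : kap ^- (4 * #|U|) = k ^- 2 * k^-1 ^+ 2.
  by rewrite /k -!exprVn -!exprM -exprD -mulnDr mulnC.
by rewrite le_eqVlt; apply/orP; left; apply/eqP; ring.
Qed.

End particle_law.

Section reweighted_law.
Context (R : realType) d (T : measurableType d) (P : probability T R).

Section weight.
Variables (k : T -> R) (bk : bpos k).

Let k_gt0 : 0 < mean P k := mean_gt0 P bk.

Let w_bm : bm (fun x => k x / mean P k).
Proof. by apply: bmM; [exact: bpos_bm|exact: bm_cst]. Qed.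

Let w_ge0 x : 0 <= k x / mean P k.
Proof. by rewrite divr_ge0 ?(bpos_ge0 _ bk) ?ltW. Qed.

Let w_mean : mean P (fun x => k x / mean P k) = 1.
Proof. by rewrite meanZr ?divff ?lt0r_neq0//; exact: bpos_bm. Qed.

Definition wdens : pdensity P := PDensity w_bm w_ge0 w_mean.

Lemma mean_wdens f : bm f -> mean (dens wdens : probability T R) f = wavg P k f.
Proof.
move=> bf; rewrite mean_dens// /wavg -meanZr; last by apply: bmM => //; exact: bpos_bm.
by apply: eq_mean => x; rewrite mulrA.
Qed.

End weight.
End reweighted_law.

Section uniform_mixture.
Context (R : realType) d (T : measurableType d) (I : finType) (i0 : I) (pt : I -> T).

(** [msum] adds measures indexed by natural numbers, hence the enumeration of [I]; [i0] is its
    default entry. *)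
Definition unif : set T -> \bar R := mscale (#|I|%:R^-1)%:nng
  (msum (fun n => \d_(pt (nth i0 (enum I) n))) #|I|).

HB.instance Definition _ := Measure.on unif.

Lemma unifE A : unif A = (#|I|%:R^-1 * \sum_i (\1_A (pt i) : R))%:E.
Proof.
rewrite /unif /mscale/= /msum EFinM; congr (_ * _)%E.
rewrite -sumEFin -[RHS]big_enum/= (big_nth i0) -cardE big_mkord.
by apply: eq_bigr => j _; rewrite diracE indicE.
Qed.

Let I_neq0 : #|I|%:R != 0 :> R.
Proof. by rewrite pnatr_eq0 -lt0n; apply/card_gt0P; exists i0. Qed.

Let unif_setT : unif setT = 1%E.
Proof.
rewrite unifE (eq_bigr (fun=> 1)) => [|i _]; last by rewrite indicE mem_set.
by rewrite sumr_const mulVf.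
Qed.

HB.instance Definition _ := Measure_isProbability.Build _ _ _ unif unif_setT.

Lemma mean_unif f : bm f ->
  mean (unif : probability T R) f = #|I|%:R^-1 * \sum_i f (pt i).
Proof.
move=> bf; transitivity (mean (unif : probability T R) (fun x => f x * 1)).
  by apply: eq_mean => x; rewrite mulr1.
pose Psi f := #|I|%:R^-1 * \sum_i f (pt i) : R.
apply: (@bfunctional_ext _ _ _ (fun f => mean (unif : probability T R) (fun x => f x * 1)) Psi) => //.
- by apply: bf_mean; exact: bm_cst.
- split.
  + by move=> g h _ _; rewrite /Psi big_split/= mulrDr.
  + by move=> c g _; rewrite /Psi -mulr_sumr mulrCA.
  + exists 1 => // g c _ gc; rewrite mul1r normrM ger0_norm ?invr_ge0//.
    rewrite mulrC ler_pdivrMr ?lt0r ?I_neq0//=.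
    apply: le_trans (ler_norm_sum _ _ _) _; apply: le_trans (ler_sum _ (fun i _ => gc (pt i))) _.
    by rewrite sumr_const -[leLHS]mulr_natr.
- move=> A mA; apply: EFin_inj; rewrite -unifE -mean_indic//.
  by congr _%:E; apply: eq_mean => x; rewrite mulr1.
Qed.

End uniform_mixture.

(** Telescoping over the factors; as every [m i] is at least 1, the full product of the bounds
    dominates all partial ones. *)
Lemma prod_diff_le (R : realType) (I : finType) (Q : {set I}) (a b m : I -> R) :
  (forall i, i \in Q -> 0 <= a i <= m i) -> (forall i, i \in Q -> 0 <= b i <= m i) ->
  (forall i, i \in Q -> 1 <= m i) ->
  `|\prod_(i in Q) a i - \prod_(i in Q) b i| <=
  (\prod_(i in Q) m i) * \sum_(i in Q) `|a i - b i|.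
Proof.
move=> ha hb hm; rewrite -!(big_enum _ _ Q)/=.
have : all (mem Q) (enum Q) by apply/allP => i; rewrite mem_enum.
elim: (enum Q) => [|i s IH]; first by rewrite !big_nil subrr normr0 mulr0.
rewrite !big_cons => /= /andP[iQ sQ]; have {}IH := IH sQ.
have /andP[a0 am] := ha i iQ; have /andP[b0 bm] := hb i iQ; have m1 := hm i iQ.
have inQ j : j \in s -> j \in Q by move=> /(allP sQ).
set A := \prod_(j <- s) a j in IH *; set B := \prod_(j <- s) b j in IH *.
set M := \prod_(j <- s) m j in IH *; set S := \sum_(j <- s) _ in IH *.
have M1 : 1 <= M.
  rewrite /M big_seq; elim/big_rec: _ => // j x /inQ/hm m1' x1.
  by rewrite -[1]mulr1 ler_pM.
have A0 : 0 <= A by rewrite /A big_seq; apply: prodr_ge0 => j /inQ/ha/andP[].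
have AM : A <= M.
  by rewrite /A /M !big_seq; apply: ler_prod => j /inQ/ha.
have -> : a i * A - b i * B = (a i - b i) * A + b i * (A - B) by ring.
apply: le_trans (ler_normD _ _) _; rewrite !normrM (ger0_norm A0) (ger0_norm b0) mulrDr.
apply: lerD.
  rewrite mulrC ler_wpM2r// (le_trans AM)// ler_peMl//; exact: le_trans M1.
by rewrite -mulrA ler_pM.
Qed.

Section start_error.
Context (R : realType) (V : finType) (d : V -> measure_display)
  (T : forall v, measurableType (d v)) (psi : forall v, probability (T v) R).
Local Notation XX := (product_space T).
Local Notation PP := (prodP psi : probability XX R).
Variables (N : V -> {set V}) (Dl : nat) (e lam sig : R).
Variable p : forall v, XX -> T v -> R.
Arguments p : clear implicits.
Hypothesis LM : local_model N Dl e lam sig p.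
Variable P : {set {set V}}.
Hypothesis partP : finset.partition P [set: V]%SET.
Variable gl : forall v, T v -> R.
Arguments gl : clear implicits.
Variable kap : R.
Hypothesis kap_gt0 : 0 < kap.
Hypothesis gl_bnd : forall v (x : T v), kap <= gl v x <= kap^-1.
Hypothesis gl_meas : forall v, measurable_fun setT (gl v).
Local Notation gS := (site_prod gl).

(** Blocks outside [Q] cancel from both averages. One power of [(kap * e)^-1] bounds the difference
    of the products of block densities, the other the inverse of a normalisation, which explains the
    2 in the exponent. *)
Lemma start_error (mu mu' : probability XX R) (Q : {set {set V}}) f c :
  Q \subset P -> bm f -> loc (finset.cover Q) f -> (forall x, `|f x| <= c) ->
  `|wavg PP (start p P mu gl) f - wavg PP (start p P mu' gl) f| <=
  2 * c * (kap * e) ^- (2 * #|finset.cover Q|) *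
  \sum_(K in Q) mean PP (fun z => `|pred_dens p mu K z - pred_dens p mu' K z|).
Proof.
move=> QP bf lf fc; set U := finset.cover Q.
have c0 : 0 <= c by apply: le_trans (fc point).
have e0 := e_gt0 LM; have e1 := e_le1 LM.
pose F nu K (z : XX) := gS K z * pred_dens p nu K z.
have HF nu K : K \in P -> bpos (F nu K) /\ loc K (F nu K).
  move=> _; split; first by apply: bposM; [exact: site_prod_bpos kap_gt0 gl_bnd gl_meas _|exact: pred_dens_bpos LM _ _].
  by apply: locM; [exact: loc_site_prod|exact: loc_pred_dens].
pose H nu z := \prod_(K in Q) F nu K z.
have bH nu : bpos (H nu) by apply: bpos_prod => K /(fintype.subsetP QP)/(HF nu)[].
have red nu : wavg PP (start p P nu gl) f = wavg PP (H nu) f.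
  have A0 : mean PP (fun z => \prod_(K in P :\: Q) F nu K z) != 0.
    by rewrite lt0r_neq0// mean_gt0//; apply: bpos_prod => K; rewrite inE => /andP[_ /(HF nu)[]].
  have r1 := prodP_indep psi partP QP (HF nu) bf lf.
  have r2 := prodP_indep psi partP QP (HF nu) (bm_cst _ 1) (@loc_cst _ _ _ _ _ 1).
  rewrite /wavg [X in X / _]r1.
  rewrite -(eq_mean PP (fun z => mul1r (start p P nu gl z))) [X in _ / X]r2.
  rewrite (eq_mean PP (fun z => mul1r (\prod_(K in Q) F nu K z))).
  by rewrite invfM mulrACA divff// mulr1.
rewrite !red; have bh := bH mu; have bh' := bH mu'.
set w := wavg PP (H mu) f; set w' := wavg PP (H mu') f.
have wc : `|w| <= c by exact: wavg_norm_le.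
have b1 := bpos_bm bh; have b2 := bpos_bm bh'.
have bfw : bm (fun z => f z - w) by apply: bmB => //; exact: bm_cst.
(* Centring at [w] removes the contribution of [H mu], whose own average is [w]. *)
have key : (w - w') * mean PP (H mu') = mean PP (fun z => (f z - w) * (H mu z - H mu' z)).
  have -> : mean PP (fun z => (f z - w) * (H mu z - H mu' z)) =
      (mean PP (fun z => f z * H mu z) - w * mean PP (H mu)) -
      (mean PP (fun z => f z * H mu' z) - w * mean PP (H mu')).
    rewrite -!meanZl// -!meanB; try by do ?[apply: bmM|apply: bmB|exact: bm_cst|done].
    by apply: eq_mean => z; ring.
  by rewrite -(wavgK _ f bh) -/w -(wavgK _ f bh') -/w'; ring.
pose k := (kap * e) ^+ #|U|; have k0 : 0 < k by rewrite exprn_gt0// mulr_gt0.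
have eK K : (e^-1) ^+ #|K| >= 1.
  by rewrite exprn_ege1// invf_ge1.
have cardU : \prod_(K in Q) (e^-1) ^+ #|K| = (e^-1) ^+ #|U|.
  rewrite -prodr_const finset.big_trivIset/=; last exact: finset.trivIsetS QP (partP_triv partP).
  by apply: eq_bigr => K _; rewrite prodr_const.
have gU z : \prod_(K in Q) gS K z = gS U z.
  transitivity (\prod_(v in finset.cover Q) gl v (z v)) => //.
  by rewrite finset.big_trivIset//; exact: finset.trivIsetS (partP_triv partP).
have Hk : k <= mean PP (H mu').
  apply: mean_ge => // z; rewrite /H /F big_split/= gU /k exprMn.
  have /andP[g1 _] := site_prod_bnd kap_gt0 gl_bnd U z.
  apply: ler_pM => //; try by rewrite exprn_ge0// ltW.
  have -> : e ^+ #|U| = \prod_(K in Q) e ^+ #|K|.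
    rewrite -prodr_const finset.big_trivIset/=; last exact: finset.trivIsetS QP (partP_triv partP).
    by apply: eq_bigr => K _; rewrite prodr_const.
  apply: ler_prod => K _; have /andP[-> _] := pred_dens_bounds LM mu' K z.
  by rewrite exprn_ge0// ltW.
have diffH z : `|H mu z - H mu' z| <= k^-1 *
    \sum_(K in Q) `|pred_dens p mu K z - pred_dens p mu' K z|.
  rewrite /H /F !big_split/= gU -mulrBr normrM /k exprMn invfM -!exprVn -mulrA.
  have /andP[g1 g2] := site_prod_bnd kap_gt0 gl_bnd U z.
  apply: ler_pM => //.
    by rewrite ger0_norm ?exprVn// (le_trans _ g1)// exprn_ge0// ltW.
  rewrite -cardU; apply: prod_diff_le => [K _|K _|K _]; last exact: eK.
    by have /andP[h1 h2] := pred_dens_bounds LM mu K z; rewrite h2 (le_trans _ h1)// exprn_ge0// ltW.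
  by have /andP[h1 h2] := pred_dens_bounds LM mu' K z; rewrite h2 (le_trans _ h1)// exprn_ge0// ltW.
have bK K : bm (fun z => `|pred_dens p mu K z - pred_dens p mu' K z|).
  by apply/bm_abs/bmB; exact: bpos_bm (pred_dens_bpos LM _ _).
have mH : `|w - w'| * mean PP (H mu') <= 2 * c * (k^-1 *
    \sum_(K in Q) mean PP (fun z => `|pred_dens p mu K z - pred_dens p mu' K z|)).
  rewrite -[X in _ * X <= _](gtr0_norm (mean_gt0 PP bh')) -normrM key.
  have bD : bm (fun z => H mu z - H mu' z) by exact: bmB.
  have bS : bm (fun z => \sum_(K in Q) `|pred_dens p mu K z - pred_dens p mu' K z|).
    by apply: bm_sum => K _.
  apply: le_trans (mean_norm PP (bmM bfw bD)) _.
  rewrite -big_enum/= -mean_sum// -!meanZl//; last first.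
  - by apply: bm_sum => K _.
  - by apply: bmM; [exact: bm_cst|apply: bm_sum => K _].
  apply: le_mean; first exact/bm_abs/bmM.
    by do 2!(apply: bmM; first exact: bm_cst); apply: bm_sum => K _.
  move=> z; rewrite normrM; apply: ler_pM => //; last by rewrite big_enum.
  by rewrite (le_trans (ler_normB _ _))// mulr_natl mulr2n lerD.
have S0 : 0 <= \sum_(K in Q) mean PP (fun z => `|pred_dens p mu K z - pred_dens p mu' K z|).
  by apply: sumr_ge0 => K _; exact: mean_ge0.
have -> : (kap * e) ^- (2 * #|U|) = k^-1 * k^-1.
  by rewrite -invfM /k -exprD addnn mul2n.
have h : `|w - w'| * k <= `|w - w'| * mean PP (H mu') by rewrite ler_wpM2l.
have {h} := le_trans h mH; rewrite -ler_pdivlMr// => h; apply: le_trans h _.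
by rewrite le_eqVlt; apply/orP; left; apply/eqP; ring.
Qed.

End start_error.

(** * Joint law of consecutive samples *)

Section rectangles.
Context (R : realType) dS (S : measurableType dS) (I : finType)
  (d : I -> measure_display) (T : forall i, measurableType (d i)).
Local Notation XX := (product_space T).

Lemma prob_unique_rect (P Q : probability (S * XX)%type R) :
  (forall H A, measurable H -> (forall i, measurable (A i)) ->
    P (H `*` box A) = Q (H `*` box A)) ->
  forall B, measurable B -> P B = Q B.
Proof.
move=> PQ B mB.
pose G : set (set (S * XX)) := [set B | exists H A, [/\ measurable H,
  forall i, measurable (A i) & B = H `*` @box I d T A]].
have GM : @measurable _ (S * XX)%type = <<s G >>.
  apply/seteqP; split; last first.
    apply: smallest_sub; first exact: sigma_algebra_measurable.
    by move=> _ [H [A [mH mA ->]]]; apply: measurableX => //; exact: measurable_box.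
  pose MG := @measurable _ (g_sigma_algebraType G).
  rewrite measurable_prod_measurableType; apply: smallest_sub.
    exact: smallest_sigma_algebra.
  move=> _ [H mH [C mC <-]].
  (* For fixed [H], the sets [C] whose rectangle with [H] is generated form a sigma-algebra that
     contains the boxes. *)
  suff : measurable `<=` [set C : set XX | MG (H `*` C)] by apply.
  rewrite measurable_boxes; apply: smallest_sub; last first.
    by move=> _ [A mA ->]; apply: sub_sigma_algebra; exists H, A.
  split.
  - by rewrite /= setX0; exact: (@measurable0 _ (g_sigma_algebraType G)).
  - move=> C0 /= hC0.
    have -> : H `*` (setT `\` C0) = (H `*` setT) `\` (H `*` C0).
      by apply/seteqP; split => [[s x] [/= h1 [_ h2]]|[s x] [[/= h1 _] h2]]; split => //=;
        [by move=> [_]|split => // h3; apply: h2].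
    have mT : MG (H `*` setT).
      by apply: sub_sigma_algebra; exists H, (fun=> setT); split => //; rewrite boxT.
    exact: (@measurableD _ (g_sigma_algebraType G)).
  - move=> F hF /=.
    have -> : H `*` (\bigcup_n F n) = \bigcup_n (H `*` F n).
      apply/seteqP; split => [[s x] [/= h1 [n _ h2]]|[s x] [n _ [/= h1 h2]]].
        by exists n.
      by split => //; exists n.
    exact: (@bigcupT_measurable _ (g_sigma_algebraType G)).
apply: (g_sigma_algebra_measure_unique G _ (fun=> setT)) => //.
- by move=> _ [H [A [mH mA ->]]]; apply: measurableX => //; exact: measurable_box.
- by move=> _; exists setT, (fun=> setT); split => //; rewrite boxT setXTT.
- by rewrite bigcup_const.
- move=> _ _ [H [A [mH mA ->]]] [H' [A' [mH' mA' ->]]].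
  exists (H `&` H'), (fun i => A i `&` A' i); split.
  + exact: measurableI.
  + by move=> i; exact: measurableI.
  + apply/seteqP; split => [[s x] [[/= h1 h2] [h3 h4]]|[s x] [[/= h1 h2] h3]].
      by split => // i; split.
    by split; split => //= i; have [] := h3 i.
- by move=> _ [H [A [mH mA ->]]]; exact: PQ.
- by move=> _; rewrite (le_lt_trans (probability_le1 _ _))// ltry.
- by rewrite -GM.
Qed.

End rectangles.

(** * Independent samples and transition kernels *)

Section iid_samples.
Context (R : realType) d (T : measurableType d) (P : probability T R) (n : nat).
Local Notation SS := (product_space (fun _ : 'I_n => T)).

Lemma mean_iid_box (A : 'I_n -> set T) (q : T -> R) : (forall i, measurable (A i)) -> bm q ->
  mean (prodP (fun _ : 'I_n => P)) (fun X : SS => \prod_i \1_(A i) (X i) * \prod_i q (X i)) =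
  \prod_i mean P (fun x => \1_(A i) x * q x).
Proof.
move=> mA bq.
have bF i : bm (fun x => \1_(A i) x * q x) by apply: bmM => //; exact: bm_indic.
transitivity (\prod_(i in [set: 'I_n]%SET) mean (prodP (fun _ : 'I_n => P))
    (fun X : SS => \1_(A i) (X i) * q (X i))).
  rewrite -(mean_prod_indep (fun _ : 'I_n => P) (S := fun i => [set i]%SET)).
  - apply: eq_mean => X; rewrite -big_split/=.
    by apply: eq_bigl => i; rewrite inE.
  - move=> i _; split; first by have := bm_comp (bF i) (@measurable_coord _ _ (fun _ : 'I_n => T) i).
    by move=> X X' XX'; rewrite XX' ?inE.
  - by move=> i j _ _ ij; rewrite disjoints1 inE.
apply: eq_big => [i|i _]; first by rewrite inE.
exact: (mean_coord (fun _ : 'I_n => P) (v := i) (bF i)).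
Qed.

Lemma bm_prod_coord (q : T -> R) : bm q -> bm (fun X : SS => \prod_i q (X i)).
Proof.
move=> bq; apply: bm_prod => i _.
exact: bm_comp bq (@measurable_coord _ _ (fun _ : 'I_n => T) i).
Qed.

Lemma mean_iid1 (q : pdensity P) :
  mean (prodP (fun _ : 'I_n => P)) (fun X : SS => \prod_i q (X i)) = 1.
Proof.
have := mean_iid_box (fun _ => @measurableT _ T) (pd_bm q).
rewrite [RHS]big1 => [E|i _]; last first.
  rewrite -[RHS](pd_mean q); apply: eq_mean => x.
  by rewrite indicE mem_set// mul1r.
rewrite -[RHS]E; apply: eq_mean => X; rewrite [X in _ = X * _]big1 ?mul1r// => i _.
by rewrite indicE mem_set.
Qed.

Lemma mean_samples (q : pdensity P) F : bm F ->
  mean (prodP (fun _ : 'I_n => dens q)) F =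
  mean (prodP (fun _ : 'I_n => P)) (fun X => F X * \prod_i q (X i)).
Proof.
move=> bF.
have q0 (X : SS) : 0 <= \prod_i q (X i) by apply: prodr_ge0 => i _; exact: pd_ge0.
pose Q := PDensity (bm_prod_coord (pd_bm q)) q0 (mean_iid1 q).
rewrite -[RHS](mean_dens Q bF); apply: eq_mean_measure; apply: box_unique => A mA.
transitivity (\prod_i dens q (A i))%E; first exact: prodP_box.
rewrite mean_box// mean_dens; last first.
  apply: bm_prod => i _; exact: bm_comp (bm_indic R (mA i)) (@measurable_coord _ _ (fun _ : 'I_n => T) i).
rewrite [in RHS]/Q/= (mean_iid_box mA (pd_bm q)) -prodEFin.
by apply: eq_bigr => i _; rewrite densE.
Qed.

End iid_samples.

Section transition.
Context (R : realType) d (T : measurableType d) (P : probability T R) (n : nat).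
Local Notation SS := (product_space (fun _ : 'I_n => T)).
Local Notation PN := (prodP (fun _ : 'I_n => P) : probability SS R).
Variable q : SS -> pdensity P.
Hypothesis bq : bm (fun u : SS * T => q u.1 u.2).
Context dO (Omega : measurableType dO) (Pr : probability Omega R).
Variables s s' : Omega -> SS.
Hypotheses (ms : measurable_fun setT s) (ms' : measurable_fun setT s').
Hypothesis law : forall (H : set SS) (A : 'I_n -> set T), measurable H ->
  (forall i, measurable (A i)) ->
  Pr (s @^-1` H `&` [set w | forall i, A i (s' w i)]) =
  (\int[Pr]_(w in s @^-1` H) \prod_(i < n) dens (q (s w)) (A i))%E.

Let bQ : bm (fun u : SS * SS => \prod_i q u.1 (u.2 i)).
Proof.
apply: bm_prod => i _.
have mi : measurable_fun setT (fun u : SS * SS => (u.1, u.2 i)).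
  apply/measurable_fun_pairP; split; first exact: measurable_fst.
  by have := measurableT_comp (@measurable_coord _ _ (fun _ : 'I_n => T) i)
    (@measurable_snd _ _ SS SS).
exact: bm_comp bq mi.
Qed.

(** The joint law of two consecutive samples has density [\prod_i q x (y i)] with respect to the law
    of the first sample times [PN]: the hypothesis [law] determines it on rectangles, where both
    agree. *)
Lemma transition_mean (Psi : SS -> SS -> R) : bm (fun u : SS * SS => Psi u.1 u.2) ->
  mean Pr (fun w => Psi (s w) (s' w)) =
  mean Pr (fun w => mean (prodP (fun _ : 'I_n => dens (q (s w)))) (Psi (s w))).
Proof.
move=> bPsi.
have mss : measurable_fun setT (fun w => (s w, s' w)) by exact/measurable_fun_pairP.
pose nu := image_prob Pr ms.
pose W := (nu \x PN)%E : probability (SS * SS)%type R.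
have meanW F : bm (fun u : SS * SS => F u.1 u.2) ->
    mean W (fun u => F u.1 u.2) = mean Pr (fun w => mean PN (F (s w))).
  move=> bF; transitivity (mean nu (fun x => mean PN (F x))).
    by apply: EFin_inj; rewrite EFin_mean//; exact: mean_fubini1.
  exact: (mean_image Pr ms (bm_mean2 PN bF)).
have Q1 : mean W (fun u => \prod_i q u.1 (u.2 i)) = 1.
  rewrite (meanW (fun x y => \prod_i q x (y i)) bQ) -[RHS](mean_cst Pr).
  by apply: eq_mean => w; exact: mean_iid1.
have Q0 (u : SS * SS) : 0 <= \prod_i q u.1 (u.2 i) by apply: prodr_ge0 => i _; exact: pd_ge0.
pose Q := PDensity bQ Q0 Q1.
rewrite -[LHS](mean_image Pr mss bPsi).
transitivity (mean (dens Q : probability _ R) (fun u => Psi u.1 u.2)); last first.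
  rewrite mean_dens//= (meanW (fun x y => Psi x y * \prod_i q x (y i))); last exact: bmM.
  apply: eq_mean => w; symmetry; apply: mean_samples.
  exact: (bm_slice1 (F := Psi)).
apply: eq_mean_measure; apply: prob_unique_rect => H A mH mA.
have bA : bm (fun X : SS => \prod_i (\1_(A i) (X i) : R)).
  apply: bm_prod => i _; exact: bm_comp (bm_indic R (mA i)) (@measurable_coord _ _ (fun _ : 'I_n => T) i).
have bH := bm_indic R mH.
transitivity (mean W (fun u => \1_(H `*` box A) u * Q u))%:E; last first.
  by symmetry; apply: densE; apply: measurableX => //; exact: measurable_box.
have -> : mean W (fun u => \1_(H `*` box A) u * Q u) =
    mean W (fun u => \1_H u.1 * (\prod_i \1_(A i) (u.2 i) * \prod_i q u.1 (u.2 i))).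
  apply: eq_mean => -[x y] /=; rewrite mulrA; congr (_ * _).
  rewrite !indicE in_setX/=; have [xH|] := boolP (x \in H); last by rewrite mul0r.
  rewrite /= mul1r; have [/set_mem yA|yA] := boolP (y \in box A).
    by rewrite big1// => i _; rewrite indicE mem_set.
  suff [i iA] : exists i, y i \notin A i by rewrite (bigD1 i)//= indicE (negbTE iA) mul0r.
  apply: contra_notP (negP yA) => ni; apply/mem_set => i.
  by apply/set_mem; apply: contra_notT ni => ?; exists i.
rewrite (meanW (fun x y => \1_H x * (\prod_i \1_(A i) (y i) * \prod_i q x (y i)))); last first.
  apply: bmM; first exact: bm_comp bH measurable_fst.
  by apply: bmM => //; exact: bm_comp bA measurable_snd.
rewrite image_probE.
have -> : (fun w => (s w, s' w)) @^-1` (H `*` box A) =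
  s @^-1` H `&` [set w | forall i, A i (s' w i)] by [].
rewrite law// integral_mkcond EFin_mean; last first.
  apply: (bm_comp (f := fun x => mean PN (fun y => \1_H x * (\prod_i \1_(A i) (y i) * \prod_i q x (y i)))) _ ms).
  apply: (bm_mean2 PN (F := fun x y => \1_H x * (\prod_i \1_(A i) (y i) * \prod_i q x (y i)))).
  apply: bmM; first exact: bm_comp bH measurable_fst.
  by apply: bmM => //; exact: bm_comp bA measurable_snd.
apply: eq_integral => w _; rewrite patchE.
rewrite meanZl; last first.
  by apply: bmM => //; exact: (bm_prod_coord _ (pd_bm (q (s w)))).
rewrite (mean_iid_box P mA (pd_bm (q (s w)))) indicE.
have [h|h] := boolP (w \in s @^-1` H).
  rewrite mem_set ?mul1r -?prodEFin; last by move: h; rewrite inE.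
  by apply: eq_bigr => i _; rewrite densE.
have -> : (s w \in H) = false by apply/negbTE; move: h; rewrite !notin_setE.
by rewrite mul0r.
Qed.

Lemma transition_le (Psi : SS -> SS -> R) B : bm (fun u : SS * SS => Psi u.1 u.2) ->
  (forall x, mean (prodP (fun _ : 'I_n => dens (q x))) (Psi x) <= B) ->
  mean Pr (fun w => Psi (s w) (s' w)) <= B.
Proof.
move=> bPsi PB; rewrite transition_mean//.
have bF : bm (fun x => mean PN (fun y => Psi x y * \prod_i q x (y i))).
  by apply: (bm_mean2 PN (F := fun x y => Psi x y * \prod_i q x (y i))); exact: bmM.
apply: (@le_trans _ _ (mean Pr (fun=> B))); last by rewrite mean_cst.
apply: le_mean => //; last exact: bm_cst.
apply: eq_bm (bm_comp bF ms) => w; symmetry.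
by apply: mean_samples; exact: (bm_slice1 (F := Psi)).
Qed.

End transition.

(** * Accumulation of the sampling errors *)

Section L2_bounds.
Context (R : realType) d (T : measurableType d) (P : probability T R).
Implicit Types (f g : T -> R).

Definition l2_le f (m : R) := bm f /\ mean P (fun x => f x ^+ 2) <= m ^+ 2.

Lemma bm_sqr f : bm f -> bm (fun x => f x ^+ 2).
Proof.
move=> bf; apply: (@eq_bm _ _ _ (fun x => f x * f x)) => [x|]; first by rewrite expr2.
exact: bmM.
Qed.

Lemma l2_le_mean f m : 0 <= m -> l2_le f m -> `|mean P f| <= m.
Proof.
move=> m0 [bf fm]; rewrite -ler_sqr ?nnegrE// real_normK ?num_real//.
exact: le_trans (mean_sqr_le P bf) fm.
Qed.

Lemma l2_leD_cst f m c : 0 <= m -> 0 <= c -> l2_le f m -> l2_le (fun x => f x + c) (m + c).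
Proof.
move=> m0 c0 lf; have [bf fm] := lf; split; first by apply: bmD => //; exact: bm_cst.
have b2 := bm_sqr bf; have bc := bm_cst T.
rewrite (@eq_mean _ _ _ _ _ (fun x => f x ^+ 2 + 2 * c * f x + c ^+ 2)) => [|x]; last by ring.
have h := l2_le_mean m0 lf.
rewrite meanD//; last by apply: bmD => //; apply: bmM => //; exact: bm_cst.
rewrite meanD//; last by apply: bmM => //; exact: bm_cst.
rewrite meanZl// mean_cst.
have -> : (m + c) ^+ 2 = m ^+ 2 + 2 * c * m + c ^+ 2 by ring.
rewrite lerD2r lerD// ler_wpM2l ?mulr_ge0//.
by rewrite (le_trans (ler_norm _)).
Qed.

Lemma l2_leZ f m c : 0 <= c -> l2_le f m -> l2_le (fun x => c * f x) (c * m).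
Proof.
move=> c0 [bf fm]; split; first by apply: bmM => //; exact: bm_cst.
rewrite (@eq_mean _ _ _ _ _ (fun x => c ^+ 2 * f x ^+ 2)) => [|x]; last by rewrite exprMn.
by rewrite meanZl ?exprMn ?ler_wpM2l ?sqr_ge0//; exact: bm_sqr.
Qed.

(** Triangle inequality through [2 a b <= (m' / m) a^2 + (m / m') b^2]; with these weights the two
    bounds add up exactly to [(m + m') ^+ 2]. *)
Lemma l2_leD f g m m' : 0 < m -> 0 < m' -> l2_le f m -> l2_le g m' ->
  l2_le (fun x => f x + g x) (m + m').
Proof.
move=> m0 m'0 [bf fm] [bg gm]; split; first exact: bmD.
have bf2 := bm_sqr bf; have bg2 := bm_sqr bg.
apply: (@le_trans _ _ (mean P (fun x => (1 + m' / m) * f x ^+ 2 + (1 + m / m') * g x ^+ 2))).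
  apply: le_mean; first exact/bm_sqr/bmD.
    by apply: bmD; apply: bmM => //; exact: bm_cst.
  move=> x; rewrite -subr_ge0.
  have -> : (1 + m' / m) * f x ^+ 2 + (1 + m / m') * g x ^+ 2 - (f x + g x) ^+ 2 =
      (m' * f x - m * g x) ^+ 2 / (m * m').
    by field; rewrite !gt_eqF.
  by rewrite divr_ge0 ?sqr_ge0// mulr_ge0// ltW.
rewrite meanD; try by apply: bmM => //; exact: bm_cst.
rewrite !meanZl//.
have -> : (m + m') ^+ 2 = (1 + m' / m) * m ^+ 2 + (1 + m / m') * m' ^+ 2.
  by field; rewrite !gt_eqF.
apply: lerD; rewrite ler_wpM2l// addr_ge0// divr_ge0// ltW//.
Qed.

Lemma l2_le_sum (I : finType) (Q : {set I}) (F : I -> T -> R) m :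
  0 < m -> (forall i, i \in Q -> l2_le (F i) m) ->
  l2_le (fun x => \sum_(i in Q) F i x) (#|Q|%:R * m).
Proof.
move=> m0 HF; have -> : (fun x => \sum_(i in Q) F i x) = (fun x => \sum_(i <- enum Q) F i x).
  by apply/funext => x; rewrite big_enum.
rewrite cardE; have {HF}: forall i, i \in enum Q -> l2_le (F i) m.
  by move=> i; rewrite mem_enum; exact: HF.
elim: (enum Q) => [|i s IH] HF.
  have -> : (fun x => \sum_(i <- [::]) F i x) = (fun=> 0).
    by apply/funext => x; rewrite big_nil.
  split; first exact: bm_cst.
  by rewrite mul0r !expr0n/= mean_cst.
have hi : l2_le (F i) m by apply: HF; rewrite inE eqxx.
have hs : l2_le (fun x => \sum_(j <- s) F j x) ((size s)%:R * m).
  by apply: IH => j js; apply: HF; rewrite inE js orbT.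
(* The singleton is the base case, since [l2_leD] asks for positive bounds and the empty sum has
   bound 0. *)
case: s hs {IH HF} => [_|j s hs].
  rewrite mul1r; have -> // : (fun x => \sum_(j <- [:: i]) F j x) = F i.
  by apply/funext => x; rewrite big_seq1.
have -> : (fun x => \sum_(j0 <- [:: i, j & s]) F j0 x) =
    (fun x => F i x + \sum_(j0 <- j :: s) F j0 x).
  by apply/funext => x; rewrite big_cons.
have -> : (size [:: i, j & s])%:R * m = m + (size (j :: s))%:R * m.
  by rewrite /= -[in LHS]natr1; ring.
by apply: l2_leD => //; rewrite mulr_gt0.
Qed.

Lemma le_l2 f m m' : 0 <= m -> m <= m' -> l2_le f m -> l2_le f m'.
Proof.
move=> m0 mm' [bf fm]; split => //; apply: le_trans fm _.
by rewrite ler_sqr ?nnegrE// (le_trans m0).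
Qed.

End L2_bounds.

Lemma bpos_mean2 (R : realType) d1 d2 (T1 : measurableType d1) (T2 : measurableType d2)
  (P2 : probability T2 R) (F : T1 -> T2 -> R) : bpos (fun u : T1 * T2 => F u.1 u.2) ->
  bpos (fun x => mean P2 (F x)).
Proof.
move=> [bF [c c0 cF]]; split; first exact: bm_mean2.
exists c => // x; apply: mean_ge; first exact: (bm_slice1 (F := F)).
by move=> y; exact: (cF (x, y)).
Qed.

Lemma wavg_scale (R : realType) d (T : measurableType d) (P : probability T R) c (k f : T -> R) :
  c != 0 -> bpos k -> bm f -> wavg P (fun x => c * k x) f = wavg P k f.
Proof.
move=> c0 bk bf; have bk' := bpos_bm bk; rewrite /wavg (meanZl P c bk').
have -> : mean P (fun x => f x * (c * k x)) = c * mean P (fun x => f x * k x).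
  rewrite -(meanZl P c (bmM bf bk')); apply: eq_mean => x; exact: mulrCA.
by rewrite invfM mulrACA divff// mul1r.
Qed.

(** * Propagation of the sampling errors along the block filter *)

Section particle_chain.
Context (R : realType) (V : finType) (d : V -> measure_display)
  (T : forall v, measurableType (d v)) (psi : forall v, probability (T v) R).
Local Notation XX := (product_space T).
Local Notation PP := (prodP psi : probability XX R).
Variables (N : V -> {set V}) (Dl : nat) (e lam sig : R).
Variable p : forall v, XX -> T v -> R.
Arguments p : clear implicits.
Hypothesis LM : local_model N Dl e lam sig p.
Local Notation pS := (pS p).
Variable P : {set {set V}}.
Hypothesis partP : finset.partition P [set: V]%SET.
Hypothesis p_int : forall v x, mean (psi v) (p v x) = 1.
Variable gl : nat -> forall v, T v -> R.
Arguments gl : clear implicits.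
Variable kap : R.
Hypothesis kap_gt0 : 0 < kap.
Hypothesis kap_le1 : kap <= 1.
Hypothesis gl_bnd : forall k v (x : T v), kap <= gl k v x <= kap^-1.
Hypothesis gl_meas : forall k v, measurable_fun setT (gl k v).
Variable n : nat.
Hypothesis n_gt0 : (0 < n)%N.
Local Notation SS := (product_space (fun _ : 'I_n => XX)).
Local Notation idx := {ffun {set V} -> 'I_n}.

Variables (Qn : {set V} -> {set {set V}}) (DK M : nat).
Hypothesis Qn_sub : forall K, K \in P -> Qn K \subset P.
Hypothesis Qn_cover : forall K v, K \in P -> v \in K -> N v \subset finset.cover (Qn K).
Hypothesis Qn_self : forall K, K \in P -> K \in Qn K.
Hypothesis Qn_card : forall K, K \in P -> (#|Qn K| <= DK)%N.
Hypothesis K_card : forall K, K \in P -> (#|K| <= M)%N.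

Let gl_bpos k v : bpos (gl k v) := site_bpos kap_gt0 (gl_bnd k) (gl_meas k) v.
Let gS_bp k S : bpos (site_prod (gl k) S : XX -> R) :=
  site_prod_bpos kap_gt0 (gl_bnd k) (gl_meas k) S.
Let i0 : idx := [ffun=> Ordinal n_gt0].
Let e_pos := e_gt0 LM.
Let e_one := e_le1 LM.

(** At time 0 all particles will sit at the initial state, so that the weights [gl 0] cancel and one
    formula serves all times. *)
Definition empP k (X : SS) : probability XX R :=
  dens (wdens (unif R i0 (fun c => glue P c X)) (gS_bp k [set: V]%SET)).

Lemma mean_empP k X f : bm f -> mean (empP k X) f = emp P (gl k) X f.
Proof.
move=> bf; have bg := bpos_bm (gS_bp k [set: V]%SET).
rewrite mean_wdens// /wavg mean_unif; last exact: bmM.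
rewrite mean_unif// invfM mulrACA divff ?mul1r//.
by rewrite invr_eq0 lt0r_neq0// card_idx_gt0.
Qed.

(** [block_step] uses the unnormalised [h] once per block, hence the power [#|P|] of its mass. *)
Lemma block_step_start k h (bh : bpos h) z :
  block_step psi p P gl k h z =
  mean PP h ^+ #|P| * start p P (dens (wdens PP bh)) (gl k) z.
Proof.
rewrite -prodr_const -big_split/=; apply: eq_bigr => K _.
rewrite mulrCA; congr (_ * _); rewrite /pred_dens mean_wdens; last first.
  exact: bpos_bm (pS_bpos1 LM K z).
rewrite mulrC wavgK// qSE; apply: eq_mean => x; exact: mulrC.
Qed.

Lemma wavg_block_step k h (bh : bpos h) f : bm f ->
  wavg PP (block_step psi p P gl k h) f =
  wavg PP (start p P (dens (wdens PP bh)) (gl k)) f.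
Proof.
move=> bf; have -> : block_step psi p P gl k h =
    (fun z => mean PP h ^+ #|P| * start p P (dens (wdens PP bh)) (gl k) z).
  by apply/funext => z; exact: block_step_start.
have bs := start_bpos LM P (dens (wdens PP bh)) kap_gt0 (gl_bnd k) (gl_meas k).
have c0 : mean PP h ^+ #|P| != 0 by rewrite expf_neq0// lt0r_neq0// mean_gt0.
exact: wavg_scale c0 bs bf.
Qed.

Fixpoint steps k (m : nat) h := if m is m'.+1 then
  steps k.+1 m' (block_step psi p P gl k.+1 h) else h.

Lemma block_iter_shift k h m : block_iter psi p P gl k h m.+1 =
  block_iter psi p P gl k.+1 (block_step psi p P gl k h) m.
Proof.
elim: m => [|m IH]; first by rewrite /= addn1.
by rewrite [RHS]/= -IH /= addSnnS.
Qed.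

Lemma steps_iter k m h : steps k m.+1 h = block_iter psi p P gl k.+1 h m.
Proof.
elim: m k h => [//|m IH] k h.
by rewrite block_iter_shift -IH.
Qed.

Definition blk_err (mu mu' : probability XX R) K : R :=
  mean PP (fun z => `|pred_dens p mu K z - pred_dens p mu' K z|).

(** Error of one block step as felt by functions on the neighbours of [K]; [DK * M] is a uniform
    bound on the number of sites in these neighbours. *)
Definition node_err (mu mu' : probability XX R) K : R :=
  2 * (kap * e) ^- (2 * (DK * M)) * \sum_(K' in Qn K) blk_err mu mu' K'.

Lemma card_cover_Qn K : K \in P -> (#|finset.cover (Qn K)| <= DK * M)%N.
Proof.
move=> KP; have QP := Qn_sub KP.
have /eqP <- := finset.trivIsetS QP (partP_triv partP).
apply: (@leq_trans (\sum_(K' in Qn K) M)%N).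
  by apply: leq_sum => K' /(fintype.subsetP QP)/K_card.
by rewrite sum_nat_const leq_mul2r Qn_card// orbT.
Qed.

Let ke_gt0 : 0 < kap * e. Proof. by rewrite mulr_gt0 ?e_pos. Qed.
Let ke_le1 : kap * e <= 1. Proof. by rewrite mulr_ile1// ltW. Qed.

Lemma le_inv_pow (a : R) u u' : 0 < a -> a <= 1 -> (u <= u')%N -> a ^- u <= a ^- u'.
Proof.
move=> a0 a1 uu; rewrite lef_pV2 ?posrE ?exprn_gt0//.
by apply: ler_wiXn2l => //; exact: ltW.
Qed.

Lemma blk_err_ge0 mu mu' K : 0 <= blk_err mu mu' K.
Proof. by apply: mean_ge0 => z. Qed.

Lemma node_errP k mu mu' K f c : K \in P -> bm f -> loc (finset.cover (Qn K)) f ->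
  (forall x, `|f x| <= c) ->
  `|wavg PP (start p P mu (gl k)) f - wavg PP (start p P mu' (gl k)) f| <=
  node_err mu mu' K * c.
Proof.
move=> KP bf lf fc; have c0 : 0 <= c by apply: le_trans (fc point).
apply: le_trans (start_error psi LM partP kap_gt0 (gl_bnd k) (gl_meas k) mu mu' (Qn_sub KP) bf lf fc) _.
rewrite /node_err -/(blk_err _ _ _).
set S := \sum_(K' in Qn K) _; have S0 : 0 <= S by apply: sumr_ge0 => K' _; exact: blk_err_ge0.
have -> : 2 * (kap * e) ^- (2 * (DK * M)) * S * c =
    2 * c * (kap * e) ^- (2 * (DK * M)) * S by ring.
rewrite ler_wpM2r// ler_wpM2l ?mulr_ge0//.
by apply: le_inv_pow => //; rewrite leq_mul2l card_cover_Qn.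
Qed.

Lemma node_err_ge0 mu mu' K : 0 <= node_err mu mu' K.
Proof.
rewrite /node_err mulr_ge0//; last by apply: sumr_ge0 => K' _; exact: blk_err_ge0.
by rewrite mulr_ge0// invr_ge0 exprn_ge0// ltW.
Qed.

Let C : R := (e ^- 2) ^+ M.

Let C_ge1 : 1 <= C.
Proof. by rewrite exprn_ege1// invf_ge1 ?exprn_gt0// exprn_ile1// ltW. Qed.

(* One transition of the block filter is replaced by the same transition started
   from the sampled law, and the remaining steps contract the difference. *)
Lemma step_difference k m mu' (h : XX -> R) (bh : bpos h) (K J : {set V}) f : K \in P -> J \subset K ->
  (0 < #|J|)%N -> bm f -> (forall x, `|f x| <= 1) -> loc J f ->
  `|wavg PP (steps k m (start p P mu' (gl k))) f -
    wavg PP (steps k m (block_step psi p P gl k h)) f| <=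
  2 * C * #|J|%:R * (rho Dl sig ^+ m.-1 *
    tree_err Qn (node_err mu' (dens (wdens PP bh))) m.-1 K).
Proof.
move=> KP JK J0 bf f1 lf; set nu := dens _.
have J1 : 1 <= (#|J|%:R : R) by rewrite ler1n.
have h_err K' c phi : K' \in P -> bm phi -> loc (finset.cover (Qn K')) phi ->
    0 <= c -> (forall x, `|phi x| <= c) ->
    `|wavg PP (start p P mu' (gl k)) phi - wavg PP (block_step psi p P gl k h) phi| <=
    node_err mu' nu K' * c.
  move=> K'P bphi lphi _ phic; rewrite (wavg_block_step k bh bphi).
  exact: node_errP.
(* Without further steps there is no tree: [K] belongs to [Qn K], and the error of a leaf bounds
   that of [f] directly. *)
case: m => [|m].
  have lfQ : loc (finset.cover (Qn K)) f.
    apply: locS lf; apply: fintype.subset_trans JK _; exact: finset.bigcup_sup (Qn_self KP).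
  apply: le_trans (h_err K 1 f KP bf lfQ ler01 f1) _; rewrite /= mulr1 expr0 mul1r.
  rewrite ler_peMl ?node_err_ge0//.
  have : 1 * 1 <= C * #|J|%:R by rewrite ler_pM.
  have -> : 2 * C * #|J|%:R = 2 * (C * #|J|%:R) by ring.
  lra.
rewrite !steps_iter.
have b1 := start_bpos LM P mu' kap_gt0 (gl_bnd k) (gl_meas k).
have b2 : bpos (block_step psi p P gl k h) by exact: (block_step_bpos psi LM P gl_bpos k bh).
have Cge K' : K' \in P -> (e ^- 2) ^+ #|K'| <= C.
  move=> K'P; apply: ler_weXn2l; last exact: K_card.
  by rewrite invf_ge1 ?exprn_gt0// exprn_ile1// ltW.
have S := block_stability LM partP gl_bpos Qn_sub Qn_cover Cge b1 b2 h_err k.+1 m KP JK bf f1 lf.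
apply: le_trans S _.
by rewrite le_eqVlt; apply/orP; left; apply/eqP; ring.
Qed.

Lemma sum_site_bpos k : bpos (fun X : SS => \sum_(c : idx) site_prod (gl k) [set: V]%SET (glue P c X)).
Proof.
have bg c : bpos (fun X : SS => site_prod (gl k) [set: V]%SET (glue P c X)).
  exact: bpos_comp (gS_bp k [set: V]%SET) (measurable_glue P c).
split; first by apply: bm_sum => c _; exact: bpos_bm (bg c).
have [_ [a a0 ha]] := bg i0; exists a => // X; rewrite (bigD1 i0)//=.
rewrite -[leLHS]addr0 lerD//; apply: sumr_ge0 => c _; exact: bpos_ge0 X (bg c).
Qed.

(** Joint measurability in the particles and the parameter is visible on the explicit quotient of
    finite sums. *)
Lemma emp_joint k (F : XX -> XX -> R) : bpos (fun u : XX * XX => F u.1 u.2) ->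
  bpos (fun u : SS * XX => mean (empP k u.1) (fun x => F x u.2)).
Proof.
move=> bF; have bFz z := bpos_bm (bpos_slice2 z bF).
split; last first.
  have [_ [a a0 ha]] := bF; exists a => // u; apply: mean_ge; first exact: bFz.
  by move=> x; exact: (ha (x, u.2)).
apply: (@eq_bm _ _ _ (fun u : SS * XX =>
    (\sum_(c : idx) F (glue P c u.1) u.2 * site_prod (gl k) [set: V]%SET (glue P c u.1)) /
    \sum_(c : idx) site_prod (gl k) [set: V]%SET (glue P c u.1))).
  by move=> u; rewrite mean_empP.
apply: bm_div; last exact: bpos_comp (sum_site_bpos k) measurable_fst.
apply: bm_sum => c _.
have mg : measurable_fun setT (fun u : SS * XX => glue P c u.1).
  by have := measurableT_comp (measurable_glue P c) (@measurable_fst _ _ SS XX).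
apply: bmM; last exact: bm_comp (bpos_bm (gS_bp k [set: V]%SET)) mg.
have mgu : measurable_fun setT (fun u : SS * XX => (glue P c u.1, u.2)).
  by apply/measurable_fun_pairP; split => //; exact: measurable_snd.
exact: (bm_comp (f := fun v : XX * XX => F v.1 v.2) (bpos_bm bF) mgu).
Qed.

Lemma pred_dens_joint k K :
  bpos (fun u : SS * XX => pred_dens p (empP k u.1) K u.2).
Proof. exact: emp_joint (pS_bpos2 LM K). Qed.

Lemma start_joint k k' :
  bpos (fun u : SS * XX => start p P (empP k u.1) (gl k') u.2).
Proof.
apply: bpos_prod => K _; apply: bposM; last exact: pred_dens_joint.
exact: bpos_comp (gS_bp k' K) measurable_snd.
Qed.

(** The law that the particles [X] of time [k] would produce at time [k.+1] without sampling; it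
    differs from [empP k.+1] by the sampling error alone. *)
Definition nuP k (X : SS) : probability XX R :=
  dens (wdens PP (start_bpos LM P (empP k X) kap_gt0 (gl_bnd k.+1) (gl_meas k.+1))).

Lemma pred_dens_nuP k X K z : pred_dens p (nuP k X) K z =
  wavg PP (start p P (empP k X) (gl k.+1)) (fun x => pS K x z).
Proof. by apply: mean_wdens; exact: bpos_bm (pS_bpos1 LM K z). Qed.

Lemma nuP_joint k K : bm (fun u : SS * XX => pred_dens p (nuP k u.1) K u.2).
Proof.
apply: (@eq_bm _ _ _ (fun u : SS * XX =>
    mean PP (fun y => pS K y u.2 * start p P (empP k u.1) (gl k.+1) y) /
    mean PP (start p P (empP k u.1) (gl k.+1)))) => [u|]; first by rewrite pred_dens_nuP.
have bs := start_joint k k.+1.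
apply: bm_div; last first.
  exact: (bpos_comp (bpos_mean2 PP (F := fun X y => start p P (empP k X) (gl k.+1) y) bs) measurable_fst).
apply: (bm_mean2 PP (F := fun (u : SS * XX) y => pS K y u.2 * start p P (empP k u.1) (gl k.+1) y)).
have m1 : measurable_fun setT (fun u : (SS * XX) * XX => (u.2, u.1.2)).
  apply/measurable_fun_pairP; split; first exact: measurable_snd.
  by have := measurableT_comp (@measurable_snd _ _ SS XX) (@measurable_fst _ _ (SS * XX)%type XX).
have m2 : measurable_fun setT (fun u : (SS * XX) * XX => (u.1.1, u.2)).
  apply/measurable_fun_pairP; split; last exact: measurable_snd.
  by have := measurableT_comp (@measurable_fst _ _ SS XX) (@measurable_fst _ _ (SS * XX)%type XX).
apply: bmM.
  exact: (bm_comp (f := fun v : XX * XX => pS K v.1 v.2) (bpos_bm (pS_bpos2 LM K)) m1).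
exact: (bm_comp (f := fun v : SS * XX => start p P (empP k v.1) (gl k.+1) v.2) (bpos_bm bs) m2).
Qed.

Let D k K (x y : SS) z := pred_dens p (empP k.+1 y) K z - pred_dens p (nuP k x) K z.

Let D_joint k K : bm (fun u : (SS * SS) * XX => D k K u.1.1 u.1.2 u.2).
Proof.
have m1 : measurable_fun setT (fun u : (SS * SS) * XX => (u.1.2, u.2)).
  apply/measurable_fun_pairP; split; last exact: measurable_snd.
  by have := measurableT_comp (@measurable_snd _ _ SS SS) (@measurable_fst _ _ (SS * SS)%type XX).
have m2 : measurable_fun setT (fun u : (SS * SS) * XX => (u.1.1, u.2)).
  apply/measurable_fun_pairP; split; last exact: measurable_snd.
  by have := measurableT_comp (@measurable_fst _ _ SS SS) (@measurable_fst _ _ (SS * SS)%type XX).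
apply: bmB.
  exact: (bm_comp (f := fun v : SS * XX => pred_dens p (empP k.+1 v.1) K v.2)
    (bpos_bm (pred_dens_joint k.+1 K)) m1).
exact: (bm_comp (f := fun v : SS * XX => pred_dens p (nuP k v.1) K v.2) (nuP_joint k K) m2).
Qed.

Context dO (Omega : measurableType dO) (Pr : probability Omega R).
Variable s : nat -> Omega -> SS.
Hypothesis ms : forall k, measurable_fun setT (s k).
Hypothesis law : forall k (H : set SS) (A : 'I_n -> set XX), measurable H ->
  (forall i, measurable (A i)) ->
  Pr (s k @^-1` H `&` [set w | forall i, A i (s k.+1 w i)]) =
  (\int[Pr]_(w in s k @^-1` H) \prod_(i < n) dens (pred_law LM p_int (empP k (s k w))) (A i))%E.

Let q_joint k : bm (fun u : SS * XX => pred_law LM p_int (empP k u.1) u.2).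
Proof. exact: bpos_bm (pred_dens_joint k [set: V]%SET). Qed.

Let n0 : 0 < (n%:R : R). Proof. by rewrite ltr0n. Qed.

(** The square of 7 exceeds the constant 48 of [sampling_error]. *)
Definition sample_err : R := 7 * kap ^- (2 * M) / Num.sqrt n%:R.

Definition blk_bound : R :=
  7 * DK%:R * kap ^- (2 * (DK * M)) * e ^- M / Num.sqrt n%:R.

(** By Jensen's inequality and Fubini it suffices to bound the mean square for fixed [z]; then
    [pS K y z] is a local test function of [y], bounded by [e ^- M]. *)
Lemma blk_err_l2 k K : K \in P ->
  l2_le Pr (fun w => blk_err (empP k.+1 (s k.+1 w)) (nuP k (s k w)) K) blk_bound.
Proof.
move=> KP; have mss : measurable_fun setT (fun w => (s k w, s k.+1 w)).
  by apply/measurable_fun_pairP; split; exact: ms.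
have bDw : bm (fun u : Omega * XX => D k K (s k u.1) (s k.+1 u.1) u.2).
  have m1 : measurable_fun setT (fun u : Omega * XX => ((s k u.1, s k.+1 u.1), u.2)).
    apply/measurable_fun_pairP; split; last exact: measurable_snd.
    by have := measurableT_comp mss (@measurable_fst _ _ Omega XX).
  exact: (bm_comp (f := fun v : (SS * SS) * XX => D k K v.1.1 v.1.2 v.2) (D_joint k K) m1).
split.
  exact: (bm_mean2 PP (F := fun w z => `|D k K (s k w) (s k.+1 w) z|) (bm_abs bDw)).
have bD2 := bm_sqr bDw.
apply: (@le_trans _ _ (mean Pr (fun w => mean PP (fun z => D k K (s k w) (s k.+1 w) z ^+ 2)))).
  apply: le_mean.
  - exact/bm_sqr/(bm_mean2 PP (F := fun w z => `|D k K (s k w) (s k.+1 w) z|) (bm_abs bDw)).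
  - exact: (bm_mean2 PP (F := fun w z => D k K (s k w) (s k.+1 w) z ^+ 2) bD2).
  move=> w; have bz : bm (fun z => `|D k K (s k w) (s k.+1 w) z|).
    exact: (bm_slice1 (F := fun w z => `|D k K (s k w) (s k.+1 w) z|) w (bm_abs bDw)).
  apply: le_trans (mean_sqr_le PP bz) _; rewrite le_eqVlt; apply/orP; left; apply/eqP.
  by apply: eq_mean => z; rewrite real_normK ?num_real.
rewrite (mean_fubini Pr PP (F := fun w z => D k K (s k w) (s k.+1 w) z ^+ 2) bD2).
apply: mean_le; first exact: (bm_mean1 Pr (F := fun w z => D k K (s k w) (s k.+1 w) z ^+ 2) bD2).
move=> z; have m1 : measurable_fun setT (fun u : SS * SS => (u, z)).
  exact: (measurable_pair2 z).
have bPsi : bm (fun u : SS * SS => D k K u.1 u.2 z ^+ 2).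
  apply: bm_sqr.
  exact: (bm_comp (f := fun v : (SS * SS) * XX => D k K v.1.1 v.1.2 v.2) (D_joint k K) m1).
apply: (transition_le (q_joint k) (ms k) (ms k.+1) (@law k) (Psi := fun x y => D k K x y z ^+ 2) bPsi) => x.
have bf : bm (fun y => pS K y z) := bpos_bm (pS_bpos1 LM K z).
have lf : loc (finset.cover (Qn K)) (fun y => pS K y z) := loc_pS LM Qn_cover z KP.
have fb y : `|pS K y z| <= e ^- M.
  have /andP[h1 h2] := pS_bounds LM K y z.
  have p0 : 0 <= pS K y z by apply: le_trans h1; rewrite exprn_ge0// ltW.
  rewrite (ger0_norm p0); apply: le_trans h2 _.
  by rewrite exprVn; apply: le_inv_pow => //; exact: K_card.
have := sampling_error LM partP p_int (empP k x) n_gt0 kap_gt0 (gl_bnd k.+1) (gl_meas k.+1)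
  (Qn_sub KP) bf lf fb.
set B := 48 * _ * _ * _ / _ => h.
apply: (@le_trans _ _ B).
  apply: le_trans h; rewrite le_eqVlt; apply/orP; left; apply/eqP.
  apply: eq_mean => y; congr (_ ^+ 2); rewrite /D pred_dens_nuP; congr (_ - _).
  exact: mean_empP.
have -> : blk_bound ^+ 2 = 49 * DK%:R ^+ 2 * kap ^- (4 * (DK * M)) * (e ^- M) ^+ 2 / n%:R.
  rewrite /blk_bound !exprMn !exprVn sqr_sqrtr ?ltW// -!exprM.
  have -> : (2 * (DK * M) * 2 = 4 * (DK * M))%N by rewrite mulnC mulnA.
  have -> : (7 : R) ^+ 2 = 49 by ring.
  by [].
apply: ler_wpM2r; first by rewrite invr_ge0 ltW.
apply: ler_wpM2r; first exact: sqr_ge0.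
apply: ler_pM.
- by rewrite mulr_ge0// sqr_ge0.
- by rewrite invr_ge0 exprn_ge0// ltW.
- apply: ler_pM; [by []|exact: sqr_ge0|lra|].
  by rewrite ler_sqr ?nnegrE// ler_nat Qn_card.
- by apply: le_inv_pow => //; rewrite leq_mul2l card_cover_Qn.
Qed.

Lemma sample_l2 k K f : K \in P -> bm f -> (forall x, `|f x| <= 1) -> loc K f ->
  l2_le Pr (fun w => emp P (gl k.+1) (s k.+1 w) f -
    wavg PP (start p P (empP k (s k w)) (gl k.+1)) f) sample_err.
Proof.
move=> KP bf f1 lf.
have bpf2 : bpos (fun u : XX * XX => f u.1 + 2).
  split; first by apply: bmD; [exact: bm_comp bf measurable_fst|exact: bm_cst].
  by exists 1 => // u; have := f1 u.1; rewrite ler_norml => /andP[h _]; lra.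
have b1 : bm (fun X : SS => emp P (gl k.+1) X f).
  have m1 : measurable_fun setT (fun X : SS => (X, point : XX)) by exact: measurable_pair2.
  have := bpos_bm (bpos_comp (emp_joint k.+1 (F := fun x _ => f x + 2) bpf2) m1).
  move=> /bmB/(_ (bm_cst _ 2)); apply: eq_bm => X /=.
  by rewrite meanD// ?mean_cst ?mean_empP//; [ring|exact: bm_cst].
have b2 : bm (fun X : SS => wavg PP (start p P (empP k X) (gl k.+1)) f).
  have bs := start_joint k k.+1.
  apply: bm_div; last exact: (bpos_mean2 PP (F := fun X y => start p P (empP k X) (gl k.+1) y) bs).
  apply: (bm_mean2 PP (F := fun X y => f y * start p P (empP k X) (gl k.+1) y)).
  by apply: bmM; [exact: bm_comp bf measurable_snd|exact: bpos_bm bs].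
have bPsi : bm (fun u : SS * SS => emp P (gl k.+1) u.2 f -
    wavg PP (start p P (empP k u.1) (gl k.+1)) f).
  by apply: bmB; [exact: bm_comp b1 measurable_snd|exact: bm_comp b2 measurable_fst].
split.
  have mss : measurable_fun setT (fun w => (s k w, s k.+1 w)).
    by apply/measurable_fun_pairP; split; exact: ms.
  exact: (bm_comp bPsi mss).
apply: (transition_le (q_joint k) (ms k) (ms k.+1) (@law k) (Psi := fun x y =>
  (emp P (gl k.+1) y f - wavg PP (start p P (empP k x) (gl k.+1)) f) ^+ 2) (bm_sqr bPsi)) => x.
have K1 : [set K]%SET \subset P by rewrite finset.sub1set.
have c1 : finset.cover [set K]%SET = K by rewrite /finset.cover finset.big_set1.
have lf1 : loc (finset.cover [set K]%SET) f by rewrite c1.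
have := sampling_error LM partP p_int (empP k x) n_gt0 kap_gt0 (gl_bnd k.+1) (gl_meas k.+1)
  K1 bf lf1 f1.
rewrite cards1 c1 => h; apply: le_trans h _.
have -> : sample_err ^+ 2 = 49 * kap ^- (4 * M) / n%:R.
  rewrite /sample_err !exprMn !exprVn sqr_sqrtr ?ltW// -!exprM.
  have -> : (2 * M * 2 = 4 * M)%N by rewrite mulnC mulnA.
  by have -> : (7 : R) ^+ 2 = 49 by ring.
rewrite !expr1n !mulr1; apply: ler_wpM2r; first by rewrite invr_ge0 ltW.
apply: ler_pM; [by []|by rewrite invr_ge0 exprn_ge0// ltW|lra|].
by apply: le_inv_pow => //; rewrite leq_mul2l K_card.
Qed.

Definition node_bound : R :=
  2 * (kap * e) ^- (2 * (DK * M)) * (DK%:R * blk_bound).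

Let DK_gt0 K : K \in P -> 0 < (DK%:R : R).
Proof.
move=> KP; rewrite ltr0n (leq_trans _ (Qn_card KP))//.
by apply/card_gt0P; exists K; exact: Qn_self.
Qed.

Let blk_bound_gt0 K : K \in P -> 0 < blk_bound.
Proof.
move=> KP; rewrite /blk_bound !mulr_gt0 ?invr_gt0 ?exprn_gt0 ?sqrtr_gt0//.
exact: DK_gt0 KP.
Qed.

Let node_bound_gt0 K : K \in P -> 0 < node_bound.
Proof.
move=> KP; apply: mulr_gt0; first by rewrite mulr_gt0// invr_gt0 exprn_gt0// ke_gt0.
by apply: mulr_gt0; [exact: DK_gt0 KP|exact: blk_bound_gt0 KP].
Qed.

(** The triangle inequality over at most [DK ^+ m] leaves, whose errors may be correlated. *)
Lemma tree_err_l2 k m K : K \in P ->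
  l2_le Pr (fun w => tree_err Qn (node_err (empP k.+1 (s k.+1 w)) (nuP k (s k w))) m K)
    (DK%:R ^+ m * node_bound).
Proof.
elim: m K => [|m IH] K KP /=.
  rewrite expr0 mul1r; apply: l2_leZ; first by rewrite mulr_ge0// invr_ge0 exprn_ge0// ltW.
  apply: (@le_l2 _ _ _ _ _ (#|Qn K|%:R * blk_bound)).
  - by rewrite mulr_ge0// ltW// (blk_bound_gt0 KP).
  - by rewrite ler_wpM2r ?ler_nat ?Qn_card// ltW// (blk_bound_gt0 KP).
  apply: l2_le_sum => [|K' K'Q]; first exact: blk_bound_gt0 KP.
  by apply: blk_err_l2; exact: (fintype.subsetP (Qn_sub KP)).
have m0 : 0 < DK%:R ^+ m * node_bound.
  by rewrite mulr_gt0 ?exprn_gt0 ?(DK_gt0 KP)// (node_bound_gt0 KP).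
apply: (@le_l2 _ _ _ _ _ (#|Qn K|%:R * (DK%:R ^+ m * node_bound))).
- by rewrite mulr_ge0// ltW.
- by rewrite exprS -mulrA; apply: ler_wpM2r; [exact: ltW|rewrite ler_nat Qn_card].
apply: l2_le_sum => // K' K'Q; apply: IH; exact: (fintype.subsetP (Qn_sub KP)).
Qed.

Variable x0 : XX.
Hypothesis s0 : forall w i, s 0%N w i = x0.
Hypothesis rho_small : rho Dl sig * DK%:R <= 2^-1.
Variable om : {set V} -> V -> R.
Hypothesis om_slow : forall K, K \in P -> slow N (om K).
Hypothesis om_le1 : forall K v, om K v <= 1.
Hypothesis om_out : forall K v, K \in P -> v \notin K -> om K v = 1.
Hypothesis om_bdry : forall K v, K \in P -> v \in K -> ~~ (N v \subset K) -> om K v = 1.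

Lemma steps_iteri k m h :
  steps k m h = iteri m (fun j => block_step psi p P gl (k + j).+1) h.
Proof.
have stepsS : forall m k h, steps k m.+1 h = block_step psi p P gl (k + m).+1 (steps k m h).
  elim=> [|m' IH] k' h'; first by rewrite /= addn0.
  by rewrite -addSnnS -IH.
by elim: m => [//|m IH]; rewrite stepsS IH.
Qed.

(** From a deterministic state the predicted sites are already independent, so that the first step
    suffers no blocking error. *)
Lemma start_x0 w : start p P (empP 0 (s 0%N w)) (gl 1) = first_density p gl x0.
Proof.
apply/funext => z; rewrite /first_density (gS_blocks partP).
transitivity (\prod_(K in P) (site_prod (gl 1) K z * pS K x0 z)); last first.
  rewrite big_split/=; congr (_ * _).
  transitivity (\prod_(v in [set: V]%SET) p v x0 (z v)) => //.
  by rewrite (set_partition_big _ partP).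
apply: eq_bigr => K _; congr (_ * _).
have gx c : glue P c (s 0%N w) = x0.
  by apply: functional_extensionality_dep => v; rewrite /glue s0.
rewrite /pred_dens mean_empP; last exact: bpos_bm (pS_bpos1 LM K z).
rewrite /emp; set a := site_prod (gl 0%N) [set: V]%SET x0.
have a0 : 0 < a := bpos_gt0 x0 (gS_bp 0 [set: V]%SET).
rewrite (eq_bigr (fun=> pS K x0 z * a)) => [|c _]; last by rewrite gx.
rewrite [X in _ / X](eq_bigr (fun=> a)) => [|c _]; last by rewrite gx.
rewrite !sumr_const -[X in X / _]mulr_natl -[X in _ / X]mulr_natl mulrCA mulfK//.
by rewrite lt0r_neq0// mulr_gt0// card_idx_gt0.
Qed.

(** The exponent [i.-1] makes the first two terms 1: errors followed by no further step, or by a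
    single one, enter without contraction. *)
Lemma half_sum m : \sum_(i < m) (2^-1 : R) ^+ i.-1 <= 3.
Proof.
case: m => [|m]; first by rewrite big_ord0.
suff : \sum_(i < m.+1) (2^-1 : R) ^+ i.-1 + 2 * 2^-1 ^+ m = 3.
  have : 0 <= (2^-1 : R) ^+ m by rewrite exprn_ge0// invr_ge0.
  lra.
elim: m => [|m IH]; first by rewrite big_ord1/= !expr0; ring.
rewrite big_ord_recr/= exprS; move: IH; set S := \sum_(i < _) _; set t := 2^-1 ^+ m.
lra.
Qed.

(** [6 = 2 * 3]: the factor of [step_difference] times the bound of [half_sum]. *)
Definition noise_bound (j : nat) : R := sample_err + 6 * C * j%:R * node_bound.

Lemma main_estimate m K (J : {set V}) f : K \in P -> J \subset K -> (0 < #|J|)%N ->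
  bm f -> (forall x, `|f x| <= 1) -> loc J f ->
  mean Pr (fun w => (wavg PP (full_density psi p gl x0 m) f -
    emp P (gl m.+1) (s m.+1 w) f) ^+ 2) <=
  (\sum_(v in J) om K v + noise_bound #|J|) ^+ 2.
Proof.
move=> KP JK J0 bf f1 lf; have lfK := locS JK lf.
set b0 := \sum_(v in J) om K v.
have b0_ge0 : 0 <= b0 by apply: sumr_ge0 => v _; have [] := om_slow KP.
have j0 : 0 < (#|J|%:R : R) by rewrite ltr0n.
have C0 : 0 < C by exact: lt_le_trans C_ge1.
have nb0 := node_bound_gt0 KP.
have se0 : 0 < sample_err.
  by rewrite /sample_err !mulr_gt0 ?invr_gt0 ?exprn_gt0 ?sqrtr_gt0.
(* Sampling up to time [k], then block steps without sampling: [A 0] is the block filter at time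
   [m.+1], and [A m] lacks only the last sampling, whose error is [S]. *)
pose A k w := wavg PP (steps k.+1 (m - k) (start p P (empP k (s k w)) (gl k.+1))) f.
pose te k := fun w => tree_err Qn (node_err (empP k.+1 (s k.+1 w)) (nuP k (s k w))) (m - k.+1).-1 K.
pose ck k := 2 * C * #|J|%:R * rho Dl sig ^+ (m - k.+1).-1.
have rho0 : 0 <= rho Dl sig := rho_ge0 LM.
have C0' : 0 <= C by exact: ltW.
have ck0 k : 0 <= ck k by rewrite /ck !mulr_ge0// exprn_ge0.
have step k w : (k < m)%N -> `|A k w - A k.+1 w| <= ck k * te k w.
  move=> km; rewrite /A distrC /ck -mulrA.
  have -> : (m - k = (m - k.+1).+1)%N by rewrite subnSK.
  exact: step_difference.
have A0E w : A 0%N w = wavg PP (block_density psi p P gl x0 m) f.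
  by rewrite /A subn0 start_x0 steps_iteri.
have bias w : `|wavg PP (full_density psi p gl x0 m) f - A 0%N w| <= b0.
  rewrite A0E.
  have h := block_bias psi LM partP gl_bpos x0 om_slow om_le1 om_out om_bdry m KP JK bf f1 lf.
  exact: h.
pose S w := emp P (gl m.+1) (s m.+1 w) f - wavg PP (start p P (empP m (s m w)) (gl m.+1)) f.
have lS : l2_le Pr S sample_err by exact: sample_l2 KP bf f1 lfK.
have AmE w : A m w = emp P (gl m.+1) (s m.+1 w) f - S w.
  by rewrite /A subnn /S subKr.
(* Contraction [rho] against branching [DK]: together at most 1/2 per level. *)
pose mk k := 2 * C * #|J|%:R * node_bound * (2^-1) ^+ (m - k.+1).-1.
have half0 : 0 < (2^-1 : R) by rewrite invr_gt0.
have bc0 : 0 < 2 * C * #|J|%:R * node_bound.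
  by apply: mulr_gt0 nb0; apply: mulr_gt0 j0; exact: mulr_gt0.
have mk0 k : 0 < mk k by apply: mulr_gt0 bc0 _; exact: exprn_gt0 half0.
have lte k : l2_le Pr (fun w => ck k * te k w) (mk k).
  have := l2_leZ (ck0 k) (tree_err_l2 k (m - k.+1).-1 KP).
  apply: le_l2; first by rewrite mulr_ge0// mulr_ge0 ?exprn_ge0// ltW.
  rewrite /ck /mk; set i := (m - k.+1).-1.
  have -> : 2 * C * #|J|%:R * rho Dl sig ^+ i * (DK%:R ^+ i * node_bound) =
    2 * C * #|J|%:R * node_bound * (rho Dl sig * DK%:R) ^+ i.
    rewrite [in RHS]exprMn; set u := _ ^+ i; set v := DK%:R ^+ i; ring.
  apply: ler_wpM2l; first exact: ltW bc0.
  by apply: lerXn2r; rewrite ?nnegrE ?invr_ge0// mulr_ge0.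
have lsum i : (i <= m)%N -> l2_le Pr (fun w => `|S w| + \sum_(k < i) ck k * te k w)
    (sample_err + \sum_(k < i) mk k).
  elim: i => [_|i IH im].
    have -> : (fun w => `|S w| + \sum_(k < 0) ck k * te k w) = (fun w => `|S w|).
      by apply/funext => w; rewrite big_ord0 addr0.
    rewrite big_ord0 addr0; have [bS lS2] := lS; split; first exact: bm_abs.
    by rewrite (@eq_mean _ _ _ _ _ (fun w => S w ^+ 2)) => [//|w]; rewrite real_normK ?num_real.
  have -> : (fun w => `|S w| + \sum_(k < i.+1) ck k * te k w) =
      (fun w => `|S w| + \sum_(k < i) ck k * te k w + ck i * te i w).
    by apply/funext => w; rewrite big_ord_recr/= addrA.
  rewrite big_ord_recr/= addrA; apply: l2_leD => //; last exact/IH/ltnW.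
  by apply: ltr_pwDl => //; apply: sumr_ge0 => k _; exact: ltW.
have tot0 : 0 <= sample_err + \sum_(k < m) mk k.
  by apply: addr_ge0; [exact: ltW|apply: sumr_ge0 => k _; exact: ltW].
have [bt lt] := l2_leD_cst tot0 b0_ge0 (lsum m (leqnn m)).
have totE : sample_err + \sum_(k < m) mk k <= noise_bound #|J|.
  rewrite lerD2l -mulr_sumr (reindex_inj rev_ord_inj)/=.
  have -> : \sum_(k < m) (2^-1 : R) ^+ (m - (m - k.+1).+1).-1 = \sum_(k < m) (2^-1) ^+ k.-1.
    by apply: eq_bigr => k _; rewrite subnSK// subKn// ltnW.
  have -> : 6 * C * #|J|%:R * node_bound = 2 * C * #|J|%:R * node_bound * 3 by ring.
  by apply: ler_wpM2l; [exact: ltW bc0|exact: half_sum].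
have tele w i : (i <= m)%N -> `|A 0%N w - A i w| <= \sum_(k < i) ck k * te k w.
  elim: i => [_|i IH im]; first by rewrite subrr normr0 big_ord0.
  rewrite big_ord_recr/=; apply: le_trans (ler_distD (A i w) _ _) _.
  by apply: lerD; [exact/IH/ltnW|exact: step].
have point w : `|wavg PP (full_density psi p gl x0 m) f - emp P (gl m.+1) (s m.+1 w) f| <=
    `|S w| + \sum_(k < m) ck k * te k w + b0.
  have -> : wavg PP (full_density psi p gl x0 m) f - emp P (gl m.+1) (s m.+1 w) f =
    (wavg PP (full_density psi p gl x0 m) f - A 0%N w) + (A 0%N w - A m w) - S w.
    by rewrite AmE; ring.
  have h1 := ler_normB ((wavg PP (full_density psi p gl x0 m) f - A 0%N w) + (A 0%N w - A m w)) (S w).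
  have h2 := ler_normD (wavg PP (full_density psi p gl x0 m) f - A 0%N w) (A 0%N w - A m w).
  apply: le_trans h1 _; rewrite -[leRHS]addrA [leRHS]addrC; apply: lerD => //.
  apply: le_trans h2 _; rewrite [leRHS]addrC; apply: lerD; first exact: bias.
  exact: tele w m (leqnn m).
have bE : bm (fun w => emp P (gl m.+1) (s m.+1 w) f).
  split; last first.
    exists 1 => w; rewrite -mean_empP//; exact: mean_norm_le.
  have m1 : measurable_fun setT (fun X : SS => emp P (gl m.+1) X f).
    apply: bm_meas; apply: bm_div; last exact: sum_site_bpos.
    apply: bm_sum => c _; apply: bmM.
      exact: bm_comp bf (measurable_glue P c).
    exact: bm_comp (bpos_bm (gS_bp _ _)) (measurable_glue P c).
  exact: measurableT_comp m1 (ms _).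
apply: (@le_trans _ _ (mean Pr (fun w => (`|S w| + \sum_(k < m) ck k * te k w + b0) ^+ 2))).
  apply: le_mean.
  - by apply/bm_sqr/bmB => //; exact: bm_cst.
  - exact: bm_sqr.
  move=> w; rewrite -(real_normK (num_real (_ - _))) ler_sqr ?nnegrE//.
  exact: le_trans (normr_ge0 _) (point w).
apply: le_trans lt _; rewrite ler_sqr ?nnegrE; last 2 first.
- exact: addr_ge0.
- by rewrite addr_ge0// (le_trans tot0).
by rewrite addrC lerD2l.
Qed.

End particle_chain.

(** * Laws of the filters *)

Section raw_laws.
Context (R : realType) d (T : measurableType d).
Implicit Types (rho : set T -> \bar R) (m : probability T R).

(* The filters are set functions that are only controlled on measurable sets. *)
Definition has_law rho m := forall A, measurable A -> rho A = m A.

Lemma integral_has_law rho m D f : has_law rho m -> measurable D -> bm f ->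
  (\int[rho]_(x in D) (f x)%:E)%E = (mean m (fun x => \1_D x * f x))%:E.
Proof.
move=> rm mD bf; rewrite (raw_integral D (fun x => (f x)%:E) rm).
rewrite EFin_mean; last by apply: bmM => //; exact: bm_indic.
rewrite integral_mkcond; apply: eq_integral => x _.
by rewrite patchE indicE; case: ifP => _; rewrite ?mul1r ?mul0r.
Qed.

Lemma integral_has_lawT rho m f : has_law rho m -> bm f ->
  (\int[rho]_x (f x)%:E)%E = (mean m f)%:E.
Proof.
move=> rm bf; rewrite (integral_has_law rm measurableT bf); congr _%:E.
by apply: eq_mean => x; rewrite indicE mem_set// mul1r.
Qed.

Lemma eq_has_law rho m m' : has_law rho m ->
  (forall f, bm f -> mean m f = mean m' f) -> has_law rho m'.
Proof.
by move=> rm mm' A mA; rewrite rm// -!mean_indic// mm'//; exact: bm_indic.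
Qed.

End raw_laws.

Section filter_laws.
Context (R : realType) (V : finType) (d : V -> measure_display)
  (T : forall v, measurableType (d v)).
Local Notation XX := (product_space T).

Lemma has_law_correct (l : XX -> R) (bl : bpos l) rho m : has_law rho m ->
  has_law (correct l rho) (dens (wdens m bl)).
Proof.
move=> rm A mA; rewrite [RHS]densE// /correct.
rewrite (integral_has_law rm mA (bpos_bm bl)) (integral_has_lawT rm (bpos_bm bl)).
have m0 := mean_gt0 m bl.
rewrite inver gt_eqF// -EFinM; congr _%:E.
rewrite -meanZr; last by apply: bmM; [exact: bm_indic|exact: bpos_bm].
by apply: eq_mean => x; rewrite mulrA.
Qed.

Variables (psi0 : forall v, {measure set (T v) -> \bar R})
  (psi : forall v, probability (T v) R) (c : V -> R).
Hypothesis c_gt0 : forall v, 0 < c v.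
Hypothesis psi0E : forall v (f : T v -> \bar R), measurable_fun setT f ->
  (forall z, (0 <= f z)%E) ->
  (\int[psi0 v]_z f z = (c v)%:E * \int[psi v]_z f z)%E.
Local Notation PP := (prodP psi : probability XX R).

Let C := \prod_v c v.

Let C_gt0 : 0 < C. Proof. by apply: prodr_gt0 => v _. Qed.

(** Each of the successive integrations contributes its own factor [c v]. *)
Lemma product_measure_scale A : measurable A ->
  product_measure psi0 A = (C%:E * PP A)%E.
Proof.
move=> mA; rewrite /product_measure.
set F : XX -> \bar R := fun x => (\1_A x)%:E.
have mF : measurable_fun setT F by apply/measurable_EFinP/measurable_indic.
have F0 x : (0 <= F x)%E by rewrite lee_fin.
have E s x : (iterated_integral psi0 s F x =
    (\prod_(v <- s) c v)%:E * iterated_integral (fun v => psi v) s F x)%E.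
  elim: s x => [|v s IH] x /=; first by rewrite big_nil mul1e.
  have [mh h0] := iterated_integral_nneg psi s mF F0.
  have mhx : measurable_fun setT (fun z : T v =>
      iterated_integral (fun v => psi v) s F (dfwith x v z)).
    by have := measurableT_comp mh (@measurable_dfwith1 _ _ _ v x).
  have p0 : 0 <= \prod_(v <- s) c v by apply: prodr_ge0 => u _; exact: ltW.
  under eq_integral do rewrite IH.
  rewrite ge0_integralZl//.
  rewrite psi0E// big_cons EFinM muleA; congr (_ * _)%E.
  by rewrite -!EFinM mulrC.
rewrite E; congr (_ * _)%E.
by congr _%:E; rewrite big_enum.
Qed.

Variable p0 : forall v, XX -> T v -> R.
Variables (N : V -> {set V}) (Dl : nat) (e lam sig : R).
Variable p : forall v, XX -> T v -> R.
Arguments p : clear implicits.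
Arguments p0 : clear implicits.
Hypothesis LM : local_model N Dl e lam sig p.
Hypothesis pE : forall v x z, p v x z = c v * p0 v x z.
Hypothesis p_int : forall v x, mean (psi v) (p v x) = 1.
Local Notation pS := (pS p).

Let kernelE x z : joint_kernel p0 x z = C^-1 * pS [set: V]%SET x z.
Proof.
transitivity (C^-1 * \prod_v p v x (z v)); last first.
  by congr (_ * _); apply: eq_bigl => v; rewrite inE.
rewrite (eq_bigr (fun v => c v * p0 v x (z v))) => [|v _]; last exact: pE.
by rewrite big_split/= mulrA mulVf ?mul1r// gt_eqF.
Qed.

(** The factors [c v] put into the transition densities are those taken out of the reference
    measures. *)
Let int_kernel x A : measurable A ->
  (\int[product_measure psi0]_(z in A) (joint_kernel p0 x z)%:E)%E =
  (mean PP (fun z => \1_A z * pS [set: V]%SET x z))%:E.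
Proof.
move=> mA; have bp := pS_bpos_target LM [set: V]%SET x.
have C0 : (0 <= C)%R by exact: ltW.
pose m : {measure set XX -> \bar R} := mscale (NngNum C0) PP.
rewrite (raw_integral (m := m)); last exact: product_measure_scale.
have bk : bm (joint_kernel p0 x).
  apply: (@eq_bm _ _ _ (fun z => C^-1 * pS [set: V]%SET x z)) => [z|]; first by rewrite kernelE.
  by apply: bmM; [exact: bm_cst|exact: bpos_bm].
rewrite ge0_integral_mscale//; last 2 first.
- apply/measurable_EFinP; apply: measurable_funTS; exact: bm_meas bk.
- by move=> z _; rewrite lee_fin kernelE mulr_ge0 ?invr_ge0// (bpos_ge0 z bp).
rewrite (@integral_has_law _ _ _ PP PP A (joint_kernel p0 x))//.
rewrite -EFinM; congr _%:E => /=.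
rewrite -meanZl; last by apply: bmM => //; exact: bm_indic.
apply: eq_mean => z; rewrite kernelE mulrCA (mulrA C) divff ?mul1r//.
exact: lt0r_neq0.
Qed.

Lemma has_law_predict rho m : has_law rho m ->
  has_law (predict (product_measure psi0) (joint_kernel p0) rho)
    (dens (pred_law LM p_int m)).
Proof.
move=> rm A mA; rewrite [RHS]densE// /predict.
have -> : (fun x => \int[product_measure psi0]_(z in A) (joint_kernel p0 x z)%:E)%E =
    (fun x => (mean PP (fun z => \1_A z * pS [set: V]%SET x z))%:E).
  by apply/funext => x; exact: int_kernel.
have b2 : bm (fun u : XX * XX => \1_A u.2 * pS [set: V]%SET u.1 u.2).
  apply: bmM; first exact: bm_comp (bm_indic R mA) measurable_snd.
  exact: bpos_bm (pS_bpos2 LM _).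
rewrite (integral_has_lawT rm (bm_mean2 PP (F := fun x z => \1_A z * pS [set: V]%SET x z) b2)).
congr _%:E; rewrite (mean_fubini m PP (F := fun x z => \1_A z * pS [set: V]%SET x z) b2).
apply: eq_mean => z; rewrite -meanZl//; exact: bpos_bm (pS_bpos1 LM _ z).
Qed.

Variable gl : nat -> forall v, T v -> R.
Arguments gl : clear implicits.
Hypothesis gl_bpos : forall k v, bpos (gl k v).
Variable l : nat -> XX -> R.
Hypothesis lE : forall k, l k = site_prod (gl k) [set: V]%SET.
Variable x0 : XX.

Let l_bpos k : bpos (l k). Proof. by rewrite lE; exact: gS_bpos. Qed.

Lemma has_law_filter n : exists m,
  has_law (nonlinear_filter (product_measure psi0) (joint_kernel p0) l x0 n.+1) m /\
  forall f, bm f -> mean m f = wavg PP (full_density psi p gl x0 n) f.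
Proof.
(* All that a step needs of the preceding law are its averages of [pS], collected in [h]; this
   covers the point mass at [x0] together with laws given by densities. *)
have step rho m k h : has_law rho m -> bm h ->
    (forall z, mean m (fun x => pS [set: V]%SET x z) = h z) ->
    exists m', has_law (correct (l k) (predict (product_measure psi0) (joint_kernel p0) rho)) m' /\
      forall f, bm f -> mean m' f = wavg PP (fun z => l k z * h z) f.
  move=> rm bh hE; pose m' := dens (wdens (dens (pred_law LM p_int m)) (l_bpos k)).
  exists m'; split; first exact/has_law_correct/has_law_predict.
  move=> f bf; rewrite mean_wdens// /wavg.
  have bl := bpos_bm (l_bpos k).
  rewrite !mean_dens//; last exact: bmM.
  have hE' z : pred_law LM p_int m z = h z by exact: hE.
  congr (_ / _); apply: eq_mean => z; first by rewrite -mulrA; congr (_ * (_ * _)); exact: hE'.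
  by congr (_ * _); exact: hE'.
elim: n => [|n [m [rm mE]]].
  have bx : bm (pS [set: V]%SET x0) := bpos_bm (pS_bpos_target LM [set: V]%SET x0).
  have rx : has_law \d_x0 (dirac x0 : probability XX R) by [].
  have hx z : mean (dirac x0 : probability XX R) (fun x => pS [set: V]%SET x z) =
      pS [set: V]%SET x0 z.
    have bz := bpos_bm (pS_bpos1 LM [set: V]%SET z).
    apply: EFin_inj; rewrite EFin_mean// integral_dirac//.
      by rewrite diracT mul1e.
    by apply/measurable_EFinP; exact: bm_meas.
  have [m' [rm' mE']] := step _ _ 1%N _ rx bx hx.
  exists m'; split => // f bf; rewrite mE'//.
  by rewrite /full_density/= /first_density -lE.
have bfd := full_density_bpos psi LM gl_bpos x0 n.
set fd := full_density psi p gl x0 n in mE bfd.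
have bq : bm (fun z => qS psi p [set: V]%SET fd z / mean PP fd).
  by apply: bmM; [exact: bpos_bm (qS_bpos psi LM _ bfd)|exact: bm_cst].
have hq z : mean m (fun x => pS [set: V]%SET x z) =
    qS psi p [set: V]%SET fd z / mean PP fd.
  rewrite mE; last exact: bpos_bm (pS_bpos1 LM _ z).
  by rewrite /wavg qSE; congr (_ / _); apply: eq_mean => x; rewrite mulrC.
have [m' [rm' mE']] := step _ m n.+2 _ rm bq hq.
exists m'; split => // f bf; rewrite mE'//.
have -> : (fun z => l n.+2 z * (qS psi p [set: V]%SET fd z / mean PP fd)) =
    (fun z => (mean PP fd)^-1 * full_density psi p gl x0 n.+1 z).
  by apply/funext => z; rewrite lE mulrA mulrC.
rewrite wavg_scale//; last exact: (full_density_bpos psi LM gl_bpos x0 n.+1).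
by rewrite invr_eq0 lt0r_neq0// mean_gt0.
Qed.

End filter_laws.

(** * Blocking of an empirical measure *)

Section blocking_law.
Context (R : realType) (V : finType) (d : V -> measure_display)
  (T : forall v, measurableType (d v)).
Local Notation XX := (product_space T).
Variable P : {set {set V}}.
Hypothesis partP : finset.partition P [set: V]%SET.
Local Notation split := (@split_blocks V d T P).
Local Notation PB := {K : {set V} | K \in P}.
Local Notation BB := (product_space (fun K : PB => block_space T (val K))).

Definition merge_blocks (y : BB) : XX := fun v =>
  y (exist _ (finset.pblock P v) (pblockP partP v)) (exist _ v (mem_pblockP partP v)).

Lemma measurable_merge_blocks : measurable_fun setT merge_blocks.
Proof.
apply: measurable_to_product => v.
by have := measurableT_comp
  (@measurable_coord _ _ (fun u : {u : V | u \in finset.pblock P v} => T (val u))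
     (exist _ v (mem_pblockP partP v)))
  (@measurable_coord _ _ (fun K : PB => block_space T (val K))
     (exist _ (finset.pblock P v) (pblockP partP v))).
Qed.

Lemma merge_blocksK (y : BB) : split (merge_blocks y) = y.
Proof.
apply: functional_extensionality_dep => -[K KP].
apply: functional_extensionality_dep => -[v vK] /=.
rewrite /split_blocks /block_restrict/= /merge_blocks.
(* The membership proofs inserted by [merge_blocks] are identified with the given ones by proof
   irrelevance. *)
have E := pblock_eq partP KP vK.
move: (pblockP partP v) (mem_pblockP partP v); rewrite E => KP' vK'.
by rewrite (Prop_irrelevance KP KP') (Prop_irrelevance vK vK').
Qed.

Lemma split_blocksK : cancel (split) merge_blocks.
Proof. by move=> x; apply: functional_extensionality_dep. Qed.

Variable n : nat.
Hypothesis n_gt0 : (0 < n)%N.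
Variable X : product_space (fun _ : 'I_n => XX).
Local Notation idx := {ffun {set V} -> 'I_n}.
Let i0 : 'I_n := Ordinal n_gt0.

Let emp_marg K : probability (block_space T K) R :=
  unif R i0 (fun i => block_restrict (K := K) (X i)).

Let marginal_law (K : PB) : has_law (@marginal R V d T (val K) (empirical R X))
  (emp_marg (val K)).
Proof.
move=> A mA; rewrite /emp_marg/= unifE /marginal /pushforward /empirical card_ord.
by rewrite EFinM -sumEFin.
Qed.

Fixpoint set_blocks (c : idx) (s : seq PB) (y : BB) : BB := if s is K :: s' then
  set_blocks c s' (dfwith y K (block_restrict (K := val K) (X (c (val K)))))
  else y.

Let measurable_set_blocks c s : measurable_fun setT (set_blocks c s).
Proof.
elim: s => [|K s IH] /=; first exact: measurable_id.
by have := measurableT_comp IH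
  (@measurable_dfwith2 _ _ (fun K : PB => block_space T (val K)) K
     (block_restrict (K := val K) (X (c (val K))))).
Qed.

Let eq_set_blocks (c c' : idx) (s : seq PB) (y : BB) : (forall K, K \in s -> c (val K) = c' (val K)) ->
  set_blocks c s y = set_blocks c' s y.
Proof.
elim: s y => [//|K s IH] y H /=.
by rewrite H ?inE ?eqxx// IH// => K' K's; rewrite H// inE K's orbT.
Qed.

(** Integrating over a block averages over the value of [c] there; since the remaining blocks do not
    read this value, [sum_idx_resample] absorbs the average into the sum over [c]. *)
Let iterated_blocks (B : set BB) s y : measurable B -> uniq s ->
  iterated_integral (fun K : PB => @marginal R V d T (val K) (empirical R X)) s
    (fun y => (\1_B y)%:E) y =
  (#|{: idx}|%:R^-1 * \sum_(c : idx) \1_B (set_blocks c s y))%:E.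
Proof.
move=> mB; have c0 := lt0r_neq0 (card_idx_gt0 R {set V} n_gt0).
have n0 : (n%:R : R) != 0 by rewrite pnatr_eq0 -lt0n.
elim: s y => [|K s IH] y /=.
  move=> _; rewrite (eq_bigr (fun=> \1_B y)) => [|c _//].
  by rewrite sumr_const -[X in _ * X]mulr_natl mulKf.
move=> /andP[Ks us].
pose W (i : 'I_n) (c : idx) : R :=
  \1_B (set_blocks c s (dfwith y K (block_restrict (K := val K) (X i)))).
transitivity ((\int[@marginal R V d T (val K) (empirical R X)]_z
    (#|{: idx}|%:R^-1 * \sum_(c : idx) \1_B (set_blocks c s (dfwith y K z)))%:E)%E).
  congr (integral _ _ _); apply/funext => z; exact: (IH (dfwith y K z) us).
have bF : bm (fun z : block_space T (val K) =>
    #|{: idx}|%:R^-1 * \sum_(c : idx) (\1_B (set_blocks c s (dfwith y K z)) : R)).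
  apply: bmM; first exact: bm_cst.
  apply: bm_sum => c _; apply: (bm_comp (bm_indic R mB)).
  by have := measurableT_comp (measurable_set_blocks c s)
    (@measurable_dfwith1 _ _ (fun K : PB => block_space T (val K)) K y).
rewrite (integral_has_lawT (@marginal_law K) bF) mean_unif// card_ord; congr _%:E.
rewrite -mulr_sumr mulrCA; congr (_ * _).
transitivity (n%:R^-1 * \sum_i \sum_c W i c) => //.
rewrite -(sum_idx_resample n_gt0 (b := val K) (W := W)) ?mulKf//.
move=> i c c' cc'; rewrite /W; congr (\1_B _); apply: eq_set_blocks => K' K's.
apply: cc'; apply: contraNneq Ks => /val_inj <-; exact: K's.
Qed.

Let set_blocksE (c : idx) (s : seq PB) (y : BB) (K : PB) :
  (set_blocks c s y : forall K : PB, block_space T (val K)) K =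
  (if K \in s then block_restrict (K := val K) (X (c (val K)))
   else (y : forall K : PB, block_space T (val K)) K).
Proof.
elim: s y => [//|K' s IH] y /=; rewrite IH inE.
case: (K \in s); first by rewrite orbT.
rewrite orbF; have [e|ne] := eqVneq K K'.
  by subst K'; rewrite dfwithin.
by rewrite dfwithout// eq_sym.
Qed.

Lemma has_law_blocking : has_law (blocking P (empirical R X))
  (unif R [ffun=> i0] (fun c : idx => glue P c X)).
Proof.
move=> A mA; rewrite [RHS]unifE /blocking /product_measure.
(* The image under [split] is the preimage under its measurable inverse. *)
have mB : measurable (split @` A : set BB).
  have -> : split @` A = merge_blocks @^-1` A.
    apply/seteqP; split => [_ [x Ax <-]|y Ay] /=; first by rewrite split_blocksK.
    by exists (merge_blocks y) => //; rewrite merge_blocksK.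
  by rewrite -[_ @^-1` _]setTI; exact: measurable_merge_blocks.
rewrite iterated_blocks ?enum_uniq//; congr (_ * _)%:E; apply: eq_bigr => c _.
have -> : set_blocks c (enum {: PB}) point = split (glue P c X).
  apply: functional_extensionality_dep => K; rewrite set_blocksE mem_enum/=.
  apply: functional_extensionality_dep => v; rewrite /block_restrict /split_blocks /glue.
  by rewrite /block_restrict (pblock_eq partP (valP K) (valP v)).
rewrite !indicE; congr (nat_of_bool _)%:R; apply/idP/idP => /set_mem h; apply/mem_set.
  by case: h => x Ax /(can_inj split_blocksK) <-.
by exists (glue P c X).
Qed.

End blocking_law.

Section L2_norm.
Context (R : realType) d (T : measurableType d) (Pr : probability T R).

Lemma Lnorm2_le (F : T -> \bar R) (h : T -> R) (r : R) :
  (forall w, F w = (h w)%:E) -> bm h -> mean Pr (fun w => h w ^+ 2) <= r ^+ 2 -> 0 <= r ->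
  (Lnorm Pr 2%:E F <= r%:E)%E.
Proof.
move=> Fh bh hr r0.
have -> : Lnorm Pr 2%:E F = (Num.sqrt (mean Pr (fun w => h w ^+ 2)))%:E.
  rewrite unlock.
  have -> : (\int[Pr]_x (`|F x| `^ 2))%E = (mean Pr (fun w => h w ^+ 2))%:E.
    rewrite EFin_mean; last exact: bm_sqr.
    apply: eq_integral => w _; rewrite Fh abse_EFin poweR_EFin.
    by rewrite powR_mulrn// real_normK ?num_real.
  by rewrite poweR_EFin powR12_sqrt// mean_ge0// => w; exact: sqr_ge0.
rewrite lee_fin -[leRHS]ger0_norm// -sqrtr_sqr ler_sqrt//; exact: sqr_ge0.
Qed.

End L2_norm.

(** * Law of the block particle filter *)

Section particle_filter_law.
Context (R : realType) (V : finType) (d : V -> measure_display)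
  (T : forall v, measurableType (d v)).
Local Notation XX := (product_space T).
Variables (psi0 : forall v, {measure set (T v) -> \bar R})
  (psi : forall v, probability (T v) R) (c : V -> R).
Hypothesis c_gt0 : forall v, 0 < c v.
Hypothesis psi0E : forall v (f : T v -> \bar R), measurable_fun setT f ->
  (forall z, (0 <= f z)%E) ->
  (\int[psi0 v]_z f z = (c v)%:E * \int[psi v]_z f z)%E.
Local Notation PP := (prodP psi : probability XX R).
Variable p0 : forall v, XX -> T v -> R.
Variables (N : V -> {set V}) (Dl : nat) (e lam sig : R).
Variable p : forall v, XX -> T v -> R.
Arguments p : clear implicits.
Arguments p0 : clear implicits.
Hypothesis LM : local_model N Dl e lam sig p.
Hypothesis pE : forall v x z, p v x z = c v * p0 v x z.
Hypothesis p_int : forall v x, mean (psi v) (p v x) = 1.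
Variable P : {set {set V}}.
Hypothesis partP : finset.partition P [set: V]%SET.
Variable gl : nat -> forall v, T v -> R.
Arguments gl : clear implicits.
Variable kap : R.
Hypothesis kap_gt0 : 0 < kap.
Hypothesis kap_le1 : kap <= 1.
Hypothesis gl_bnd : forall k v (x : T v), kap <= gl k v x <= kap^-1.
Hypothesis gl_meas : forall k v, measurable_fun setT (gl k v).
Variable l : nat -> XX -> R.
Hypothesis lE : forall k, l k = site_prod (gl k) [set: V]%SET.
Variable x0 : XX.
Variable n : nat.
Hypothesis n_gt0 : (0 < n)%N.
Local Notation SS := (product_space (fun _ : 'I_n => XX)).
Context dO (Omega : measurableType dO) (Pr : probability Omega R).
Variable xi : nat -> 'I_n -> Omega -> XX.
Variable hpi : nat -> Omega -> set XX -> \bar R.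
Hypothesis hpi_filter : block_particle_filter (product_measure psi0) (joint_kernel p0)
  l x0 Pr P xi hpi.

(** The sample [xi j] is drawn at time [j.+1]; at time 0 all particles are placed at [x0], which
    reproduces the point mass. *)
Definition particles k (w : Omega) : SS :=
  if k is j.+1 then fun i => xi j i w else fun=> x0.

Local Notation empP := (empP P kap_gt0 gl_bnd gl_meas n_gt0).

Let gS_bp k S : bpos (site_prod (gl k) S : XX -> R) :=
  site_prod_bpos kap_gt0 (gl_bnd k) (gl_meas k) S.

Lemma measurable_particles k : measurable_fun setT (particles k).
Proof.
apply: measurable_to_product => i; case: k => [|k] /=; first exact: measurable_cst.
by have [_ H _] := hpi_filter; have [] := H k.
Qed.

Lemma emp_const k f : emp P (gl k) ((fun=> x0) : SS) f = f x0.
Proof.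
set X0 : SS := fun=> x0.
have gx (c' : {ffun {set V} -> 'I_n}) : glue P c' X0 = x0.
  by apply: functional_extensionality_dep.
rewrite /emp; set a := site_prod (gl k) [set: V]%SET x0.
have a0 : 0 < a := bpos_gt0 x0 (gS_bp k [set: V]%SET).
rewrite (eq_bigr (fun=> f x0 * a)) => [|c' _]; last by rewrite gx.
rewrite !sumr_const -[X in X / _]mulr_natl -[X in _ / X]mulr_natl mulrCA mulfK//.
by rewrite lt0r_neq0// mulr_gt0// card_idx_gt0.
Qed.

Lemma has_law_hpi k w : has_law (hpi k w) (empP k (particles k w)).
Proof.
have [h0 _ hS] := hpi_filter; case: k => [|k].
  have rx : has_law (hpi 0%N w) (dirac x0 : probability XX R) by move=> A mA; rewrite h0.
  apply: (eq_has_law rx) => f bf; rewrite mean_empP// emp_const.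
  apply: EFin_inj; rewrite EFin_mean// integral_dirac//; first by rewrite diracT mul1e.
  by apply/measurable_EFinP; exact: bm_meas.
rewrite hS; have bl : bpos (l k.+1) by rewrite lE; exact: gS_bp.
have hb := has_law_blocking R partP n_gt0 (particles k.+1 w).
have hc := has_law_correct bl hb.
have hd := eq_has_law (m' := empP k.+1 (particles k.+1 w)) hc.
apply hd => f bf; rewrite mean_wdens// [RHS]mean_wdens//.
by rewrite /wavg lE.
Qed.

Let history_particles k (H : set SS) : measurable H ->
  history xi k (particles k @^-1` H).
Proof.
pose G := [set H : set Omega | exists (j : nat) (i : 'I_n) (B : set XX),
  [/\ (j < k)%N, measurable B & H = xi j i @^-1` B]].
move=> mH.
have : @measurable _ (g_sigma_algebraType G) (setT `&` particles k @^-1` H).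
  (* Measurability with respect to the history is measurability on [Omega] equipped with the
     sigma-algebra generated by [G]. *)
  have mp : @measurable_fun _ _ (g_sigma_algebraType G) SS setT (particles k).
    apply: (@measurable_to_product _ _ _ _ (g_sigma_algebraType G)) => i.
    case: k @G => [|k] G /=; first exact: measurable_cst.
    move=> _ B mB; rewrite setTI; apply: sub_sigma_algebra.
    by exists k, i, B.
  exact: mp.
by rewrite setTI.
Qed.

Lemma particles_law k (H : set SS) (A : 'I_n -> set XX) : measurable H ->
  (forall i, measurable (A i)) ->
  Pr (particles k @^-1` H `&` [set w | forall i, A i (particles k.+1 w i)]) =
  (\int[Pr]_(w in particles k @^-1` H)
     \prod_(i < n) dens (pred_law LM p_int (empP k (particles k w))) (A i))%E.
Proof.
move=> mH mA; have [_ /(_ k)[_ law] _] := hpi_filter.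
rewrite (law _ A (history_particles mH) mA); apply: eq_integral => w _.
apply: eq_bigr => i _.
exact: (has_law_predict c_gt0 psi0E LM pE p_int (@has_law_hpi k w)).
Qed.

Variables (Qn : {set V} -> {set {set V}}) (DK M : nat).
Hypothesis Qn_sub : forall K, K \in P -> Qn K \subset P.
Hypothesis Qn_cover : forall K v, K \in P -> v \in K -> N v \subset finset.cover (Qn K).
Hypothesis Qn_self : forall K, K \in P -> K \in Qn K.
Hypothesis Qn_card : forall K, K \in P -> (#|Qn K| <= DK)%N.
Hypothesis K_card : forall K, K \in P -> (#|K| <= M)%N.
Hypothesis rho_small : rho Dl sig * DK%:R <= 2^-1.
Variable om : {set V} -> V -> R.
Hypothesis om_slow : forall K, K \in P -> slow N (om K).
Hypothesis om_le1 : forall K v, om K v <= 1.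
Hypothesis om_out : forall K v, K \in P -> v \notin K -> om K v = 1.
Hypothesis om_bdry : forall K v, K \in P -> v \in K -> ~~ (N v \subset K) -> om K v = 1.

Lemma noise_bound_ge0 j : 0 <= noise_bound e kap n DK M j.
Proof.
have e0 := e_gt0 LM.
rewrite /noise_bound /node_bound /blk_bound /sample_err.
by rewrite addr_ge0 ?mulr_ge0 ?invr_ge0 ?exprn_ge0 ?sqrtr_ge0 ?mulr_ge0 ?invr_ge0 ?exprn_ge0// ltW.
Qed.

Lemma filter_error k K (J : {set V}) : K \in P -> J \subset K ->
  (local_norm Pr J
     (fun=> nonlinear_filter (product_measure psi0) (joint_kernel p0) l x0 k) (hpi k) <=
   (if #|J| == 0%N then 0 else
      \sum_(v in J) om K v + noise_bound e kap n DK M #|J|)%:E)%E.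
Proof.
move=> KP JK; apply: ub_ereal_sup => _ [f [mf f1 lf]] <-.
have bf : bm f by split => //; exists 1.
have om0 : 0 <= \sum_(v in J) om K v by apply: sumr_ge0 => v _; have [] := om_slow KP.
have bE : bm (fun w => mean (empP k (particles k w)) f).
  split; last by exists 1 => w; exact: mean_norm_le.
  have -> : (fun w => mean (empP k (particles k w)) f) =
      (fun w => emp P (gl k) (particles k w) f).
    by apply/funext => w; rewrite mean_empP.
  have m1 : measurable_fun setT (fun X : SS => emp P (gl k) X f).
    apply: bm_meas; apply: bm_div; last exact: (sum_site_bpos P kap_gt0 gl_bnd gl_meas n_gt0 k).
    apply: bm_sum => c' _; apply: bmM.
      exact: bm_comp bf (measurable_glue P c').
    exact: bm_comp (bpos_bm (gS_bp _ _)) (measurable_glue P c').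
  exact: measurableT_comp m1 (measurable_particles _).
have hE w : (\int[hpi k w]_x (f x)%:E)%E = (mean (empP k (particles k w)) f)%:E.
  exact: integral_has_lawT (@has_law_hpi k w) bf.
have trivial_case (r : R) : 0 <= r ->
    (exists a, (\int[nonlinear_filter (product_measure psi0) (joint_kernel p0) l x0 k]_x (f x)%:E)%E = a%:E /\
       forall w, mean (empP k (particles k w)) f = a) ->
    (Lnorm Pr 2%:E (fun w => \int[nonlinear_filter (product_measure psi0) (joint_kernel p0) l x0 k]_x (f x)%:E -
        \int[hpi k w]_x (f x)%:E) <= r%:E)%E.
  move=> r0 [a [Ea Ew]]; apply: (@Lnorm2_le _ _ _ _ _ (fun=> 0)) => //.
  - by move=> w; rewrite hE Ea Ew -EFinB subrr.
  - exact: bm_cst.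
  - by rewrite expr0n/= mean_cst sqr_ge0.
(* At time 0 both filters are the point mass at [x0]. *)
case: k bE hE trivial_case => [|m] bE hE trivial_case.
  apply: trivial_case; first by case: ifP => // _; rewrite addr_ge0// noise_bound_ge0.
  exists (f x0); split; last by move=> w; rewrite mean_empP//; exact: emp_const.
  rewrite /= integral_dirac//; first by rewrite diracT mul1e.
  by apply/measurable_EFinP.
have gl_bpos k v : bpos (gl k v) := site_bpos kap_gt0 (gl_bnd k) (gl_meas k) v.
have [mu [rmu muE]] := has_law_filter c_gt0 psi0E LM pE p_int gl_bpos lE x0 m.
have nE := integral_has_lawT rmu bf.
(* For empty [J] the test functions are constant and the error vanishes, whereas [noise_bound] has a
   term without the factor [#|J|]. *)
have [J0|J0] := eqVneq #|J| 0%N.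
  apply: trivial_case => //; exists (f point).
  have fc x : f x = f point.
    by apply: lf => v; rewrite (cards0_eq J0) inE.
  split; first by rewrite nE (@eq_mean _ _ _ _ _ (fun=> f point)) ?mean_cst.
  by move=> w; rewrite (@eq_mean _ _ _ _ _ (fun=> f point)) ?mean_cst.
have nb := noise_bound_ge0 #|J|.
apply: (@Lnorm2_le _ _ _ _ _ (fun w => mean mu f - mean (empP m.+1 (particles m.+1 w)) f)).
- by move=> w; rewrite nE hE -EFinB.
- by apply: bmB => //; exact: bm_cst.
- rewrite muE//.
  have h := main_estimate partP kap_le1 Qn_sub Qn_cover Qn_self Qn_card K_card
    measurable_particles particles_law (fun w i => erefl) rho_small
    om_slow om_le1 om_out om_bdry m KP JK _ bf f1 lf.
  apply: le_trans (h _); last by rewrite lt0n.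
  rewrite le_eqVlt; apply/orP; left; apply/eqP; apply: eq_mean => w.
  by rewrite mean_empP.
- exact: addr_ge0.
Qed.

End particle_filter_law.

(** * Distances to the boundary and constants *)

Section graph_distance.
Context (R : realType) (V : finType) (adj : rel V).
Hypothesis adj_sym : symmetric adj.
Variable r : nat.
Local Notation nb := (nbhd R adj r).
Local Notation dist := (set_gdist R adj).
Implicit Types (v w u : V) (J K B : {set V}).

Lemma gdist_ge0 v w : (0 <= gdist R adj v w)%E.
Proof. by apply: le_ereal_inf_tmp => _ [s [_ _ ->]]; rewrite lee_fin. Qed.

Lemma gdist_refl v : (gdist R adj v v <= 0)%E.
Proof. by apply: ge_ereal_inf; exists 0%E => //; exists [::]; split. Qed.

Lemma nbhdP v w : reflect (exists s, [/\ path adj v s, last v s = w & (size s <= r)%N])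
  (w \in nb v).
Proof.
rewrite finset.inE; apply: (iffP (asboolP _)) => [h|[s [ps ls sr]]]; last first.
  by apply: ge_ereal_inf; exists (size s)%:R%:E; [exists s|rewrite lee_fin ler_nat].
have h1 : (gdist R adj v w < r.+1%:R%:E)%E.
  by apply: le_lt_trans h _; rewrite lte_fin ltr_nat.
have [_ [s [ps ls ->]] h2] := ereal_inf_lt h1; exists s; split => //.
by move: h2; rewrite lte_fin ltr_nat ltnS.
Qed.

Lemma nbhd_sym v w : (w \in nb v) = (v \in nb w).
Proof.
suff h a b : b \in nb a -> a \in nb b by apply/idP/idP; exact: h.
move=> /nbhdP[s [ps ls sr]]; apply/nbhdP; exists (rev (belast a s)); split.
- rewrite -ls rev_path (@eq_path _ _ adj)// => x y; exact: adj_sym.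
- by case: s ps ls sr => [//|c s] _ _ _; rewrite /= rev_cons last_rcons.
- by rewrite size_rev size_belast.
Qed.

Lemma gdist_step v u w : u \in nb v -> (gdist R adj v w <= r%:R%:E + gdist R adj u w)%E.
Proof.
move=> /nbhdP[s [ps ls sr]]; rewrite -leeBlDl//; apply: le_ereal_inf_tmp => _ [t [pt lt ->]].
rewrite leeBlDl//; apply: ge_ereal_inf; exists (size (s ++ t))%:R%:E.
  by exists (s ++ t); split => //; rewrite ?cat_path ?ps ?ls// last_cat ls.
by rewrite -EFinD lee_fin -natrD ler_nat size_cat leq_add2r.
Qed.

Lemma set_gdist_ge0 J B : (0 <= dist J B)%E.
Proof. by apply: le_ereal_inf_tmp => _ [v [w [_ _ ->]]]; exact: gdist_ge0. Qed.

Lemma set_gdist_le J B v w : v \in J -> w \in B -> (dist J B <= gdist R adj v w)%E.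
Proof. by move=> vJ wB; apply: ge_ereal_inf; exists (gdist R adj v w) => //; exists v, w. Qed.

Lemma set_gdistS J J' B : J \subset J' -> (dist J' B <= dist J B)%E.
Proof.
move=> /fintype.subsetP JJ'; apply: le_ereal_inf_tmp => _ [v [w [vJ wB ->]]].
exact: set_gdist_le (JJ' _ vJ) wB.
Qed.

Lemma set_gdist_step B v u : u \in nb v ->
  (dist [set v]%SET B <= r%:R%:E + dist [set u]%SET B)%E.
Proof.
move=> uv; rewrite -leeBlDl//; apply: le_ereal_inf_tmp => _ [u' [w [/set1P -> wB ->]]].
rewrite leeBlDl//; apply: le_trans (gdist_step w uv).
by apply: set_gdist_le wB; rewrite inE.
Qed.

End graph_distance.

Section boundary_weight.
Context (R : realType) (V : finType) (adj : rel V).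
Hypothesis adj_sym : symmetric adj.
Variable r : nat.
Hypothesis r_gt0 : (0 < r)%N.
Local Notation nb := (nbhd R adj r).
Local Notation dist := (set_gdist R adj).
Implicit Types (K J : {set V}).

(** Chosen so that a displacement by a distance of at most [r] changes the weight by a factor of at
    most 2, as [slow] requires. *)
Definition decay_rate : R := ln 2 / r%:R.

Lemma decay_rate_gt0 : 0 < decay_rate.
Proof. by rewrite divr_gt0 ?ltr0n// ln_gt0// ltr1n. Qed.

(** At infinite distance, as from an empty boundary, the value is 0. *)
Definition decay (x : \bar R) : R := fine (expeR (- (decay_rate%:E * x))).

Lemma decayE x : (0 <= x)%E -> (decay x)%:E = expeR (- (decay_rate%:E * x)).
Proof.
move=> x0; rewrite /decay fineK//; case: x x0 => [y _ //| _|//].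
by rewrite gt0_muley ?lte_fin ?decay_rate_gt0.
Qed.

Lemma decay_ge0 x : 0 <= decay x.
Proof. by rewrite fine_ge0// expeR_ge0. Qed.

Lemma decay_anti x y : (0 <= x)%E -> (x <= y)%E -> decay y <= decay x.
Proof.
move=> x0 xy; rewrite -lee_fin !decayE ?(le_trans x0)// lee_expeR leeN2.
by rewrite lee_wpmul2l// lee_fin ltW// decay_rate_gt0.
Qed.

Lemma decay0 : decay 0 = 1.
Proof. by rewrite /decay mule0 oppe0 expeR0. Qed.

Lemma decay_shift x y : (0 <= x)%E -> (0 <= y)%E -> (y <= r%:R%:E + x)%E ->
  decay x <= 2 * decay y.
Proof.
move=> x0 y0 yx; case: x x0 yx => [x x0|_ _|//]; last first.
  rewrite /decay gt0_muley ?lte_fin ?decay_rate_gt0//=.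
  by rewrite mulr_ge0// decay_ge0.
case: y y0 => [y y0|//|//]; rewrite -EFinD lee_fin => yx; rewrite /decay/=.
have r0 : (r%:R : R) != 0 by rewrite pnatr_eq0 -lt0n.
have e2 : (2 : R) = expR (ln 2) by rewrite lnK ?posrE.
rewrite [X in _ <= X * _]e2 -expRD ler_expR.
have -> : ln 2 = decay_rate * r%:R by rewrite /decay_rate divfK.
have d0 := decay_rate_gt0.
have -> : decay_rate * r%:R + - (decay_rate * y) = decay_rate * (r%:R - y) by ring.
rewrite -mulrN; apply: ler_wpM2l; first exact: ltW.
have : 0 <= r%:R + x - y by rewrite subr_ge0.
by move=> h; rewrite -subr_ge0 opprK addrAC.
Qed.

Definition bdry_weight (K : {set V}) (v : V) : R :=
  if v \in K then decay (dist [set v]%SET (boundary R adj r K)) else 1.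

Lemma bdry_weight_ge0 K v : 0 <= bdry_weight K v.
Proof. by rewrite /bdry_weight; case: ifP => // _; exact: decay_ge0. Qed.

Lemma bdry_weight_le1 K v : bdry_weight K v <= 1.
Proof.
rewrite /bdry_weight; case: ifP => // _.
by rewrite -decay0 decay_anti// set_gdist_ge0.
Qed.

Lemma bdry_weight_bdry K v : v \in K -> ~~ (nb v \subset K) -> bdry_weight K v = 1.
Proof.
move=> vK vb; rewrite /bdry_weight vK.
have -> : dist [set v]%SET (boundary R adj r K) = 0%E; last exact: decay0.
apply/eqP; rewrite eq_le set_gdist_ge0 andbT.
apply: le_trans (gdist_refl R adj v); apply: set_gdist_le; rewrite ?inE//.
by rewrite vK.
Qed.

Lemma bdry_weight_slow K : slow nb (bdry_weight K).
Proof.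
split=> [v|v u uv]; first exact: bdry_weight_ge0.
have [vK|vK] := boolP (v \in K); last first.
  rewrite [X in _ <= _ * X]/bdry_weight (negbTE vK).
  by have := bdry_weight_le1 K u; lra.
have [uK|uK] := boolP (u \in K).
  rewrite /bdry_weight vK uK; apply: decay_shift; try exact: set_gdist_ge0.
  exact: set_gdist_step.
(* A neighbour outside [K] puts [v] on the boundary, where the weight is already 1: there is no jump
   on leaving [K]. *)
rewrite (@bdry_weight_bdry K v)//; first by have := bdry_weight_le1 K u; lra.
by apply/negP => /fintype.subsetP/(_ u uv); rewrite (negbTE uK).
Qed.

Lemma sum_bdry_weight K J : J \subset K ->
  \sum_(v in J) bdry_weight K v <= #|J|%:R * decay (dist J (boundary R adj r K)).
Proof.
move=> JK; rewrite mulr_natl -sumr_const; apply: ler_sum => v vJ.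
rewrite /bdry_weight (fintype.subsetP JK _ vJ); apply: decay_anti.
  exact: set_gdist_ge0.
by apply: set_gdistS; rewrite finset.sub1set.
Qed.

End boundary_weight.

Lemma bernoulli_le (R : realType) (t : R) k : 0 <= t -> t <= 1 -> 1 - k%:R * t <= (1 - t) ^+ k.
Proof.
move=> t0 t1; elim: k => [|k IH]; first by rewrite expr0 mul0r subr0.
rewrite exprS; have h : (1 - t) * (1 - k%:R * t) <= (1 - t) * (1 - t) ^+ k.
  by rewrite ler_wpM2l// subr_ge0.
apply: le_trans h; rewrite -natr1 -subr_ge0.
have -> : (1 - t) * (1 - k%:R * t) - (1 - (k%:R + 1) * t) = k%:R * (t * t) by ring.
by rewrite !mulr_ge0.
Qed.

(** * Normalised reference measures and choice of the constants *)

Section normalized_measure.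
Context (R : realType) d (T : measurableType d) (mu : {measure set T -> \bar R}).
Variables (eps : R) (q : T -> R).
Hypothesis eps_gt0 : 0 < eps.
Hypothesis mq : measurable_fun setT q.
Hypothesis q_bnd : forall z, eps <= q z <= eps^-1.
Hypothesis q_int : (\int[mu]_z (q z)%:E = 1)%E.

Definition total_mass : R := fine (mu setT).

(** [mnormalize] falls back on the Dirac mass when the total mass is 0 or infinite, which
    [total_massE] excludes. *)
Definition normalized : probability T R := mnormalize mu (dirac point).

(** A density with values between [eps] and [eps^-1] confines the mass of its reference measure in
    the same way. *)
Lemma total_massE : mu setT = total_mass%:E /\ eps <= total_mass <= eps^-1.
Proof.
have mE : measurable_fun setT (EFin \o q) by exact/measurable_EFinP.
have q0 z : (0 <= (q z)%:E)%E.
  by rewrite lee_fin; have /andP[h _] := q_bnd z; rewrite (le_trans _ h)// ltW.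
have h1 : (eps%:E * mu setT <= 1)%E.
  rewrite -q_int -(integral_cst _ measurableT); apply: ge0_le_integral => //.
  - by move=> z _; rewrite lee_fin ltW.
  - by move=> z _; rewrite lee_fin; have /andP[] := q_bnd z.
have h2 : (1 <= eps^-1%:E * mu setT)%E.
  rewrite -q_int -(integral_cst _ measurableT); apply: ge0_le_integral => //.
  by move=> z _; rewrite lee_fin; have /andP[] := q_bnd z.
have muT : mu setT = total_mass%:E.
  rewrite /total_mass fineK// ge0_fin_numE//; move: h1; case: (mu setT) => [x _|h|//].
    exact: ltry.
  by move: h; rewrite gt0_muley ?lte_fin.
split => //; move: h1 h2; rewrite muT -!EFinM !lee_fin => h1 h2.
apply/andP; split; last by rewrite -[eps^-1]mul1r ler_pdivlMr// mulrC.
by move: h2; rewrite mulrC ler_pdivlMr// mul1r.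
Qed.

Lemma integral_normalized (f : T -> \bar R) : measurable_fun setT f ->
  (forall z, (0 <= f z)%E) ->
  (\int[mu]_z f z = total_mass%:E * \int[normalized]_z f z)%E.
Proof.
have [muT /andP[c0 _]] := total_massE; have {}c0 := lt_le_trans eps_gt0 c0.
move=> mf f0.
have ci0 : 0 <= total_mass^-1 by rewrite invr_ge0 ltW.
have -> : (\int[normalized]_z f z = \int[mscale (NngNum ci0) mu]_z f z)%E.
  apply: eq_measure_integral => A mA _; rewrite /normalized /= /mnormalize muT.
  rewrite gt_eqF//= /mscale/= muleC; congr (_ * _)%E.
rewrite ge0_integral_mscale//= muleA -EFinM mulfV ?mul1e//.
by rewrite gt_eqF.
Qed.

End normalized_measure.

(** All powers are compared with those of [(kap * e)^-1]. In [4 * DK + 3], 2 stands for the ratio of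
    transitions onto a block, twice [2 * DK] for [node_bound] and for the sampling error over the
    neighbouring blocks, and 1 for the size of the test function; [84 = 6 * 2 * 7]. *)
Lemma noise_bound_le (R : realType) (e kap : R) (n DK M j : nat) :
  0 < e -> e <= 1 -> 0 < kap -> kap < 1 -> (0 < j)%N ->
  noise_bound e kap n DK M j <= (7 + 84 * DK%:R ^+ 2) * j%:R *
    (expR ((4 * DK + 3)%:R * ln (kap * e)^-1 * M%:R) / Num.sqrt n%:R).
Proof.
move=> e0 e1 k0 k1 j0; pose g := (kap * e)^-1.
have ke0 : 0 < kap * e by rewrite mulr_gt0.
have g0 : 0 < g by rewrite invr_gt0.
have kg : kap^-1 <= g.
  by rewrite /g lef_pV2 ?posrE// ger_pMr.
have eg : e^-1 <= g.
  by rewrite /g lef_pV2 ?posrE// ger_pMl// ltW.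
have g1 : 1 <= g by rewrite (le_trans _ kg)// invf_ge1// ltW.
have -> : expR ((4 * DK + 3)%:R * ln (kap * e)^-1 * M%:R) = g ^+ ((4 * DK + 3) * M).
  rewrite expRM_natr expRM_natl lnK ?posrE//; by rewrite exprM.
set s := (Num.sqrt n%:R)^-1; have s0 : 0 <= s by rewrite invr_ge0 sqrtr_ge0.
have kpow u : kap ^- u <= g ^+ u.
  by rewrite -exprVn lerXn2r// nnegrE ltW// invr_gt0.
have epow u : e ^- u <= g ^+ u.
  by rewrite -exprVn lerXn2r// nnegrE ltW// invr_gt0.
have j1 : 1 <= (j%:R : R) by rewrite ler1n.
set L := ((4 * DK + 3) * M)%N.
have t1 : sample_err kap n M <= 7 * j%:R * (g ^+ L * s).
  rewrite /sample_err -/s -mulrA -[X in _ <= X]mulrA; apply: ler_wpM2l => //.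
  rewrite mulrA; apply: ler_wpM2r => //.
  apply: (@le_trans _ _ (g ^+ (2 * M))); first exact: kpow.
  apply: (@le_trans _ _ (g ^+ L)).
    by apply: ler_weXn2l => //; rewrite leq_mul2r addn3 orbT.
  by rewrite ler_peMl// exprn_ge0// ltW.
have t2 : 6 * (e ^- 2) ^+ M * j%:R * node_bound e kap n DK M <=
    84 * DK%:R ^+ 2 * j%:R * (g ^+ L * s).
  rewrite /node_bound /blk_bound -/s.
  have -> : 6 * (e ^- 2) ^+ M * j%:R * (2 * (kap * e) ^- (2 * (DK * M)) *
      (DK%:R * (7 * DK%:R * kap ^- (2 * (DK * M)) * e ^- M * s))) =
    84 * DK%:R ^+ 2 * j%:R * (((e ^- 2) ^+ M * (kap * e) ^- (2 * (DK * M)) *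
      kap ^- (2 * (DK * M)) * e ^- M) * s) by ring.
  apply: ler_wpM2l; first by rewrite !mulr_ge0// exprn_ge0.
  apply: ler_wpM2r => //.
  have -> : g ^+ L = g ^+ (2 * M) * g ^+ (2 * (DK * M)) * g ^+ (2 * (DK * M)) * g ^+ M.
    by rewrite -!exprD; congr (_ ^+ _); rewrite /L; ring.
  have i0 (x : R) u : 0 < x -> 0 <= x ^- u by move=> x0; rewrite invr_ge0 exprn_ge0// ltW.
  have a1 : 0 <= (e ^- 2) ^+ M by rewrite exprn_ge0// i0.
  have a2 : 0 <= (kap * e) ^- (2 * (DK * M)) by exact: i0.
  have a3 : 0 <= kap ^- (2 * (DK * M)) by exact: i0.
  have a4 : 0 <= e ^- M by exact: i0.
  have c1 : (e ^- 2) ^+ M <= g ^+ (2 * M) by rewrite -exprVn -exprM exprVn; exact: epow.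
  have c2 : (kap * e) ^- (2 * (DK * M)) <= g ^+ (2 * (DK * M)) by rewrite /g exprVn.
  apply: ler_pM (mulr_ge0 (mulr_ge0 a1 a2) a3) a4 _ (epow M).
  exact: ler_pM (mulr_ge0 a1 a2) a3 (ler_pM a1 a2 c1 c2) (kpow _).
rewrite /noise_bound; apply: le_trans (lerD t1 t2) _.
by rewrite le_eqVlt; apply/orP; left; apply/eqP; ring.
Qed.

(** [t] is such that Bernoulli's inequality gives [(1 - t) ^+ 8 >= 1 - 8 * t = B / (B + 1)], and the
    claim is [eps ^+ 8 >= B / (B + 1)] rearranged. *)
Lemma smallness_constant (R : realType) (B : R) : 1 <= B ->
  exists eps0 : R, 0 < eps0 < 1 /\
    forall eps, eps0 < eps -> B * (eps ^- 8 - 1) <= 1.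
Proof.
move=> B1; have B0 : 0 < B by lra.
pose t := (8 * (B + 1))^-1.
have d0 : 0 < 8 * (B + 1) by lra.
have t0 : 0 < t by rewrite invr_gt0.
have t1 : t < 1 by rewrite invf_lt1//; lra.
exists (1 - t); split; first by apply/andP; split; lra.
move=> eps he; have s0 : 0 < 1 - t by lra.
have e0 : 0 < eps by exact: lt_trans he.
have h1 := bernoulli_le 8 (ltW t0) (ltW t1).
have h2 : (1 - t) ^+ 8 <= eps ^+ 8.
  by apply: lerXn2r; rewrite ?nnegrE ltW.
have b1 : B + 1 != 0 by rewrite gt_eqF//; lra.
have h3 : 1 - 8 * t = B / (B + 1) by rewrite /t; field.
have h4 : B / (B + 1) <= eps ^+ 8 by rewrite -h3; exact: le_trans h1 h2.
have e8 : 0 < eps ^+ 8 by rewrite exprn_gt0.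
have h5 : B * (1 - eps ^+ 8) <= eps ^+ 8.
  by move: h4; rewrite ler_pdivrMr; [lra|lra].
have -> : B * (eps ^- 8 - 1) = B * (1 - eps ^+ 8) / eps ^+ 8.
  by field; rewrite gt_eqF.
by rewrite ler_pdivrMr// mul1r.
Qed.

Theorem theorem2p1 (R : realType) (Delta DeltaK : nat) :
  exists eps0 : R, 0 < eps0 < 1 /\
  forall (eps kappa : R) (r : nat),
    eps0 < eps < 1 -> 0 < kappa < 1 -> (1 <= r)%N ->
  exists alpha beta1 beta2 : R,
    [/\ 0 < alpha, 0 < beta1 & 0 < beta2] /\
  forall
    (* the graph and its partition *)
    (V : finType) (adj : rel V) (P : {set {set V}})
    (adj_sym : symmetric adj)
    (partP : finset.partition P [set: V]%SET)
    (Delta_eq : max_nbhd R adj r = Delta)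
    (DeltaK_eq : max_block_nbhd R adj r P = DeltaK)
    (* the hidden Markov model *)
    (X Y : V -> completePseudoMetricType R)
    (X_polish : forall v, polish (X v))
    (Y_polish : forall v, polish (Y v))
    (psi : forall v, {measure set (borel (X v)) -> \bar R})
    (phi : forall v, {measure set (borel (Y v)) -> \bar R})
    (XX := product_space (fun v => borel (X v)))
    (YY := product_space (fun v => borel (Y v)))
    (p : forall v, XX -> borel (X v) -> R)
    (g : forall v, borel (X v) -> borel (Y v) -> R)
    (p_meas : forall v, measurable_fun setT
       (fun u : (XX * borel (X v))%type => p v u.1 u.2))
    (g_meas : forall v, measurable_fun setT
       (fun u : (borel (X v) * borel (Y v))%type => g v u.1 u.2))
    (p_ge0 : forall v x z, 0 <= p v x z)
    (g_ge0 : forall v x y, 0 <= g v x y)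
    (p_density : forall v x, (\int[psi v]_z (p v x z)%:E = 1)%E)
    (g_density : forall v x, (\int[phi v]_y (g v x y)%:E = 1)%E)
    (p_local : forall v (x x' : XX) z,
       (forall u, u \in nbhd R adj r v -> x u = x' u) -> p v x z = p v x' z)
    (* the assumptions of the theorem *)
    (p_bounds : forall v x z, eps <= p v x z <= eps^-1)
    (g_bounds : forall v x y, kappa <= g v x y <= kappa^-1)
    (* the observations, the initial condition, the particles *)
    (Yobs : nat -> YY) (x0 : XX) (N : nat) (N_gt0 : (0 < N)%N)
    (dO : measure_display) (Omega : measurableType dO)
    (Pr : probability Omega R)
    (xi : nat -> 'I_N -> Omega -> XX)
    (hpi : nat -> Omega -> set XX -> \bar R)
    (l := fun (n : nat) (x : XX) => joint_density g x (Yobs n))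
    (hpi_filter : block_particle_filter (product_measure psi) (joint_kernel p)
       l x0 Pr P xi hpi)
    (n : nat) (K J : {set V}),
    K \in P -> J \subset K ->
    (local_norm Pr J
       (fun=> nonlinear_filter (product_measure psi) (joint_kernel p) l x0 n)
       (hpi n)
     <= (alpha * #|J|%:R)%:E *
        (expeR (- (beta1%:E * set_gdist R adj J (boundary R adj r K)))
         + (expR (beta2 * (max_block P)%:R) / Num.sqrt N%:R)%:E))%E.
Proof.
(* One constant for both smallness conditions: [sig_small] uses the first two factors, and the last
   one makes the contraction beat the branching number. *)
pose B : R := 64 * Delta.+1%:R ^+ 2 * DeltaK.+1%:R.
have D1 : 1 <= (Delta.+1%:R : R) by rewrite ler1n.
have DK1 : 1 <= (DeltaK.+1%:R : R) by rewrite ler1n.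
have D21 : 1 <= (Delta.+1%:R : R) ^+ 2 by rewrite exprn_ege1.
have B1 : 1 <= B.
  have : 1 * 1 <= (Delta.+1%:R : R) ^+ 2 * DeltaK.+1%:R by rewrite ler_pM.
  by rewrite /B -mulrA; lra.
have [eps0 [eps001 small]] := smallness_constant B1.
exists eps0; split => // eps kap r /andP[eps_lb eps1] /andP[kap0 kap1] r_gt0.
have /andP[eps00 _] := eps001.
have ep0 : 0 < eps by exact: lt_trans eps_lb.
(* A normalised transition density is [p] times a total mass, both between [eps] and [eps^-1]; hence
   [e ^- 4 = eps ^- 8], the power in [smallness_constant]. *)
pose e := eps ^+ 2.
have e0 : 0 < e by rewrite exprn_gt0.
have e1 : e <= 1 by rewrite exprn_ile1// ltW.
pose b2 := (4 * DeltaK + 3)%:R * ln (kap * e)^-1.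
exists (7 + 84 * DeltaK%:R ^+ 2), (decay_rate R r), b2.
have alpha1 : 1 <= 7 + 84 * DeltaK%:R ^+ 2 :> R.
  by have := sqr_ge0 (DeltaK%:R : R); lra.
split.
  split; [exact: lt_le_trans alpha1|exact: decay_rate_gt0|].
  apply: mulr_gt0; first by rewrite ltr0n addn3.
  rewrite ln_gt0// invf_gt1 ?mulr_gt0//.
  by apply: le_lt_trans kap1; rewrite ger_pMr.
move=> V adj P adj_sym partP Delta_eq DeltaK_eq X Y _ _ psi phi XX YY p g p_meas g_meas
  p_ge0 g_ge0 p_density g_density p_local p_bounds g_bounds Yobs x0 n n_gt0 dO Omega Pr
  xi hpi l hpi_filter k K J KP JK.
have mp v (x : XX) : measurable_fun setT (p v x).
  by have := measurableT_comp (p_meas v) (measurable_pair1 x).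
have mass v := total_massE ep0 (mp v point) (p_bounds v point) (p_density v point).
pose c v := total_mass (psi v).
have c_bnd v : eps <= c v <= eps^-1 by have [] := mass v.
have c0 v : 0 < c v by have /andP[h _] := c_bnd v; exact: lt_le_trans h.
pose ph v (x : XX) z := c v * p v x z.
pose psih v : probability (borel (X v)) R := normalized (psi v).
have psi0E v (f : borel (X v) -> \bar R) : measurable_fun setT f ->
    (forall z, (0 <= f z)%E) ->
    (\int[psi v]_z f z = (c v)%:E * \int[psih v]_z f z)%E.
  exact: (integral_normalized ep0 (mp v point) (p_bounds v point) (p_density v point)).
pose lam := ln (e ^- 4); pose sig := expR lam - 1.
have lamE : expR lam = e ^- 4 by rewrite lnK// posrE invr_gt0 exprn_gt0.
have sigE : sig = eps ^- 8 - 1 by rewrite /sig lamE /e -!exprM.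
have Bsig : B * sig <= 1 by rewrite sigE; exact: small.
have sig0 : 0 <= sig.
  rewrite sigE subr_ge0 invf_ge1 ?exprn_gt0// exprn_ile1// ltW//.
have ph_bnd v x z : e <= ph v x z <= e^-1.
  have /andP[h1 h2] := c_bnd v; have /andP[h3 h4] := p_bounds v x z.
  have ep0' := ltW ep0.
  by rewrite /e /ph expr2 invfM !ler_pM// (le_trans ep0').
have LM : local_model (fun v => nbhd R adj r v) Delta e lam sig ph.
  split => //.
  - by move=> v w; exact: nbhd_sym.
  - by move=> v; rewrite -Delta_eq; apply: (leq_bigmax (F := fun v => #|nbhd R adj r v|)).
  - apply: le_trans Bsig; apply: ler_wpM2r => //.
    have d0 : 0 <= 64 * (Delta.+1%:R : R) ^+ 2 by apply: mulr_ge0 => //; exact: sqr_ge0.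
    by rewrite -[leLHS]mulr1 /B ler_wpM2l.
  - move=> v; exact: measurable_funM (measurable_cst _) (p_meas v).
  - by move=> v z x x' xx'; rewrite /ph; congr (_ * _); exact: p_local.
have bp v x : bm (p v x).
  split => //; exists eps^-1 => z; have /andP[h1 h2] := p_bounds v x z.
  by rewrite ger0_norm.
have p_int v x : mean (psih v) (ph v x) = 1.
  rewrite meanZl//; apply: EFin_inj; rewrite EFinM EFin_mean//.
  by rewrite -psi0E -?p_density// => [|z]; [exact/measurable_EFinP|rewrite lee_fin].
pose gl k v x := g v x (Yobs k v).
have gl_meas k' v : measurable_fun setT (gl k' v).
  by have := measurableT_comp (g_meas v) (measurable_pair2 (Yobs k' v)).
have lE k' : l k' = site_prod (gl k') [set: V]%SET.
  by apply/funext => x; apply: eq_bigl => v; rewrite inE.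
pose Qn K := [set K' in P | `[< (set_gdist R adj K K' <= r%:R%:E)%E >]]%SET.
have QnP (K1 K2 : {set V}) (v w : V) : v \in K1 -> w \in K2 -> K2 \in P -> w \in nbhd R adj r v -> K2 \in Qn K1.
  move=> vK wK K2P; rewrite finset.inE => /asboolP h; rewrite finset.inE K2P/=.
  by apply/asboolP; apply: le_trans h; exact: set_gdist_le.
have Qn_sub (K1 : {set V}) : K1 \in P -> Qn K1 \subset P.
  by move=> _; apply/fintype.subsetP => K2; rewrite inE => /andP[].
have Qn_cover (K1 : {set V}) v : K1 \in P -> v \in K1 -> nbhd R adj r v \subset finset.cover (Qn K1).
  move=> K1P vK; apply/fintype.subsetP => w wv; apply/finset.bigcupP.
  exists (finset.pblock P w); last exact: mem_pblockP.
  by apply: QnP vK (mem_pblockP partP w) (pblockP partP w) wv.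
have Qn_self (K1 : {set V}) : K1 \in P -> K1 \in Qn K1.
  move=> K1P; have [v vK] : exists v, v \in K1.
    apply/finset.set0Pn; apply: contraTneq K1P => ->.
    by have /and3P[] := partP.
  apply: (QnP _ _ v v) => //; apply/nbhdP; by exists [::].
have Qn_card (K1 : {set V}) : K1 \in P -> (#|Qn K1| <= DeltaK)%N.
  by move=> K1P; rewrite -DeltaK_eq; exact: (leq_bigmax_cond (F := fun K => #|Qn K|)).
have K_card (K1 : {set V}) : K1 \in P -> (#|K1| <= max_block P)%N.
  by move=> K1P; exact: (leq_bigmax_cond (F := fun K : {set V} => #|K|)).
have rho_small : rho Delta sig * DeltaK%:R <= 2^-1 :> R.
  rewrite /rho; have h1 : (Delta%:R : R) * DeltaK%:R <= Delta.+1%:R ^+ 2 * DeltaK.+1%:R.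
    apply: ler_pM => //; last by rewrite ler_nat.
    apply: (@le_trans _ _ Delta.+1%:R); first by rewrite ler_nat.
    by rewrite expr2 ler_peMl.
  have h2 : 8 * (Delta%:R * DeltaK%:R) * sig <= 8 * (Delta.+1%:R ^+ 2 * DeltaK.+1%:R) * sig.
    by rewrite ler_wpM2r// ler_wpM2l.
  have h3 : 8 * (Delta.+1%:R ^+ 2 * DeltaK.+1%:R) * sig = 8^-1 * (B * sig) by rewrite /B; field.
  have -> : 8 * Delta%:R * sig * DeltaK%:R = 8 * (Delta%:R * DeltaK%:R) * sig by ring.
  apply: (le_trans h2); rewrite h3; lra.
have h := filter_error c0 psi0E LM (fun v x z => erefl) p_int partP kap0 (ltW kap1)
  (fun k' v x => g_bounds v x (Yobs k' v)) gl_meas lE n_gt0 hpi_filter Qn_sub Qn_cover Qn_self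
  Qn_card K_card rho_small (fun K1 _ => bdry_weight_slow R adj r_gt0 K1)
  (bdry_weight_le1 R adj r_gt0) _ _ k KP JK.
apply: le_trans (h _ _) _.
- by move=> K1 v _ vK; rewrite /bdry_weight (negbTE vK).
- by move=> K1 v _; exact: bdry_weight_bdry.
have [J0|J0] := eqVneq #|J| 0%N; first by rewrite J0 mulr0 mul0e.
have jj : (0 < #|J|)%N by rewrite lt0n.
rewrite -(decayE r_gt0); last exact: set_gdist_ge0.
rewrite -EFinD -EFinM lee_fin.
have s1 := sum_bdry_weight R adj r_gt0 JK.
have s2 := noise_bound_le n DeltaK (max_block P) e0 e1 kap0 kap1 jj.
rewrite mulrDr; apply: lerD; last exact: s2.
apply: le_trans s1 _; apply: ler_wpM2r; first exact: decay_ge0.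
by rewrite ler_peMl.
Qed.
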